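(* Let $f,g\in\mathcal C^\infty(\mathbb R)$ and let $(\sigma_0,\underline u_{-\infty},\underline u_{+\infty})\in\mathbb R^3$, $\underline u_{+\infty}\neq\underline u_{-\infty}$, define a strictly entropic Riemann shock (in the sense recalled in the context) such that $g'(\underline u_{+\infty})<0$ and $g'(\underline u_{-\infty})<0$. For any $0<\alpha^\ell<\theta_0^\ell$, $0<\alpha^r<\theta_0^r$ and $k_0\in\mathbb N$, $k_0\geq1$, there exist $\varepsilon_0>0$ and $C_0>0$ such that, for any $0<\varepsilon\le\varepsilon_0$, there exists a unique $(\sigma_\varepsilon,\underline U_\varepsilon)$, with $\sigma_\varepsilon\in\mathbb R$, $\underline U_\varepsilon\in\mathcal C^2(\mathbb R)$, $$\underline U_\varepsilon(0)=\frac{\underline u_{-\infty}+\underline u_{+\infty}}2,\qquad (f(\underline U_\varepsilon)-\sigma_\varepsilon\,\underline U_\varepsilon)'=\underline U_\varepsilon''+\varepsilon\,g(\underline U_\varepsilon),$$ and $$|\sigma_\varepsilon-\sigma_0|+\|\mathrm e^{\alpha^\ell|\cdot|}(\underline U_\varepsilon-\underline U_0)\|_{W^{1,\infty}(\mathbb R_-)}+\|\mathrm e^{\alpha^r\,\cdot}(\underline U_\varepsilon-\underline U_0)\|_{W^{1,\infty}(\mathbb R_+)}\leq C_0\,\varepsilon,$$ and, moreover, there also holds $$\|\mathrm e^{\theta_\varepsilon^\ell|\cdot|}(\underline U_\varepsilon-\underline u_{-\infty})-\mathrm e^{\theta_0^\ell|\cdot|}(\underline U_0-\underline u_{-\infty})\|_{L^\infty(\mathbb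 R_-)}\leq C_0\,\varepsilon,$$ $$\|\mathrm e^{\theta_\varepsilon^r\,\cdot}(\underline U_\varepsilon-\underline u_{+\infty})-\mathrm e^{\theta_0^r\,\cdot}(\underline U_0-\underline u_{+\infty})\|_{L^\infty(\mathbb R_+)}\leq C_0\,\varepsilon,$$ and, for $1\le k\le k_0$, $$\|\mathrm e^{\theta_\varepsilon^\ell|\cdot|}\underline U_\varepsilon^{(k)}-\mathrm e^{\theta_0^\ell|\cdot|}\underline U_0^{(k)}\|_{L^\infty(\mathbb R_-)}\leq C_0\,\varepsilon,\qquad \|\mathrm e^{\theta_\varepsilon^r\,\cdot}\underline U_\varepsilon^{(k)}-\mathrm e^{\theta_0^r\,\cdot}\underline U_0^{(k)}\|_{L^\infty(\mathbb R_+)}\leq C_0\,\varepsilon.$$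
   Context: Strictly entropic Riemann shock: $(\sigma_0,\underline u_{-\infty},\underline u_{+\infty})$ with $\underline u_{-\infty}\ne\underline u_{+\infty}$ satisfies (i) $g(\underline u_{+\infty})=0$, $g(\underline u_{-\infty})=0$, $f(\underline u_{+\infty})-f(\underline u_{-\infty})=\sigma_0(\underline u_{+\infty}-\underline u_{-\infty})$; (ii) $f'(\underline u_{-\infty})>\sigma_0>f'(\underline u_{+\infty})$ and, for every $\tau\in(0,1)$, with $m_\tau:=\tau\underline u_{-\infty}+(1-\tau)\underline u_{+\infty}$, $$\frac{f(m_\tau)-f(\underline u_{-\infty})}{m_\tau-\underline u_{-\infty}}>\frac{f(m_\tau)-f(\underline u_{+\infty})}{m_\tau-\underline u_{+\infty}}.$$ $\underline U_0$ is the solution of $\underline U_0'=f(\underline U_0)-f(\underline u_{+\infty})-\sigma_0(\underline U_0-\underline u_{+\infty})$, $\underline U_0(0)=\tfrac12(\underline u_{-\infty}+\underline u_{+\infty})$; it is strictly monotone and tends to $\underline u_{\pm\infty}$ at $\pm\infty$. For $\varepsilon\ge0$, $$\theta_\varepsilon^r:=\tfrac12|f'(\underline u_{+\infty})-\sigma_\varepsilon|+\tfrac12\sqrt{(f'(\underline u_{+\infty})-\sigma_\varepsilon)^2+4\varepsilon|g'(\underline u_{+\infty})|},$$ $$\theta_\varepsilon^\ell:=\tfrac12(f'(\underline u_{-\infty})-\sigma_\varepsilon)+\tfrac12\sqrt{(f'(\underline u_{-\infty})-\sigma_\varepsilon)^2+4\varepsilon|g'(\underline u_{-\infty})|}.$$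 $\mathbb R_+=[0,+\infty)$, $\mathbb R_-=(-\infty,0]$. *)

(* Defs.v *)
From Stdlib Require Import Reals.
From Coquelicot Require Import Coquelicot.
Open Scope R_scope.

(** [ex_derive_n h k] only says that [Derive_n h (k - 1)] is differentiable, and
    [Derive_n] is total: all lower orders have to be required as well. *)
Definition class_C (n : nat) (h : R -> R) : Prop :=
  (forall k x, (k <= n)%nat -> ex_derive_n h k x) /\
  (forall x, continuous (Derive_n h n) x).

Definition class_Cinf (h : R -> R) : Prop := forall n, class_C n h.

(** Lebesgue-null sets. *)
Definition negligible (N : R -> Prop) : Prop :=
  forall eta : R, 0 < eta ->
  exists a b : nat -> R,
    (forall n, a n <= b n) /\
    (forall x, N x -> exists n, a n < x < b n) /\
    (forall n, sum_f_R0 (fun k => b k - a k) n <= eta).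

(** Essential supremum of [|h|] over [D]; it is [p_infty] when [h] is not
    essentially bounded on [D]. *)
Definition Linf_norm (D : R -> Prop) (h : R -> R) : Rbar :=
  Glb_Rbar (fun M => negligible (fun x => D x /\ M < Rabs (h x))).

(** [Derive] is the pointwise derivative, so this is the W^{1,oo} norm only for
    [h] whose weak derivative on [D] is the pointwise one, e.g. [h] of class
    C^1 in the interior of the interval [D]; the value of [Derive h] at an
    endpoint of [D] is irrelevant. *)
Definition W1inf_norm (D : R -> Prop) (h : R -> R) : Rbar :=
  Rbar_plus (Linf_norm D h) (Linf_norm D (Derive h)).

Definition Rminus_half (x : R) : Prop := x <= 0.
Definition Rplus_half (x : R) : Prop := 0 <= x.

Definition strictly_entropic_shock (f g : R -> R) (s0 um up : R) : Prop :=
  um <> up /\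
  g up = 0 /\ g um = 0 /\ f up - f um = s0 * (up - um) /\
  Derive f um > s0 /\ s0 > Derive f up /\
  (forall tau, 0 < tau < 1 ->
     let m := tau * um + (1 - tau) * up in
     (f m - f um) / (m - um) > (f m - f up) / (m - up)).

(** The profile of the [eps = 0] shock, normalized at 0. *)
Definition is_profile0 (f : R -> R) (s0 um up : R) (U0 : R -> R) : Prop :=
  (forall x, is_derive U0 x (f (U0 x) - f up - s0 * (U0 x - up))) /\
  U0 0 = (um + up) / 2.

(** Here [s] is the speed associated with [eps]. *)
Definition theta_r (f g : R -> R) (up eps s : R) : R :=
  / 2 * Rabs (Derive f up - s) +
  / 2 * sqrt ((Derive f up - s) ^ 2 + 4 * eps * Rabs (Derive g up)).

Definition theta_l (f g : R -> R) (um eps s : R) : R :=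
  / 2 * (Derive f um - s) +
  / 2 * sqrt ((Derive f um - s) ^ 2 + 4 * eps * Rabs (Derive g um)).

(** [(s, U)] is a normalized travelling wave within [C0 * eps] of [(s0, U0)] in
    the weighted norms of rates [al] (left) and [ar] (right). *)
Definition is_close_profile (f g : R -> R) (s0 um up : R) (U0 : R -> R)
    (al ar C0 eps s : R) (U : R -> R) : Prop :=
  class_C 2 U /\
  U 0 = (um + up) / 2 /\
  (forall x, Derive (fun y => f (U y) - s * U y) x
             = Derive_n U 2 x + eps * g (U x)) /\
  Rbar_le
    (Rbar_plus
       (Rbar_plus (Finite (Rabs (s - s0)))
          (W1inf_norm Rminus_half (fun x => exp (al * Rabs x) * (U x - U0 x))))
       (W1inf_norm Rplus_half (fun x => exp (ar * x) * (U x - U0 x))))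
    (Finite (C0 * eps)).

(* Main.v *)
Require Import Defs.
From Stdlib Require Import Reals Lra Lia Psatz Classical ClassicalEpsilon.
From Coquelicot Require Import Coquelicot.
Open Scope R_scope.

(** In the variable [y = (U - up) / (um - up)] the end states become 1 on the left and 0 on the
    right, and the equation becomes [y'' = (F'(y) - sg) y' - eps G(y)], where [sg = s - s0],
    [F] and [G] vanish at 0 and 1, and the entropy condition says that [F < 0] in between and
    that [F'(0) < 0 < F'(1)]. The profile at [eps = 0] is [y0' = F(y0)].

    Existence. A monotone wave is a graph [y' = W(y)] in the phase plane, with
    [W' = F' - sg - eps G / W] and [W = 0] at both ends, which determines [sg]. Writing
    [W = F z] and dividing by [v (1 - v)], this boundary value problem becomes
    [z = 1 + eps q(v) A(v)], where [q = v (1 - v) / F] is regular and [A(v)] is the average over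
    [v, 1] minus the average over [0, v] of [k = G / (F z)]. No singularity is left, and for small
    [eps] the right-hand side is a contraction ([speed_factor_exists], [slope_factor_exists]). It
    also gives that [z - 1] and its Lipschitz constant are [O(eps)], and its values at the ends
    are the equations of the exact rates: [theta_eps = theta_0 z(0)] on the right,
    [theta_eps = theta_0 z(1)] on the left. The wave itself is [y = y0 o tau] with
    [tau' = z(y0 o tau)] and [tau 0 = 0], so that no new differential equation has to be solved.

    Estimates. On the right, [tau x - x = O(eps x)] controls [y - y0] with any rate smaller than
    [theta_0]. For the exact rates, [theta_eps x - theta_0 tau x] has a derivative of size
    [eps y], which is integrable, while [exp(theta_0 x) y0] has an exponentially small
    derivative ([reparametrized_decay]). The left end follows from the symmetry [y -> 1 - y],
    [x -> - x]. All derivatives of [y] are polynomials in [y'], [G(y)], [sg], [eps] and smooth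
    functions of [y], with a factor [y'] or [G(y)] in each term; these two factors are
    [y (1 - y)] times Lipschitz functions of [y], and the estimates propagate
    ([eval_close]).

    Uniqueness. Let [u] be a wave of speed [sg'] satisfying the estimate. As
    [g' < 0] at both end states, these are saddles and a maximum principle, together with the
    closeness to [y0] on a compact set, shows that [u' < 0] ([near_wave_monotone]). Then
    [u' - W(u)] satisfies a linear equation with forcing [(sg - sg') u'] of constant sign; up to
    a positive integrating factor, bounded at both ends, it is monotone and tends to 0 at both
    ends. So it vanishes, [sg' = sg], and [u = y] ([normalized_uniqueness]).

    The essential suprema in the statement are those of functions that are continuous away from
    the origin, and are compared with pointwise bounds by [Linf_norm_le] and [le_Linf_norm]. *)

(** * Comparison and decay on the line *)

Lemma dominated_increment (f df g dg : R -> R) (a b : R) :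
  a <= b ->
  (forall x, a <= x <= b -> is_derive f x (df x)) ->
  (forall x, a <= x <= b -> is_derive g x (dg x)) ->
  (forall x, a <= x <= b -> Rabs (df x) <= dg x) ->
  Rabs (f b - f a) <= g b - g a.
Proof.
  intros Hab Hf Hg Hd.
  assert (Hmm : Rmin a b = a /\ Rmax a b = b)
    by (split; [apply Rmin_left | apply Rmax_right]; lra).
  destruct Hmm as [Hmin Hmax].
  assert (Hcont : forall h dh, (forall x, a <= x <= b -> is_derive h x (dh x)) ->
     (forall x, a <= x <= b -> 0 <= dh x) -> h a <= h b).
  { intros h dh Hh Hpos.
    destruct (MVT_gen h a b dh) as [c [Hc Hc']].
    - rewrite Hmin, Hmax. intros x Hx. apply Hh. lra.
    - rewrite Hmin, Hmax. intros x Hx.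
      apply continuity_pt_filterlim, @ex_derive_continuous. exists (dh x). now apply Hh.
    - rewrite Hmin, Hmax in Hc. specialize (Hpos c Hc). nra. }
  apply Rabs_le. split.
  - enough (g a + f a <= g b + f b) by lra.
    apply (Hcont (fun x => g x + f x) (fun x => dg x + df x)).
    + intros x Hx. apply @is_derive_plus; auto.
    + intros x Hx. specialize (Hd x Hx). apply Rabs_le_between in Hd. lra.
  - enough (g a - f a <= g b - f b) by lra.
    apply (Hcont (fun x => g x - f x) (fun x => dg x - df x)).
    + intros x Hx. apply @is_derive_minus; auto.
    + intros x Hx. specialize (Hd x Hx). apply Rabs_le_between in Hd. lra.
Qed.

Lemma differentiable_continuous (h : R -> R) (x : R) : ex_derive h x -> continuous h x.
Proof. apply (@ex_derive_continuous R_AbsRing R_NormedModule). Qed.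

Lemma derive_nonneg_le (f df : R -> R) (a b : R) :
  a <= b ->
  (forall x, a <= x <= b -> is_derive f x (df x)) ->
  (forall x, a <= x <= b -> 0 <= df x) ->
  f a <= f b.
Proof.
  intros Hab Hf Hd.
  assert (H := dominated_increment (fun _ => 0) (fun _ => 0) f df a b Hab
    (fun x _ => is_derive_const 0 x) Hf).
  assert (H0 := Rabs_pos ((fun _ : R => 0) b - (fun _ : R => 0) a)).
  enough (0 <= f b - f a) by lra.
  eapply Rle_trans; [apply H0 | apply H].
  intros x Hx. change (Rabs 0 <= df x). rewrite Rabs_R0. now apply Hd.
Qed.

Lemma derive_pos_lt (f df : R -> R) (a b : R) :
  a < b ->
  (forall x, a <= x <= b -> is_derive f x (df x)) ->
  (forall x, a <= x <= b -> 0 < df x) ->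
  f a < f b.
Proof.
  intros Hab Hf Hd.
  assert (Hmm : Rmin a b = a /\ Rmax a b = b)
    by (split; [apply Rmin_left | apply Rmax_right]; lra).
  destruct Hmm as [Hmin Hmax].
  destruct (MVT_gen f a b df) as [c [Hc Hc']].
  - rewrite Hmin, Hmax. intros x Hx. apply Hf. lra.
  - rewrite Hmin, Hmax. intros x Hx.
    apply continuity_pt_filterlim, @ex_derive_continuous. exists (df x). now apply Hf.
  - rewrite Hmin, Hmax in Hc. specialize (Hd c Hc). nra.
Qed.

Lemma derive_nonpos_ge (f df : R -> R) (a b : R) :
  a <= b ->
  (forall x, a <= x <= b -> is_derive f x (df x)) ->
  (forall x, a <= x <= b -> df x <= 0) ->
  f b <= f a.
Proof.
  intros Hab Hf Hd. apply Ropp_le_cancel.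
  apply (derive_nonneg_le (fun x => - f x) (fun x => - df x)); [easy | | ].
  - intros x Hx. now apply (is_derive_opp (V := R_NormedModule)), Hf.
  - intros x Hx. specialize (Hd x Hx). lra.
Qed.

Lemma derive_neg_gt (f df : R -> R) (a b : R) :
  a < b ->
  (forall x, a <= x <= b -> is_derive f x (df x)) ->
  (forall x, a <= x <= b -> df x < 0) ->
  f b < f a.
Proof.
  intros Hab Hf Hd. apply Ropp_lt_cancel.
  apply (derive_pos_lt (fun x => - f x) (fun x => - df x)); [easy | | ].
  - intros x Hx. now apply (is_derive_opp (V := R_NormedModule)), Hf.
  - intros x Hx. specialize (Hd x Hx). lra.
Qed.

Lemma derive_bounded_lipschitz (f df : R -> R) (K a b : R) :
  (forall x, Rmin a b <= x <= Rmax a b -> is_derive f x (df x)) ->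
  (forall x, Rmin a b <= x <= Rmax a b -> Rabs (df x) <= K) ->
  Rabs (f b - f a) <= K * Rabs (b - a).
Proof.
  assert (HK : forall x, is_derive (fun x => K * x) x K).
  { intros x. auto_derive; [easy | ring]. }
  intros Hf Hd. destruct (Rle_dec a b) as [Hab | Hab].
  - rewrite Rmin_left, Rmax_right in Hf, Hd by lra.
    rewrite (Rabs_right (b - a)) by lra.
    apply Rle_trans with (K * b - K * a); [ | lra].
    apply (dominated_increment f df (fun x => K * x) (fun _ => K)); auto.
  - rewrite Rmin_right, Rmax_left in Hf, Hd by lra.
    rewrite (Rabs_left (b - a)), Rabs_minus_sym by lra.
    apply Rle_trans with (K * a - K * b); [ | lra].
    apply (dominated_increment f df (fun x => K * x) (fun _ => K)); auto; lra.
Qed.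

(** Both [N exp(-K x)] nonincreasing and [N exp(K x)] nondecreasing follow from the bound on the
    derivative, so a zero of [N] propagates in both directions. *)
Lemma gronwall_zero (N dN : R -> R) (K a b x0 : R) :
  (forall x, a <= x <= b -> is_derive N x (dN x)) ->
  (forall x, a <= x <= b -> 0 <= N x) ->
  (forall x, a <= x <= b -> Rabs (dN x) <= K * N x) ->
  a <= x0 <= b -> N x0 = 0 ->
  forall x, a <= x <= b -> N x = 0.
Proof.
  intros HN Hpos Hd Hx0 Hz x Hx.
  destruct (Rle_dec x0 x) as [H | H].
  - assert (HH : N x * exp (- K * x) <= N x0 * exp (- K * x0)).
    { apply (derive_nonpos_ge (fun x => N x * exp (- K * x))
        (fun x => dN x * exp (- K * x) + N x * (- K * exp (- K * x)))); [easy | | ].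
      - intros t Ht. assert (Hdt := HN t ltac:(lra)).
        auto_derive; [now exists (dN t) | ].
        change (Derive (fun x => N x) t) with (Derive N t).
        rewrite (is_derive_unique N t (dN t) Hdt).
        ring.
      - intros t Ht. specialize (Hd t ltac:(lra)). apply Rabs_le_between in Hd.
        assert (He := exp_pos (- K * t)). nra. }
    rewrite Hz in HH. specialize (Hpos x Hx). assert (He := exp_pos (- K * x)). nra.
  - assert (HH : (N x * exp (K * x)) <= (N x0 * exp (K * x0))).
    { apply (derive_nonneg_le (fun x => (N x * exp (K * x)))
        (fun x => (dN x * exp (K * x) + N x * (K * exp (K * x))))); [lra | | ].
      - intros t Ht. assert (Hdt := HN t ltac:(lra)).
        auto_derive; [now exists (dN t) | ].
        change (Derive (fun x => N x) t) with (Derive N t).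
        rewrite (is_derive_unique N t (dN t) Hdt).
        ring.
      - intros t Ht. specialize (Hd t ltac:(lra)). apply Rabs_le_between in Hd.
        assert (He := exp_pos (K * t)). nra. }
    rewrite Hz in HH. specialize (Hpos x Hx). assert (He := exp_pos (K * x)). nra.
Qed.

Definition vanishes_at_infinity (h : R -> R) : Prop :=
  forall e, 0 < e -> exists M, forall x, M <= Rabs x -> Rabs (h x) <= e.

Lemma increasing_vanishing_zero (h dh : R -> R) :
  (forall x, is_derive h x (dh x)) -> (forall x, 0 <= dh x) ->
  vanishes_at_infinity h -> forall x, h x = 0.
Proof.
  intros Hh Hd Hv x.
  assert (Hm : forall a b, a <= b -> h a <= h b).
  { intros a b Hab. now apply (derive_nonneg_le h dh). }
  assert (Hle : forall e, 0 < e -> Rabs (h x) <= e).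
  { intros e He. destruct (Hv e He) as [M HM].
    set (T := Rmax M (Rabs x)).
    assert (HT1 := Rmax_l M (Rabs x)). assert (HT2 := Rmax_r M (Rabs x)). fold T in HT1, HT2.
    assert (Hx := Rabs_le_between x T). destruct Hx as [Hx _]. specialize (Hx HT2).
    assert (HT0 : 0 <= T) by lra.
    assert (H1 := HM T ltac:(rewrite Rabs_right; lra)).
    assert (H2 := HM (- T) ltac:(rewrite Rabs_Ropp, Rabs_right; lra)).
    apply Rabs_le_between in H1. apply Rabs_le_between in H2.
    assert (H3 := Hm x T ltac:(lra)). assert (H4 := Hm (- T) x ltac:(lra)).
    apply Rabs_le. lra. }
  destruct (Req_dec (h x) 0) as [H | H]; [easy | ].
  assert (H1 := Rabs_pos_lt _ H). specialize (Hle (Rabs (h x) / 2) ltac:(lra)). lra.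
Qed.

Lemma exp_diff_le (a b : R) : Rabs (exp b - exp a) <= (exp a + exp b) * Rabs (b - a).
Proof.
  apply (derive_bounded_lipschitz exp exp).
  - intros x _. apply is_derive_exp.
  - intros x Hx. rewrite Rabs_right by (left; apply exp_pos).
    assert (H1 := exp_pos a). assert (H2 := exp_pos b).
    assert (Hle : forall u v, u <= v -> exp u <= exp v).
    { intros u v [H | ->]; [left; now apply exp_increasing | lra]. }
    destruct (Rle_dec a b).
    + rewrite Rmax_right in Hx by lra. specialize (Hle x b). lra.
    + rewrite Rmax_left in Hx by lra. specialize (Hle x a). lra.
Qed.

Lemma exp_le (a b : R) : a <= b -> exp a <= exp b.
Proof. intros [H | ->]; [left; now apply exp_increasing | lra]. Qed.

Lemma linear_exp_le (c x : R) : 0 < c -> 0 <= x -> x * exp (- c * x) <= / c.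
Proof.
  intros Hc Hx.
  assert (H := exp_ineq1_le (c * x)).
  replace (- c * x) with (- (c * x)) by ring. rewrite exp_Ropp.
  assert (He := exp_pos (c * x)).
  apply Rmult_le_reg_r with (exp (c * x)); [easy | ].
  rewrite Rmult_assoc, Rinv_l by lra.
  apply Rmult_le_reg_l with c; [easy | ].
  replace (c * (/ c * exp (c * x))) with (exp (c * x)) by (field; lra). lra.
Qed.

Lemma exp_decay_increment (h dh : R -> R) (A c : R) :
  0 < c ->
  (forall x, 0 <= x -> is_derive h x (dh x)) ->
  (forall x, 0 <= x -> Rabs (dh x) <= A * exp (- c * x)) ->
  forall x, 0 <= x -> Rabs (h x - h 0) <= A / c.
Proof.
  intros Hc Hh Hd x Hx.
  assert (HA : 0 <= A).
  { specialize (Hd 0 ltac:(lra)). rewrite Rmult_0_r, exp_0 in Hd.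
    assert (H := Rabs_pos (dh 0)). lra. }
  assert (H := dominated_increment h dh (fun x => - (A / c) * exp (- c * x))
     (fun x => A * exp (- c * x)) 0 x Hx).
  cbv beta in H. rewrite Rmult_0_r, exp_0 in H.
  assert (He := exp_pos (- c * x)).
  assert (HAc : 0 <= A / c).
  { apply Rmult_le_pos; [easy | ]. left. now apply Rinv_0_lt_compat. }
  eapply Rle_trans; [apply H | nra].
  - intros t Ht. apply Hh. lra.
  - intros t Ht. auto_derive; [easy | ]. field. lra.
  - intros t Ht. apply Hd. lra.
Qed.

Lemma ex_antiderivative (c : R -> R) :
  (forall x, continuous c x) -> exists B : R -> R, forall x, is_derive B x (c x).
Proof.
  intros Hc. exists (fun x => RInt c 0 x). intros x.
  apply is_derive_RInt with 0; [ | apply Hc].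
  exists (mkposreal 1 Rlt_0_1). intros y _. apply (@RInt_correct R_CompleteNormedModule).
  apply (@ex_RInt_continuous R_CompleteNormedModule). intros; apply Hc.
Qed.

(** * Essential supremum *)

(** Length of the part to the left of [x] of the first [n + 1] intervals, counted with
    multiplicity. *)
Definition covered_length (a b : nat -> R) (n : nat) (x : R) : R :=
  sum_f_R0 (fun k => Rmax 0 (Rmin (x - a k) (b k - a k))) n.

Lemma covered_length_incr (a b : nat -> R) (n m : nat) (x y : R) :
  (n <= m)%nat -> x <= y -> covered_length a b n x <= covered_length a b m y.
Proof.
  intros Hnm Hxy. unfold covered_length.
  apply Rle_trans with (sum_f_R0 (fun k => Rmax 0 (Rmin (y - a k) (b k - a k))) n).
  - apply sum_Rle. intros k _. apply Rle_max_compat_l, Rle_min_compat_r. lra.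
  - induction Hnm as [ | m Hnm IH]; [lra | ]. simpl.
    assert (H := Rmax_l 0 (Rmin (y - a (S m)) (b (S m) - a (S m)))). lra.
Qed.

Lemma covered_length_step (a b : nat -> R) (n i : nat) (x y : R) :
  (i <= n)%nat -> a i <= x -> x <= y -> y <= b i ->
  y - x + covered_length a b n x <= covered_length a b n y.
Proof.
  intros Hin Hx Hxy Hy. unfold covered_length.
  set (F := fun t k => Rmax 0 (Rmin (t - a k) (b k - a k))).
  change (y - x + sum_f_R0 (F x) n <= sum_f_R0 (F y) n).
  assert (Hinc : forall k, F x k <= F y k).
  { intros k. apply Rle_max_compat_l, Rle_min_compat_r. lra. }
  assert (Hi : y - x + F x i <= F y i).
  { unfold F. rewrite !Rmin_left, !Rmax_right by lra. lra. }
  induction n as [ | n IH].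
  - replace i with 0%nat in Hi by lia. exact Hi.
  - simpl. destruct (Nat.eq_dec i (S n)) as [-> | H].
    + assert (sum_f_R0 (F x) n <= sum_f_R0 (F y) n) by (apply sum_Rle; auto). lra.
    + specialize (IH ltac:(lia)). specialize (Hinc (S n)). lra.
Qed.

(** A continuity argument in place of compactness: the points [x] such that [a, x] is no longer
    than the length covered to the left of [x] by finitely many of the intervals form a set
    whose supremum cannot be smaller than [b], since the interval containing the supremum pushes
    it further. *)
Lemma interval_not_negligible (N : R -> Prop) (a b : R) :
  a < b -> (forall x, a <= x <= b -> N x) -> ~ negligible N.
Proof.
  intros Hab HN Hneg.
  destruct (Hneg ((b - a) / 2) ltac:(lra)) as [l [r [Hlr [Hcov Hsum]]]].
  set (E := fun x => a <= x <= b /\ exists n, x - a <= covered_length l r n x).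
  destruct (completeness E) as [S [HS1 HS2]].
  - exists b. intros x [Hx _]. lra.
  - exists a. split; [lra | ]. exists 0%nat.
    unfold covered_length. simpl. rewrite Rminus_diag. apply Rmax_l.
  - assert (HaS : a <= S).
    { apply HS1. split; [lra | ]. exists 0%nat.
      unfold covered_length. simpl. rewrite Rminus_diag. apply Rmax_l. }
    assert (HSb : S <= b) by (apply HS2; intros x [Hx _]; lra).
    destruct (Hcov S (HN S (conj HaS HSb))) as [i [Hi1 Hi2]].
    assert (Hx : exists x, E x /\ l i < x).
    { apply NNPP. intros Hno. apply (Rlt_irrefl S).
      apply Rle_lt_trans with (l i); [ | easy].
      apply HS2. intros x HEx. apply Rnot_lt_le. intros Hlt. apply Hno. now exists x. }
    destruct Hx as [x [HEx Hlx]]. assert (HxS := HS1 x HEx).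
    destruct HEx as [Hxab [n Hn]].
    assert (Hstep : forall y, x <= y -> y <= r i -> y <= b -> E y).
    { intros y Hxy Hyr Hyb. split; [lra | ].  exists (Nat.max n i).
      assert (H1 := covered_length_step l r (Nat.max n i) i x y ltac:(lia) ltac:(lra) Hxy Hyr).
      assert (H2 := covered_length_incr l r n (Nat.max n i) x x ltac:(lia) ltac:(lra)).
      lra. }
    assert (HSeq : S = b).
    { destruct (Req_dec S b) as [ | Hne]; [easy | ].
      assert (H := HS1 (Rmin ((S + r i) / 2) b)).
      unfold Rmin in H. destruct (Rle_dec ((S + r i) / 2) b).
      - specialize (H ltac:(apply Hstep; lra)). lra.
      - specialize (H ltac:(apply Hstep; lra)). lra. }
    destruct (Hstep b) as [_ [m Hm]]; [lra | lra | lra | ].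
    specialize (Hsum m).
    assert (covered_length l r m b <= sum_f_R0 (fun k => r k - l k) m).
    { apply sum_Rle. intros k _. specialize (Hlr k).
      apply Rmax_lub; [lra | apply Rmin_r]. }
    lra.
Qed.

Lemma negligible_singleton (x0 : R) : negligible (fun x => x = x0).
Proof.
  intros eta Heta.
  exists (fun k => match k with O => x0 - eta / 4 | _ => 0 end),
         (fun k => match k with O => x0 + eta / 4 | _ => 0 end).
  repeat split.
  - intros [ | n]; lra.
  - intros x ->. exists 0%nat. lra.
  - intros n. induction n as [ | n IH]; simpl; [lra | ]. lra.
Qed.

Lemma negligible_subset (M N : R -> Prop) :
  (forall x, M x -> N x) -> negligible N -> negligible M.
Proof.
  intros HMN HN eta Heta. destruct (HN eta Heta) as [a [b [H1 [H2 H3]]]].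
  exists a, b. repeat split; auto.
Qed.

(** One point is exempted because the weights and the derivatives are only controlled away from
    the origin, where the two half-lines meet. *)
Lemma Linf_norm_le (D : R -> Prop) (h : R -> R) (x0 M : R) :
  (forall x, D x -> x <> x0 -> Rabs (h x) <= M) -> Rbar_le (Linf_norm D h) M.
Proof.
  intros H. unfold Linf_norm. destruct (Glb_Rbar_correct
    (fun M => negligible (fun x => D x /\ M < Rabs (h x)))) as [Hlb _].
  apply Hlb.
  apply (negligible_subset _ (fun x => x = x0)); [ | apply negligible_singleton].
  intros x [HD Hx]. apply NNPP. intros Hne. specialize (H x HD Hne). lra.
Qed.

(** By continuity a value exceeding [M] is exceeded on a whole interval, which is not
    negligible. *)
Lemma le_Linf_norm (D : R -> Prop) (h : R -> R) (x : R) :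
  locally x D -> continuous h x -> Rbar_le (Rabs (h x)) (Linf_norm D h).
Proof.
  intros HD Hc. unfold Linf_norm.
  destruct (Glb_Rbar_correct
    (fun M => negligible (fun x => D x /\ M < Rabs (h x)))) as [_ Hglb].
  apply Hglb. intros M HM. simpl. apply Rnot_lt_le. intros Hlt.
  assert (Hloc : locally x (fun y => D y /\ M < Rabs (h y))).
  { apply filter_and; [easy | ].
    assert (HcA : continuous (fun y => Rabs (h y)) x).
    { apply (continuous_comp h Rabs); [easy | ]. apply continuous_Rabs. }
    apply (HcA (fun t => M < t)). apply (open_gt M). easy. }
  destruct Hloc as [d Hd].
  refine (interval_not_negligible _ (x - d / 2) (x + d / 2) _ _ HM).
  - assert (H := cond_pos d). lra.
  - intros y Hy. apply Hd. assert (H := cond_pos d).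
    apply Rabs_lt_between. change (- d < y - x < d). lra.
Qed.

Lemma Linf_norm_nonneg (D : R -> Prop) (h : R -> R) (x : R) :
  locally x D -> Rbar_le 0 (Linf_norm D h).
Proof.
  intros HD. unfold Linf_norm.
  destruct (Glb_Rbar_correct
    (fun M => negligible (fun x => D x /\ M < Rabs (h x)))) as [_ Hglb].
  apply Hglb. intros M HM. simpl. apply Rnot_lt_le. intros Hlt.
  destruct HD as [d Hd].
  refine (interval_not_negligible _ (x - d / 2) (x + d / 2) _ _ HM).
  - assert (H := cond_pos d). lra.
  - intros y Hy. assert (H := cond_pos d). split.
    + apply Hd. apply Rabs_lt_between. change (- d < y - x < d). lra.
    + assert (H1 := Rabs_pos (h y)). lra.
Qed.

(** * Division by v (1 - v) *)

Definition lipschitz (K : R) (h : R -> R) : Prop :=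
  forall a b, Rabs (h a - h b) <= K * Rabs (a - b).

Definition clamp (x : R) : R := Rmax 0 (Rmin 1 x).

Lemma clamp_in (x : R) : 0 <= clamp x <= 1.
Proof.
  unfold clamp. split; [apply Rmax_l | ].
  apply Rmax_lub; [lra | apply Rmin_l].
Qed.

Lemma clamp_id (x : R) : 0 <= x <= 1 -> clamp x = x.
Proof. intros H. unfold clamp. rewrite Rmin_right, Rmax_right; lra. Qed.

Lemma clamp_lipschitz : lipschitz 1 clamp.
Proof.
  intros a b. unfold clamp, Rmax, Rmin.
  repeat destruct Rle_dec; unfold Rabs; repeat destruct Rcase_abs; lra.
Qed.

Lemma lipschitz_continuous (K : R) (h : R -> R) (x : R) :
  lipschitz K h -> continuous h x.
Proof.
  intros H. apply continuity_pt_filterlim. intros e He.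
  assert (HK := Rabs_pos K).
  exists (e / (Rabs K + 1)). split.
  - apply Rdiv_lt_0_compat; lra.
  - intros y [_ Hy]. simpl in *. unfold R_dist in *.
    apply Rle_lt_trans with (1 := H y x).
    assert (HK2 := Rle_abs K). assert (Hyx := Rabs_pos (y - x)).
    apply Rle_lt_trans with ((Rabs K + 1) * Rabs (y - x)); [nra | ].
    apply Rlt_le_trans with ((Rabs K + 1) * (e / (Rabs K + 1))).
    + apply Rmult_lt_compat_l; lra.
    + apply Req_le. field. lra.
Qed.

Lemma continuous_affine (k : R -> R) (u v t : R) :
  (forall x, continuous k x) -> continuous (fun s => k (u + v * s)) t.
Proof.
  intros Hk. apply (continuous_comp (fun s => u + v * s) k); [ | apply Hk].
  apply differentiable_continuous. auto_derive; easy.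
Qed.

(** Average of [k] over [v, 1] minus its average over [0, v], each written as an integral over
    [0, 1] so that [v] may reach 0 and 1. *)
Definition average_gap (k : R -> R) (v : R) : R :=
  RInt (fun t => k (v + (1 - v) * t) - k (0 + v * t)) 0 1.

Lemma ex_RInt_average_gap (k : R -> R) (v : R) :
  (forall x, continuous k x) ->
  ex_RInt (fun t => k (v + (1 - v) * t) - k (0 + v * t)) 0 1.
Proof.
  intros Hk. apply (@ex_RInt_continuous R_CompleteNormedModule).
  intros t _. apply (@continuous_minus R_UniformSpace R_AbsRing R_NormedModule);
    now apply continuous_affine.
Qed.

Lemma Rabs_minus_le (a b c d : R) : Rabs a <= c -> Rabs b <= d -> Rabs (a - b) <= c + d.
Proof.
  intros H1 H2. apply Rabs_le_between in H1. apply Rabs_le_between in H2.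
  apply Rabs_le. lra.
Qed.

Lemma average_gap_bound (k : R -> R) (B v : R) :
  (forall x, continuous k x) -> (forall x, Rabs (k x) <= B) ->
  Rabs (average_gap k v) <= 2 * B.
Proof.
  intros Hk HB. unfold average_gap.
  replace (2 * B) with ((1 - 0) * (B + B)) by ring.
  apply abs_RInt_le_const; [lra | now apply ex_RInt_average_gap | ].
  intros t _. now apply Rabs_minus_le.
Qed.

Lemma average_gap_dist (k1 k2 : R -> R) (d v : R) :
  (forall x, continuous k1 x) -> (forall x, continuous k2 x) ->
  (forall x, Rabs (k1 x - k2 x) <= d) ->
  Rabs (average_gap k1 v - average_gap k2 v) <= 2 * d.
Proof.
  intros H1 H2 Hd. unfold average_gap.
  assert (E1 := ex_RInt_average_gap k1 v H1). assert (E2 := ex_RInt_average_gap k2 v H2).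
  rewrite <- (RInt_minus (V := R_CompleteNormedModule)) by easy.
  replace (2 * d) with ((1 - 0) * (d + d)) by ring.
  apply abs_RInt_le_const; [lra | now apply (ex_RInt_minus (V := R_NormedModule)) | ].
  intros t _. unfold minus, plus, opp. simpl.
  replace (k1 (v + (1 - v) * t) - k1 (0 + v * t) + - (k2 (v + (1 - v) * t) - k2 (0 + v * t)))
    with ((k1 (v + (1 - v) * t) - k2 (v + (1 - v) * t))
          - (k1 (0 + v * t) - k2 (0 + v * t))) by ring.
  now apply Rabs_minus_le.
Qed.

Lemma average_gap_lipschitz (k : R -> R) (K v w : R) :
  lipschitz K k ->
  Rabs (average_gap k v - average_gap k w) <= 2 * K * Rabs (v - w).
Proof.
  intros HK. unfold average_gap.
  assert (Hk : forall x, continuous k x) by (intros x; now apply lipschitz_continuous with K).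
  assert (HK0 : 0 <= K).
  { specialize (HK 1 0). assert (H := Rabs_pos (k 1 - k 0)).
    rewrite Rminus_0_r, Rabs_R1 in HK. lra. }
  assert (E1 := ex_RInt_average_gap k v Hk). assert (E2 := ex_RInt_average_gap k w Hk).
  rewrite <- (RInt_minus (V := R_CompleteNormedModule)) by easy.
  replace (2 * K * Rabs (v - w)) with ((1 - 0) * (K * Rabs (v - w) + K * Rabs (v - w))) by ring.
  apply abs_RInt_le_const; [lra | now apply (ex_RInt_minus (V := R_NormedModule)) | ].
  intros t Ht. unfold minus, plus, opp. simpl.
  replace (k (v + (1 - v) * t) - k (0 + v * t) + - (k (w + (1 - w) * t) - k (0 + w * t)))
    with ((k (v + (1 - v) * t) - k (w + (1 - w) * t))
          - (k (0 + v * t) - k (0 + w * t))) by ring.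
  assert (Habs := Rabs_pos (v - w)).
  apply Rabs_minus_le.
  - eapply Rle_trans; [apply HK | ]. apply Rmult_le_compat_l; [easy | ].
    replace (v + (1 - v) * t - (w + (1 - w) * t)) with ((1 - t) * (v - w)) by ring.
    rewrite Rabs_mult, Rabs_right by lra. nra.
  - eapply Rle_trans; [apply HK | ]. apply Rmult_le_compat_l; [easy | ].
    replace (0 + v * t - (0 + w * t)) with (t * (v - w)) by ring.
    rewrite Rabs_mult, Rabs_right by lra. nra.
Qed.

(** Inside (0, 1) this expresses the gap by the primitive of [k] corrected to vanish at both
    ends; the gap is therefore the regular form of that primitive divided by [v (1 - v)]. *)
Lemma average_gap_identity (k : R -> R) (v : R) :
  (forall x, continuous k x) ->
  v * (1 - v) * average_gap k v = v * RInt k 0 1 - RInt k 0 v.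
Proof.
  intros Hk. unfold average_gap.
  assert (Hex : forall a b, ex_RInt k a b).
  { intros a b. apply (@ex_RInt_continuous R_CompleteNormedModule). intros; apply Hk. }
  assert (Hex1 : forall p q a b, ex_RInt (fun t => k (p + q * t)) a b).
  { intros p q a b. apply (@ex_RInt_continuous R_CompleteNormedModule). intros x _.
    now apply continuous_affine. }
  rewrite (RInt_minus (V := R_CompleteNormedModule)) by easy.
  assert (Hlin : forall p q, q * RInt (fun t => k (p + q * t)) 0 1 = RInt k p (p + q)).
  { intros p q.
    assert (H := RInt_comp_lin (V := R_CompleteNormedModule) k q p 0 1 (Hex _ _)).
    rewrite Rmult_0_r, Rplus_0_l, Rmult_1_r in H.
    rewrite (Rplus_comm p q), <- H.
    rewrite <- (RInt_scal (V := R_CompleteNormedModule)) by easy.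
    apply RInt_ext. intros x _. rewrite (Rplus_comm p). reflexivity. }
  assert (H1 := Hlin v (1 - v)). assert (H2 := Hlin 0 v).
  replace (v + (1 - v)) with 1 in H1 by ring. replace (0 + v) with v in H2 by ring.
  assert (H3 := RInt_Chasles (V := R_CompleteNormedModule) k 0 v 1 (Hex _ _) (Hex _ _)).
  unfold plus in H3; simpl in H3. unfold minus, plus, opp; simpl.
  rewrite <- H3.
  set (a := RInt (fun t => k (v + (1 - v) * t)) 0 1) in *.
  set (b := RInt (fun t => k (0 + v * t)) 0 1) in *.
  rewrite <- H1, <- H2. ring.
Qed.

Definition smooth (a : R -> R) : Prop := forall n x, ex_derive_n a n x.

Lemma smooth_is_derive (a : R -> R) (x : R) : smooth a -> is_derive a x (Derive a x).
Proof. intros H. apply Derive_correct. apply (H 1%nat x). Qed.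

Lemma smooth_Derive (a : R -> R) : smooth a -> smooth (Derive a).
Proof.
  intros H [ | n] x; [easy | ].
  simpl. apply (ex_derive_ext (Derive_n a (S n))); [ | apply (H (S (S n)) x)].
  intros t. rewrite <- Nat.add_1_r. symmetry. apply (Derive_n_comp a n 1).
Qed.

Lemma smooth_continuous (a : R -> R) (x : R) : smooth a -> continuous a x.
Proof.
  intros H. apply differentiable_continuous. apply (H 1%nat x).
Qed.

Lemma continuous_bounded (a : R -> R) (p q : R) :
  (forall x, continuous a x) -> exists M, forall x, p <= x <= q -> Rabs (a x) <= M.
Proof.
  intros Ha. destruct (Rle_dec p q) as [Hpq | Hpq].
  - destruct (continuity_ab_maj (fun x => Rabs (a x)) p q Hpq) as [m [Hm _]].
    + intros c _. apply continuity_pt_filterlim.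
      apply (continuous_comp a Rabs); [apply Ha | apply continuous_Rabs].
    + exists (Rabs (a m)). exact Hm.
  - exists 0. intros x Hx. lra.
Qed.

Lemma smooth_lipschitz_on (a : R -> R) (p q : R) :
  smooth a -> exists K, 0 <= K /\ forall x y, p <= x <= q -> p <= y <= q ->
    Rabs (a x - a y) <= K * Rabs (x - y).
Proof.
  intros Ha. destruct (continuous_bounded (Derive a) p q) as [K HK].
  - intros x. apply smooth_continuous. now apply smooth_Derive.
  - exists (Rmax 0 K). split; [apply Rmax_l | ]. intros x y Hx Hy.
    apply (derive_bounded_lipschitz a (Derive a)).
    + intros t _. now apply smooth_is_derive.
    + intros t Ht. eapply Rle_trans; [apply HK | apply Rmax_r].
      unfold Rmin, Rmax in Ht. destruct (Rle_dec y x); lra.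
Qed.

Lemma smooth_clamp_lipschitz (a : R -> R) :
  smooth a -> exists K, 0 <= K /\ lipschitz K (fun x => a (clamp x)).
Proof.
  intros Ha. destruct (smooth_lipschitz_on a 0 1 Ha) as [K [HK0 HK]].
  exists K. split; [easy | ]. intros x y. eapply Rle_trans; [apply HK; apply clamp_in | ].
  apply Rmult_le_compat_l; [easy | ]. rewrite <- (Rmult_1_l (Rabs (x - y))).
  apply clamp_lipschitz.
Qed.

(** The quotient [a v / (v (1 - v))] when [a] vanishes at 0 and 1, in a form that is Lipschitz
    up to the end points. The clamping only serves to have a function on the whole line. *)
Definition quotient01 (a : R -> R) (v : R) : R :=
  - average_gap (fun x => Derive a (clamp x)) (clamp v).

Lemma RInt_Derive_clamp (a : R -> R) (v : R) :
  smooth a -> 0 <= v <= 1 -> RInt (fun x => Derive a (clamp x)) 0 v = a v - a 0.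
Proof.
  intros Ha Hv. rewrite <- (RInt_Derive a 0 v).
  - apply RInt_ext. intros x. rewrite Rmin_left, Rmax_right by lra. intros Hx.
    rewrite clamp_id; [easy | lra].
  - intros x _. apply (Ha 1%nat x).
  - intros x _. apply smooth_continuous. now apply smooth_Derive.
Qed.

Lemma continuous_Derive_clamp (a : R -> R) (x : R) :
  smooth a -> continuous (fun x => Derive a (clamp x)) x.
Proof.
  intros Ha. destruct (smooth_clamp_lipschitz (Derive a) (smooth_Derive a Ha)) as [K [_ HK]].
  now apply lipschitz_continuous with K.
Qed.

Lemma quotient01_correct (a : R -> R) (v : R) :
  smooth a -> a 0 = 0 -> a 1 = 0 -> 0 <= v <= 1 -> a v = v * (1 - v) * quotient01 a v.
Proof.
  intros Ha H0 H1 Hv. unfold quotient01. rewrite clamp_id by easy.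
  rewrite <- Ropp_mult_distr_r, average_gap_identity
    by (intros x; now apply continuous_Derive_clamp).
  rewrite !RInt_Derive_clamp by (easy || lra). rewrite H0, H1. ring.
Qed.

Lemma quotient01_lipschitz (a : R -> R) :
  smooth a -> exists K, 0 <= K /\ lipschitz K (quotient01 a).
Proof.
  intros Ha. destruct (smooth_clamp_lipschitz (Derive a) (smooth_Derive a Ha)) as [K [HK0 HK]].
  exists (2 * K). split; [lra | ]. intros x y. unfold quotient01.
  set (k := fun x => Derive a (clamp x)) in *.
  replace (- average_gap k (clamp x) - - average_gap k (clamp y))
    with (- (average_gap k (clamp x) - average_gap k (clamp y))) by ring.
  rewrite Rabs_Ropp. eapply Rle_trans; [apply (average_gap_lipschitz k K); exact HK | ].
  apply Rmult_le_compat_l; [lra | ]. rewrite <- (Rmult_1_l (Rabs (x - y))).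
  apply clamp_lipschitz.
Qed.

Lemma average_gap_0 (k : R -> R) :
  (forall x, continuous k x) -> average_gap k 0 = RInt k 0 1 - k 0.
Proof.
  intros Hk. unfold average_gap.
  rewrite (RInt_ext _ (fun t => minus (k t) (k 0))).
  - rewrite (RInt_minus (V := R_CompleteNormedModule)).
    + rewrite RInt_const. unfold minus, plus, opp, scal; simpl. unfold mult; simpl. ring.
    + apply (@ex_RInt_continuous R_CompleteNormedModule). intros; apply Hk.
    + apply ex_RInt_const.
  - intros t _. unfold minus, plus, opp; simpl. unfold Rminus. f_equal; f_equal; [ring | f_equal; ring].
Qed.

Lemma average_gap_1 (k : R -> R) :
  (forall x, continuous k x) -> average_gap k 1 = k 1 - RInt k 0 1.
Proof.
  intros Hk. unfold average_gap.
  rewrite (RInt_ext _ (fun t => minus (k 1) (k t))).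
  - rewrite (RInt_minus (V := R_CompleteNormedModule)).
    + rewrite RInt_const. unfold minus, plus, opp, scal; simpl. unfold mult; simpl. ring.
    + apply ex_RInt_const.
    + apply (@ex_RInt_continuous R_CompleteNormedModule). intros; apply Hk.
  - intros t _. unfold minus, plus, opp; simpl. unfold Rminus. f_equal; f_equal; [ring | f_equal; ring].
Qed.

Lemma quotient01_0 (a : R -> R) :
  smooth a -> a 0 = 0 -> a 1 = 0 -> quotient01 a 0 = Derive a 0.
Proof.
  intros Ha H0 H1. unfold quotient01. rewrite clamp_id by lra.
  rewrite average_gap_0 by (intros x; now apply continuous_Derive_clamp).
  rewrite RInt_Derive_clamp, clamp_id by (easy || lra). lra.
Qed.

Lemma quotient01_1 (a : R -> R) :
  smooth a -> a 0 = 0 -> a 1 = 0 -> quotient01 a 1 = - Derive a 1.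
Proof.
  intros Ha H0 H1. unfold quotient01. rewrite clamp_id by lra.
  rewrite average_gap_1 by (intros x; now apply continuous_Derive_clamp).
  rewrite RInt_Derive_clamp, clamp_id by (easy || lra). lra.
Qed.

(** * A contraction for the slope factor *)

Lemma is_lim_seq_Rabs_le (u : nat -> R) (l a M : R) (N : nat) :
  is_lim_seq u l -> (forall n, (N <= n)%nat -> Rabs (u n - a) <= M) -> Rabs (l - a) <= M.
Proof.
  intros Hu HM.
  assert (H : Rbar_le (Rabs (l - a)) M); [ | exact H].
  apply (is_lim_seq_le_loc (fun n => Rabs (u n - a)) (fun _ => M)).
  - exists N. exact HM.
  - apply (is_lim_seq_abs (fun n => u n - a) (Finite (l - a))).
    apply (is_lim_seq_minus u (fun _ => a) l a); [easy | apply is_lim_seq_const | easy].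
  - apply is_lim_seq_const.
Qed.

(** Banach's theorem for the uniform distance, the closed set being given by a predicate stable
    under pointwise limits. *)
Lemma contraction_fixed_point (P : (R -> R) -> Prop) (T : (R -> R) -> R -> R)
    (z0 : R -> R) (d0 : R) :
  P z0 ->
  (forall z, P z -> P (T z)) ->
  (forall z w d, P z -> P w -> (forall x, Rabs (z x - w x) <= d) ->
     forall x, Rabs (T z x - T w x) <= d / 2) ->
  (forall (zs : nat -> R -> R) (z : R -> R), (forall n, P (zs n)) ->
     (forall x, is_lim_seq (fun n => zs n x) (z x)) -> P z) ->
  (forall x, Rabs (T z0 x - z0 x) <= d0) ->
  exists z, P z /\ forall x, T z x = z x.
Proof.
  intros H0 HT Hcon Hlim Hd0.
  set (zs := fun n => Nat.iter n T z0).
  assert (HP : forall n, P (zs n)) by (induction n as [ | n IH]; simpl; auto).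
  assert (Hstep : forall n x, Rabs (zs (S n) x - zs n x) <= d0 * (/ 2) ^ n).
  { induction n as [ | n IH]; intros x.
    - simpl. rewrite Rmult_1_r. apply Hd0.
    - replace (d0 * (/ 2) ^ S n) with ((d0 * (/ 2) ^ n) / 2) by (simpl; field).
      exact (Hcon (zs (S n)) (zs n) _ (HP _) (HP _) IH x). }
  assert (Hdist : forall n m x, Rabs (zs (n + m)%nat x - zs n x)
                     <= 2 * (d0 * (/ 2) ^ n) - d0 * (/ 2) ^ (n + m) * 2).
  { intros n m x. induction m as [ | m IH].
    - rewrite Nat.add_0_r, Rminus_diag, Rabs_R0. lra.
    - rewrite Nat.add_succ_r. specialize (Hstep (n + m)%nat x). simpl in Hstep |- *.
      set (p := (/ 2) ^ (n + m)) in *.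
      replace (T (Nat.iter (n + m) T z0) x) with (zs (S (n + m)) x) in * by reflexivity.
      apply Rabs_le_between in IH. apply Rabs_le_between in Hstep.
      apply Rabs_le. fold (zs (n + m)%nat) in Hstep. lra. }
  assert (Hd0pos : 0 <= d0).
  { eapply Rle_trans; [ | exact (Hd0 0)]. apply Rabs_pos. }
  assert (Hpow : forall n, 0 < (/ 2) ^ n) by (intros n; apply pow_lt; lra).
  assert (Hclose : forall n m x, (n <= m)%nat -> Rabs (zs m x - zs n x) <= 2 * d0 * (/ 2) ^ n).
  { intros n m x Hnm. replace m with (n + (m - n))%nat by lia.
    specialize (Hdist n (m - n)%nat x). specialize (Hpow (n + (m - n))%nat). nra. }
  assert (Hsmall : forall e, 0 < e -> exists n, 2 * d0 * (/ 2) ^ n <= e).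
  { intros e He.
    assert (Hg : is_lim_seq (fun n => 2 * d0 * (/ 2) ^ n) (2 * d0 * 0)).
    { apply (is_lim_seq_scal_l _ (2 * d0) 0). apply is_lim_seq_geom.
      rewrite Rabs_right; lra. }
    rewrite Rmult_0_r in Hg. apply is_lim_seq_spec in Hg.
    destruct (Hg (mkposreal e He)) as [n Hn]. exists n. specialize (Hn n (le_n _)).
    simpl in Hn. rewrite Rminus_0_r in Hn. apply Rabs_lt_between in Hn. lra. }
  assert (Hex : forall x, ex_finite_lim_seq (fun n => zs n x)).
  { intros x. apply ex_lim_seq_cauchy_corr. intros e.
    destruct (Hsmall (e / 4)) as [N HN]; [assert (He := cond_pos e); lra | ].
    exists N. intros n m Hn Hm.
    assert (H1 := Hclose N n x Hn). assert (H2 := Hclose N m x Hm).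
    apply Rabs_le_between in H1. apply Rabs_le_between in H2.
    assert (He := cond_pos e). apply Rabs_lt_between. lra. }
  set (z := fun x => real (Lim_seq (fun n => zs n x))).
  assert (Hz : forall x, is_lim_seq (fun n => zs n x) (z x)).
  { intros x. apply Lim_seq_correct'. apply Hex. }
  assert (HPz : P z) by now apply (Hlim zs).
  assert (Hzn : forall n x, Rabs (z x - zs n x) <= 2 * d0 * (/ 2) ^ n).
  { intros n x. apply (is_lim_seq_Rabs_le _ _ _ _ n (Hz x)). intros m Hm. now apply Hclose. }
  exists z. split; [easy | ]. intros x.
  assert (Hle : forall e, 0 < e -> Rabs (T z x - z x) <= 2 * e).
  { intros e He. destruct (Hsmall e He) as [n Hn].
    assert (H1 : Rabs (T z x - T (zs n) x) <= e / 2).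
    { apply (Hcon z (zs n) e HPz (HP n)). intros y. eapply Rle_trans; [apply Hzn | easy]. }
    assert (H2 := Hzn (S n) x). simpl in H2. fold (zs n) in H2.
    apply Rabs_le_between in H1. apply Rabs_le_between in H2. specialize (Hpow n).
    apply Rabs_le. nra. }
  destruct (Req_dec (T z x) (z x)) as [H | H]; [easy | ].
  assert (H1 := Rabs_pos_lt (T z x - z x) ltac:(lra)).
  specialize (Hle (Rabs (T z x - z x) / 4) ltac:(lra)). lra.
Qed.

Lemma lipschitz_limit (K : R) (zs : nat -> R -> R) (z : R -> R) :
  (forall n, lipschitz K (zs n)) -> (forall x, is_lim_seq (fun n => zs n x) (z x)) ->
  lipschitz K z.
Proof.
  intros HK Hz a b.
  rewrite <- (Rminus_0_r (z a - z b)).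
  apply (is_lim_seq_Rabs_le (fun n => zs n a - zs n b) _ _ _ 0).
  - apply (is_lim_seq_minus _ _ (z a) (z b)); [apply Hz | apply Hz | easy].
  - intros n _. rewrite Rminus_0_r. apply HK.
Qed.

Lemma inv_bounds (t : R) : / 2 <= t -> 0 < / t <= 2.
Proof.
  intros Ht. split; [apply Rinv_0_lt_compat; lra | ].
  rewrite <- (Rinv_inv 2). apply Rinv_le_contravar; lra.
Qed.

Lemma lipschitz_quotient (h z : R -> R) (B L M m : R) :
  0 < m -> (forall x, Rabs (h x) <= B) -> lipschitz L h ->
  (forall x, m <= Rabs (z x)) -> lipschitz M z ->
  lipschitz (L / m + B * M / (m * m)) (fun x => h x / z x).
Proof.
  intros Hm HB HL Hz HM a b.
  assert (Hz0 : forall t, z t <> 0).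
  { intros t Ht. specialize (Hz t). rewrite Ht, Rabs_R0 in Hz. lra. }
  replace (h a / z a - h b / z b)
    with ((h a - h b) * / z a + h b * (z b - z a) * (/ z a * / z b)) by (field; auto).
  eapply Rle_trans; [apply Rabs_triang | ]. rewrite !Rabs_mult.
  assert (I : forall t, 0 <= Rabs (/ z t) <= / m).
  { intros t. split; [apply Rabs_pos | ]. rewrite Rabs_inv. now apply Rinv_le_contravar. }
  assert (Ia := I a). assert (Ib := I b).
  assert (H1 := HL a b). assert (H2 := HM b a). rewrite (Rabs_minus_sym b a) in H2.
  replace ((L / m + B * M / (m * m)) * Rabs (a - b))
    with (L * Rabs (a - b) * / m + B * (M * Rabs (a - b)) * (/ m * / m)) by (field; lra).
  apply Rplus_le_compat.
  - apply Rmult_le_compat; auto using Rabs_pos; lra.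
  - apply Rmult_le_compat.
    + apply Rmult_le_pos; apply Rabs_pos.
    + apply Rmult_le_pos; lra.
    + apply Rmult_le_compat; auto using Rabs_pos.
    + apply Rmult_le_compat; lra.
Qed.

Lemma lipschitz_nonneg (K : R) (h : R -> R) : lipschitz K h -> 0 <= K.
Proof.
  intros H. specialize (H 1 0). assert (H1 := Rabs_pos (h 1 - h 0)).
  rewrite Rminus_0_r, Rabs_R1 in H. lra.
Qed.

(** The right-hand side maps the functions with [|z - 1| <= 1/2] and Lipschitz constant 1 into
    themselves, and is a contraction for the uniform distance once [eps] is small. Every
    function it produces is 1 plus [eps] times a function with bounds depending on [B] and [L]
    only, and so is the fixed point. *)
Lemma speed_factor_exists (h q : R -> R) (B L : R) :
  (forall x, Rabs (h x) <= B) -> lipschitz L h ->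
  (forall x, Rabs (q x) <= B) -> lipschitz L q ->
  exists eps0 C : R, 0 < eps0 /\ 0 <= C /\ forall eps, 0 <= eps <= eps0 ->
  exists z : R -> R,
    (forall x, Rabs (z x - 1) <= C * eps) /\ (forall x, / 2 <= z x <= 3 / 2) /\
    lipschitz (C * eps) z /\
    forall v, z v = 1 + eps * (q v * average_gap (fun x => h x / z x) (clamp v)).
Proof.
  intros HhB HhL HqB HqL.
  assert (HB : 0 <= B) by (eapply Rle_trans; [apply Rabs_pos | apply (HhB 0)]).
  assert (HL := lipschitz_nonneg _ _ HhL).
  (* the Lipschitz constant of [h / z] given by [lipschitz_quotient] for [z >= 1/2] *)
  set (K := L / / 2 + B * 1 / (/ 2 * / 2)).
  assert (HK : K = 2 * L + 4 * B) by (unfold K; field).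
  set (C := 16 * (B * B) + (4 * (L * B) + 2 * (B * K)) + 1).
  assert (HBB : 0 <= B * B) by nra. assert (HLB : 0 <= L * B) by nra.
  assert (HBK : 0 <= B * K) by (rewrite HK; nra).
  assert (HC : 1 <= C) by (unfold C; lra).
  exists (/ (2 * C)), C.
  split; [apply Rinv_0_lt_compat; lra | ]. split; [lra | ]. intros eps [He1 He2].
  assert (HCe : C * eps <= / 2).
  { apply Rmult_le_compat_l with (r := C) in He2; [ | lra].
    replace (C * / (2 * C)) with (/ 2) in He2 by (field; lra). exact He2. }
  set (P := fun z : R -> R => (forall x, Rabs (z x - 1) <= / 2) /\ lipschitz 1 z).
  set (T := fun (z : R -> R) v => 1 + eps * (q v * average_gap (fun x => h x / z x) (clamp v))).
  assert (Hpos : forall z x, P z -> / 2 <= z x <= 3 / 2).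
  { intros z x [Hz _]. specialize (Hz x). apply Rabs_le_between in Hz. lra. }
  assert (Hkb : forall z x, P z -> Rabs (h x / z x) <= 2 * B).
  { intros z x Hz. specialize (Hpos z x Hz). unfold Rdiv. rewrite Rabs_mult.
    assert (I := inv_bounds (z x) ltac:(lra)). rewrite (Rabs_right (/ z x)) by lra.
    specialize (HhB x). assert (H1 := Rabs_pos (h x)). nra. }
  assert (HkL : forall z, P z -> lipschitz K (fun x => h x / z x)).
  { intros z Hz. apply lipschitz_quotient; [lra | easy | easy | | apply Hz].
    intros x. specialize (Hpos z x Hz). rewrite Rabs_right; lra. }
  assert (Hkc : forall z x, P z -> continuous (fun x => h x / z x) x).
  { intros z x Hz. apply lipschitz_continuous with K. now apply HkL. }
  assert (HTb : forall z x, P z -> Rabs (T z x - 1) <= C * eps).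
  { intros z x Hz. unfold T. replace (1 + eps * (q x * average_gap (fun x => h x / z x) (clamp x)) - 1)
      with (eps * (q x * average_gap (fun x => h x / z x) (clamp x))) by ring.
    rewrite !Rabs_mult, (Rabs_right eps), Rmult_comm by lra.
    apply Rmult_le_compat_r; [easy | ].
    assert (H1 := average_gap_bound _ (2 * B) (clamp x) (fun x => Hkc z x Hz) (fun x => Hkb z x Hz)).
    apply Rle_trans with (B * (2 * (2 * B))); [ | unfold C; lra].
    apply Rmult_le_compat; auto; apply Rabs_pos. }
  assert (HTL : forall z, P z -> lipschitz (C * eps) (T z)).
  { intros z Hz a b. unfold T. set (k := fun x => h x / z x).
    replace (1 + eps * (q a * average_gap k (clamp a)) - (1 + eps * (q b * average_gap k (clamp b))))
      with (eps * ((q a - q b) * average_gap k (clamp a)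
                   + q b * (average_gap k (clamp a) - average_gap k (clamp b)))) by ring.
    rewrite Rabs_mult, (Rabs_right eps) by lra.
    replace (C * eps * Rabs (a - b)) with (eps * (C * Rabs (a - b))) by ring.
    apply Rmult_le_compat_l; [easy | ].
    eapply Rle_trans; [apply Rabs_triang | ]. rewrite !Rabs_mult.
    assert (H1 := average_gap_bound _ (2 * B) (clamp a) (fun x => Hkc z x Hz) (fun x => Hkb z x Hz)).
    fold k in H1.
    assert (H2 := average_gap_lipschitz k K (clamp a) (clamp b) (HkL z Hz)).
    assert (H3 := HqL a b). assert (H4 := HqB b).
    assert (H5 := clamp_lipschitz a b). rewrite Rmult_1_l in H5.
    assert (P0 := Rabs_pos (a - b)).
    apply Rle_trans with ((L * Rabs (a - b)) * (2 * (2 * B)) + B * (2 * K * Rabs (a - b))).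
    - apply Rplus_le_compat.
      + apply Rmult_le_compat; auto; apply Rabs_pos.
      + apply Rmult_le_compat; auto using Rabs_pos.
        eapply Rle_trans; [apply H2 | ]. apply Rmult_le_compat_l; [rewrite HK; lra | easy].
    - unfold C. nra. }
  destruct (contraction_fixed_point P T (fun _ => 1) (C * eps)) as [z [HPz Hz]].
  - split; [intros x; rewrite Rminus_diag, Rabs_R0; lra | ].
    intros a b. rewrite Rminus_diag, Rabs_R0. assert (H := Rabs_pos (a - b)). lra.
  - intros z Hz. split.
    + intros x. eapply Rle_trans; [now apply HTb | easy].
    + intros a b. eapply Rle_trans; [now apply HTL | ].
      apply Rmult_le_compat_r; [apply Rabs_pos | lra].
  - intros z w d Hz Hw Hd x. unfold T.
    assert (Hd0 : 0 <= d) by (eapply Rle_trans; [apply Rabs_pos | apply (Hd 0)]).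
    set (g1 := average_gap (fun x => h x / z x) (clamp x)).
    set (g2 := average_gap (fun x => h x / w x) (clamp x)).
    assert (Hg : Rabs (g1 - g2) <= 2 * (B * d * 4)).
    { apply average_gap_dist; auto. intros y.
      assert (Hzy := Hpos z y Hz). assert (Hwy := Hpos w y Hw).
      replace (h y / z y - h y / w y) with (h y * (w y - z y) * (/ z y * / w y)) by (field; lra).
      rewrite !Rabs_mult, (Rabs_right (/ z y)), (Rabs_right (/ w y))
        by (left; apply Rinv_0_lt_compat; lra).
      assert (I1 := inv_bounds _ (proj1 Hzy)). assert (I2 := inv_bounds _ (proj1 Hwy)).
      specialize (Hd y). rewrite Rabs_minus_sym in Hd.
      apply Rmult_le_compat.
      - apply Rmult_le_pos; apply Rabs_pos.
      - apply Rmult_le_pos; lra.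
      - apply Rmult_le_compat; auto using Rabs_pos.
      - nra. }
    replace (1 + eps * (q x * g1) - (1 + eps * (q x * g2))) with (eps * (q x * (g1 - g2))) by ring.
    rewrite !Rabs_mult, (Rabs_right eps) by lra.
    apply Rle_trans with (eps * (B * (2 * (B * d * 4)))).
    + apply Rmult_le_compat_l; [easy | ]. apply Rmult_le_compat; auto using Rabs_pos.
    + assert (16 * (B * B) * eps <= / 2) by (unfold C in HCe; nra). nra.
  - intros zs z Hzs Hlim. split.
    + intros x. apply (is_lim_seq_Rabs_le _ _ _ _ 0 (Hlim x)). intros n _. apply Hzs.
    + apply lipschitz_limit with zs; [apply Hzs | easy].
  - intros x. apply HTb. split.
    + intros y. rewrite Rminus_diag, Rabs_R0. lra.
    + intros a b. rewrite Rminus_diag, Rabs_R0. assert (H := Rabs_pos (a - b)). lra.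
  - exists z. repeat split.
    + intros x. rewrite <- Hz. now apply HTb.
    + now apply Hpos.
    + now apply Hpos.
    + intros a b. rewrite <- !Hz. now apply HTL.
    + intros v. symmetry. apply Hz.
Qed.

(** * Normalized shock, slope factor and profile *)

(** The shock seen in the variable that is 1 at the left end state and 0 at the right one: [F]
    is the flux minus its chord, so that [F < 0] is the entropy condition, and [G] is the
    source. *)
Record normalized_shock (F G : R -> R) : Prop := {
  ns_F : smooth F;
  ns_G : smooth G;
  ns_F0 : F 0 = 0;
  ns_F1 : F 1 = 0;
  ns_G0 : G 0 = 0;
  ns_G1 : G 1 = 0;
  ns_neg : forall v, 0 < v < 1 -> F v < 0;
  ns_dF0 : Derive F 0 < 0;
  ns_dF1 : 0 < Derive F 1;
  ns_dG0 : Derive G 0 < 0;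
  ns_dG1 : Derive G 1 < 0 }.

Arguments ns_F {F G}.
Arguments ns_G {F G}.
Arguments ns_F0 {F G}.
Arguments ns_F1 {F G}.
Arguments ns_G0 {F G}.
Arguments ns_G1 {F G}.
Arguments ns_neg {F G}.
Arguments ns_dF0 {F G}.
Arguments ns_dF1 {F G}.
Arguments ns_dG0 {F G}.
Arguments ns_dG1 {F G}.

Lemma quotient01_clamp (a : R -> R) (v : R) : quotient01 a v = quotient01 a (clamp v).
Proof. unfold quotient01. now rewrite (clamp_id (clamp v)) by apply clamp_in. Qed.

Lemma quotient01_bounded (a : R -> R) :
  smooth a -> exists B, 0 <= B /\ forall v, Rabs (quotient01 a v) <= B.
Proof.
  intros Ha. destruct (quotient01_lipschitz a Ha) as [K [_ HK]].
  destruct (continuous_bounded (quotient01 a) 0 1) as [B HB].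
  - intros x. now apply lipschitz_continuous with K.
  - exists B. split; [eapply Rle_trans; [apply Rabs_pos | apply (HB 0); lra] | ].
    intros v. rewrite quotient01_clamp. apply HB, clamp_in.
Qed.

(** At the end points the quotient equals [Derive F 0] and [- Derive F 1]; compactness then
    gives a uniform sign. *)
Lemma quotient01_negative (F G : R -> R) :
  normalized_shock F G -> exists c, 0 < c /\ forall v, quotient01 F v <= - c.
Proof.
  intros HN. destruct (quotient01_lipschitz F (ns_F HN)) as [K [_ HK]].
  assert (Hneg : forall v, 0 <= v <= 1 -> quotient01 F v < 0).
  { intros v Hv.
    destruct (Req_dec v 0) as [-> | H0].
    { rewrite quotient01_0; apply HN. }
    destruct (Req_dec v 1) as [-> | H1].
    { rewrite quotient01_1; try apply HN. assert (H := ns_dF1 HN). lra. }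
    assert (H := ns_neg HN v ltac:(lra)).
    rewrite quotient01_correct in H; try apply HN; [ | easy].
    assert (0 < v * (1 - v)) by nra. nra. }
  destruct (continuity_ab_maj (quotient01 F) 0 1) as [m [Hm Hm1]]; [lra | | ].
  - intros x _. apply continuity_pt_filterlim. now apply lipschitz_continuous with K.
  - exists (- quotient01 F m). split; [specialize (Hneg m Hm1); lra | ].
    intros v. rewrite quotient01_clamp. rewrite Ropp_involutive. apply Hm, clamp_in.
Qed.

(** A monotone wave of speed [sg] and strength [eps] satisfies [y' = W(y)] with [W' = F' - sg -
    eps G / W] and [W] vanishing at 0 and 1. Here [W] is written [F z]. The last two fields are
    the limits of the equation for [W] at the end points: they say that [W'(0)] and [W'(1)] are
    eigenvalues of the linearization at the end states. *)
Record slope_factor (F G : R -> R) (C eps sg : R) (z : R -> R) : Prop := {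
  sf_close : forall v, Rabs (z v - 1) <= C * eps;
  sf_range : forall v, / 2 <= z v <= 3 / 2;
  sf_lip : lipschitz (C * eps) z;
  sf_speed : Rabs sg <= C * eps;
  sf_ode : forall v, 0 < v < 1 -> is_derive (fun v => F v * z v) v
    (Derive F v - sg - eps * (quotient01 G v / quotient01 F v / z v));
  sf_rate0 : Derive F 0 * z 0 = Derive F 0 - sg - eps * (Derive G 0 / (Derive F 0 * z 0));
  sf_rate1 : Derive F 1 * z 1 = Derive F 1 - sg - eps * (Derive G 1 / (Derive F 1 * z 1)) }.

Arguments sf_close {F G C eps sg z}.
Arguments sf_range {F G C eps sg z}.
Arguments sf_lip {F G C eps sg z}.
Arguments sf_speed {F G C eps sg z}.
Arguments sf_ode {F G C eps sg z}.
Arguments sf_rate0 {F G C eps sg z}.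
Arguments sf_rate1 {F G C eps sg z}.

(** Integrating the equation for [W] from 0 and choosing [sg] so that [W 1 = 0] gives [W v = F v
    + eps (v * int_0^1 k - int_0^v k)] with [k = G / W]. Dividing by [v (1 - v)] turns this into
    the fixed point equation of [speed_factor_exists], where the singularities of [G / W] and of
    [1 / F] at the end states have disappeared. *)
Lemma slope_factor_exists (F G : R -> R) :
  normalized_shock F G ->
  exists eps0 C : R, 0 < eps0 /\ 0 <= C /\ forall eps, 0 <= eps <= eps0 ->
  exists sg z, slope_factor F G C eps sg z.
Proof.
  intros HN.
  destruct (quotient01_negative F G HN) as [c [Hc HQ]].
  destruct (quotient01_lipschitz F (ns_F HN)) as [KF [HKF LF]].
  destruct (quotient01_lipschitz G (ns_G HN)) as [KG [HKG LG]].
  destruct (quotient01_bounded G (ns_G HN)) as [BG [HBG0 HBG]].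
  set (Q := quotient01 F) in *. set (P := quotient01 G) in *.
  assert (Hi : forall v, Rabs (/ Q v) <= / c).
  { intros v. specialize (HQ v). rewrite Rabs_inv, Rabs_left by lra.
    apply Rinv_le_contravar; lra. }
  assert (Hic : 0 < / c) by (now apply Rinv_0_lt_compat).
  assert (HQm : forall v, c <= Rabs (Q v)).
  { intros v. specialize (HQ v). rewrite Rabs_left; lra. }
  assert (Hq : lipschitz (0 / c + 1 * KF / (c * c)) (fun v => / Q v)).
  { intros a b.
    assert (H := lipschitz_quotient (fun _ => 1) Q 1 0 KF c Hc).
    replace (/ Q a - / Q b) with (1 / Q a - 1 / Q b) by (unfold Rdiv; ring).
    apply H; auto.
    - intros x. rewrite Rabs_R1. lra.
    - intros x y. rewrite Rminus_diag, Rabs_R0. lra. }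
  assert (Hh : lipschitz (KG / c + BG * KF / (c * c)) (fun v => P v / Q v))
    by now apply lipschitz_quotient.
  set (B := Rmax (BG * / c) (/ c)).
  set (L := Rmax (KG / c + BG * KF / (c * c)) (0 / c + 1 * KF / (c * c))).
  assert (Lmon : forall K h, K <= L -> lipschitz K h -> lipschitz L h).
  { intros K h HK Hl a b. eapply Rle_trans; [apply Hl | ].
    apply Rmult_le_compat_r; [apply Rabs_pos | easy]. }
  assert (HhB : forall v, Rabs (P v / Q v) <= B).
  { intros v. unfold Rdiv. rewrite Rabs_mult. apply Rle_trans with (BG * / c); [ | apply Rmax_l].
    apply Rmult_le_compat; auto using Rabs_pos. }
  assert (HqB : forall v, Rabs (/ Q v) <= B).
  { intros v. eapply Rle_trans; [apply Hi | apply Rmax_r]. }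
  assert (HhL : lipschitz L (fun v => P v / Q v)) by (apply (Lmon _ _ (Rmax_l _ _) Hh)).
  assert (HqL : lipschitz L (fun v => / Q v)) by (apply (Lmon _ _ (Rmax_r _ _) Hq)).
  destruct (speed_factor_exists _ _ B L HhB HhL HqB HqL) as [eps0 [C [He0 [HC Hex]]]].
  assert (HB0 : 0 <= B) by (eapply Rle_trans; [apply Rabs_pos | apply (HhB 0)]).
  exists eps0, (Rmax C (2 * B)). split; [easy | ].
  assert (HC1 : C <= Rmax C (2 * B)) by apply Rmax_l.
  assert (HC2 : 2 * B <= Rmax C (2 * B)) by apply Rmax_r.
  split; [lra | ].
  intros eps Heps. destruct (Hex eps Heps) as [z [Hz1 [Hz2 [Hz3 Hz4]]]].
  set (k := fun x => P x / Q x / z x) in *.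
  assert (Hk : forall x, continuous k x).
  { intros x. apply lipschitz_continuous with (L / / 2 + B * (C * eps) / (/ 2 * / 2)).
    apply lipschitz_quotient; auto; [lra | ]. intros y. specialize (Hz2 y).
    rewrite Rabs_right; lra. }
  assert (HkB : forall x, Rabs (k x) <= 2 * B).
  { intros x. unfold k. unfold Rdiv at 1. rewrite Rabs_mult.
    destruct (Hz2 x) as [Hzx _].
    assert (I := inv_bounds (z x) Hzx).
    rewrite (Rabs_right (/ z x)) by lra. specialize (HhB x).
    assert (H := Rabs_pos (P x / Q x)). nra. }
  assert (Hexk : forall a b, ex_RInt k a b).
  { intros a b. apply (@ex_RInt_continuous R_CompleteNormedModule). intros; apply Hk. }
  exists (- (eps * RInt k 0 1)), z. split.
  - intros v. eapply Rle_trans; [apply Hz1 | ]. apply Rmult_le_compat_r; lra.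
  - exact Hz2.
  - intros a b. eapply Rle_trans; [apply Hz3 | ].
    apply Rmult_le_compat_r; [apply Rabs_pos | ]. apply Rmult_le_compat_r; lra.
  - rewrite Rabs_Ropp, Rabs_mult, (Rabs_right eps), Rmult_comm by lra.
    apply Rmult_le_compat_r; [lra | ]. apply Rle_trans with (2 * B); [ | easy].
    replace (2 * B) with ((1 - 0) * (2 * B)) by ring.
    apply abs_RInt_le_const; [lra | apply Hexk | intros; apply HkB].
  - intros v Hv.
    apply (is_derive_ext_loc (fun v => F v + eps * (v * RInt k 0 1 - RInt k 0 v))).
    + exists (mkposreal (Rmin v (1 - v)) ltac:(apply Rmin_pos; lra)).
      intros y Hy. change (Rabs (y - v) < Rmin v (1 - v)) in Hy.
      assert (M1 := Rmin_l v (1 - v)). assert (M2 := Rmin_r v (1 - v)).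
      apply Rabs_lt_between in Hy. assert (Hy' : 0 <= y <= 1) by lra.
      rewrite <- average_gap_identity by exact Hk. rewrite (Hz4 y), clamp_id by easy.
      fold k. rewrite (quotient01_correct F y) by (apply HN || easy). fold Q.
      specialize (HQ y). change (fun x => P x / Q x / z x) with k.
      match goal with |- ?a = ?b => change (@eq R a b) end. field. lra.
    + replace (Derive F v - - (eps * RInt k 0 1) - eps * (quotient01 G v / quotient01 F v / z v))
        with (Derive F v + eps * (1 * RInt k 0 1 - k v)) by (unfold k, P, Q; ring).
      apply (is_derive_plus (V := R_NormedModule)).
      * apply smooth_is_derive, HN.
      * apply (is_derive_scal (fun v => v * RInt k 0 1 - RInt k 0 v)).
        apply (is_derive_minus (V := R_NormedModule)).
        -- generalize (RInt k 0 1). intros I. auto_derive; [easy | ring].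
        -- apply is_derive_RInt with 0; [ | apply Hk].
           exists (mkposreal 1 Rlt_0_1). intros y _.
           apply (@RInt_correct R_CompleteNormedModule), Hexk.
  - assert (E := Hz4 0). rewrite clamp_id in E by lra.
    rewrite average_gap_0 in E by exact Hk.
    assert (HQ0 : Q 0 = Derive F 0) by (apply quotient01_0; apply HN).
    assert (HP0 : P 0 = Derive G 0) by (apply quotient01_0; apply HN).
    assert (Hn := ns_dF0 HN). rewrite HQ0 in E.
    replace (Derive G 0 / (Derive F 0 * z 0)) with (k 0).
    + rewrite E at 1. field. lra.
    + unfold k. rewrite HQ0, HP0. field. specialize (Hz2 0). lra.
  - assert (E := Hz4 1). rewrite clamp_id in E by lra.
    rewrite average_gap_1 in E by exact Hk.
    assert (HQ0 : Q 1 = - Derive F 1) by (apply quotient01_1; apply HN).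
    assert (HP0 : P 1 = - Derive G 1) by (apply quotient01_1; apply HN).
    assert (Hn := ns_dF1 HN). rewrite HQ0 in E.
    replace (Derive G 1 / (Derive F 1 * z 1)) with (k 1).
    + rewrite E at 1. field. lra.
    + unfold k. rewrite HQ0, HP0. field. specialize (Hz2 1). lra.
Qed.

Lemma ode_unique_on (W y w : R -> R) (K p q a b x0 : R) :
  (forall u v, p <= u <= q -> p <= v <= q -> Rabs (W u - W v) <= K * Rabs (u - v)) ->
  (forall x, a <= x <= b -> is_derive y x (W (y x))) ->
  (forall x, a <= x <= b -> is_derive w x (W (w x))) ->
  (forall x, a <= x <= b -> p <= y x <= q) ->
  (forall x, a <= x <= b -> p <= w x <= q) ->
  a <= x0 <= b -> y x0 = w x0 ->
  forall x, a <= x <= b -> y x = w x.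
Proof.
  intros HW Hy Hw Hyr Hwr Hx0 Heq x Hx.
  assert (H : (y x - w x) * (y x - w x) = 0); [ | nra].
  apply (gronwall_zero (fun t => (y t - w t) * (y t - w t))
    (fun t => (W (y t) - W (w t)) * (y t - w t) + (y t - w t) * (W (y t) - W (w t)))
    (2 * K) a b x0); auto.
  - intros t Ht. apply (is_derive_mult (K := R_AbsRing) (fun t => y t - w t) (fun t => y t - w t)).
    + apply (is_derive_minus (V := R_NormedModule)); auto.
    + apply (is_derive_minus (V := R_NormedModule)); auto.
    + intros n m. apply Rmult_comm.
  - intros t Ht. apply Rle_0_sqr.
  - intros t Ht.
    specialize (HW (y t) (w t) (Hyr t Ht) (Hwr t Ht)).
    set (u := y t - w t) in *. set (d := W (y t) - W (w t)) in *.
    replace (d * u + u * d) with (2 * (d * u)) by ring.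
    rewrite !Rabs_mult, (Rabs_right 2) by lra.
    replace (2 * K * (u * u)) with (2 * (K * Rabs u * Rabs u)).
    + apply Rmult_le_compat_l; [lra | ]. apply Rmult_le_compat_r; [apply Rabs_pos | easy].
    + replace (u * u) with (Rabs u * Rabs u); [ring | ].
      rewrite <- Rabs_mult. apply Rabs_right. nra.
  - rewrite Heq. ring.
Qed.

Lemma is_derive_continuous (y : R -> R) (x l : R) : is_derive y x l -> continuous y x.
Proof. intros H. apply differentiable_continuous. now exists l. Qed.

(** By uniqueness, a solution that vanishes somewhere is the rest solution 0. *)
Lemma ode_stays_positive (F y : R -> R) :
  smooth F -> F 0 = 0 -> (forall x, is_derive y x (F (y x))) -> 0 < y 0 ->
  forall x, 0 < y x.
Proof.
  intros HF HF0 Hy Hy0 x. apply Rnot_le_lt. intros Hx.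
  assert (Hc : forall t, continuous y t) by (intros t; now apply is_derive_continuous with (F (y t))).
  destruct (IVT_gen y 0 x 0) as [t [Ht1 Ht2]].
  - intros t. apply continuity_pt_filterlim, Hc.
  - rewrite Rmin_right, Rmax_left by lra. lra.
  - destruct (continuous_bounded y (Rmin 0 x) (Rmax 0 x) Hc) as [M HM].
    destruct (smooth_lipschitz_on F (- M) M HF) as [K [_ HK]].
    assert (Hbnd : forall s, Rmin 0 x <= s <= Rmax 0 x -> - M <= y s <= M).
    { intros s Hs. apply Rabs_le_between. now apply HM. }
    assert (M1 := Rmin_l 0 x). assert (M2 := Rmax_l 0 x).
    assert (M3 := Rmin_r 0 x). assert (M4 := Rmax_r 0 x).
    assert (H := ode_unique_on F y (fun _ => 0) K (- M) M (Rmin 0 x) (Rmax 0 x) t HK).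
    specialize (H (fun s _ => Hy s)).
    enough (y 0 = 0) by lra. apply H; auto; try lra.
    + intros s _. rewrite HF0. apply (is_derive_const (V := R_NormedModule) 0).
    + intros s _. specialize (Hbnd 0 ltac:(lra)). lra.
Qed.

Lemma Derive_reflect (a : R -> R) (v : R) :
  smooth a -> Derive (fun v => a (1 - v)) v = - Derive a (1 - v).
Proof.
  intros Ha. apply is_derive_unique. evar_last.
  - apply (is_derive_comp a (fun v => 1 - v)); [now apply smooth_is_derive | ].
    auto_derive; [easy | reflexivity].
  - unfold scal; simpl; unfold mult; simpl. ring.
Qed.

Lemma normalized_shock_reflect (F G : R -> R) :
  normalized_shock F G -> normalized_shock (fun v => F (1 - v)) (fun v => - G (1 - v)).
Proof.
  intros HN.
  assert (Hs : forall a, smooth a -> smooth (fun v => a (1 - v))).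
  { intros a Ha n x.
    apply (ex_derive_n_ext (fun v => (fun u => a (u + 1)) (- v))).
    - intros t. f_equal. ring.
    - apply (ex_derive_n_comp_opp (fun u => a (u + 1))). exists (mkposreal 1 Rlt_0_1). intros y _ k _.
      apply ex_derive_n_comp_trans. apply Ha. }
  assert (Hd' : forall v, Derive (fun v => - G (1 - v)) v = Derive G (1 - v)).
  { intros v. rewrite Derive_opp, Derive_reflect by apply HN. ring. }
  destruct HN. split.
  - now apply Hs.
  - intros n x. apply ex_derive_n_opp. now apply Hs.
  - now rewrite Rminus_0_r.
  - now rewrite Rminus_diag.
  - rewrite Rminus_0_r. lra.
  - rewrite Rminus_diag. lra.
  - intros v Hv. apply ns_neg0. lra.
  - rewrite Derive_reflect, Rminus_0_r by easy. lra.
  - rewrite Derive_reflect, Rminus_diag by easy. lra.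
  - now rewrite Hd', Rminus_0_r.
  - now rewrite Hd', Rminus_diag.
Qed.

Lemma is_derive_reflect (y : R -> R) (x l : R) :
  is_derive y (- x) l -> is_derive (fun t => 1 - y (- t)) x l.
Proof.
  intros H.
  evar_last.
  - apply (is_derive_minus (V := R_NormedModule) (fun _ => 1) (fun t => y (- t))).
    + apply is_derive_const.
    + apply (is_derive_comp y Ropp); [exact H | ].
      auto_derive; [easy | reflexivity].
  - unfold minus, plus, opp, scal, zero; simpl; unfold mult; simpl. ring.
Qed.

Definition inviscid_profile (F y0 : R -> R) : Prop :=
  (forall x, is_derive y0 x (F (y0 x))) /\ y0 0 = / 2.

Lemma inviscid_profile_reflect (F y0 : R -> R) :
  inviscid_profile F y0 -> inviscid_profile (fun v => F (1 - v)) (fun x => 1 - y0 (- x)).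
Proof.
  intros [H1 H2]. split.
  - intros x. apply is_derive_reflect.
    replace (1 - (1 - y0 (- x))) with (y0 (- x)) by ring. apply H1.
  - rewrite Ropp_0, H2. lra.
Qed.

Lemma inviscid_profile_range (F G y0 : R -> R) :
  normalized_shock F G -> inviscid_profile F y0 -> forall x, 0 < y0 x < 1.
Proof.
  intros HN HP x. split.
  - apply (ode_stays_positive F); try apply HN; [apply HP | ]. destruct HP. lra.
  - assert (HN' := normalized_shock_reflect F G HN).
    assert (HP' := inviscid_profile_reflect F y0 HP).
    assert (H : 0 < 1 - y0 (- - x)).
    { apply (ode_stays_positive (fun v => F (1 - v)) (fun x => 1 - y0 (- x)));
        try apply HN'; [apply HP' | ]. destruct HP'. lra. }
    rewrite Ropp_involutive in H. lra.
Qed.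

(** If [F v / (v (1 - v)) <= - c], then [F v <= - (c / 2) v] at the heights below 1/2, which
    are those reached for positive [x]. *)
Lemma inviscid_profile_decay (F G y0 : R -> R) :
  normalized_shock F G -> inviscid_profile F y0 ->
  exists c, 0 < c /\ forall x, 0 <= x -> y0 x <= exp (- c * x).
Proof.
  intros HN HP. assert (Hr := inviscid_profile_range F G y0 HN HP).
  destruct (quotient01_negative F G HN) as [c [Hc HQ]]. destruct HP as [Hd H0].
  assert (Hdec : forall x, 0 <= x -> y0 x <= / 2).
  { intros x Hx. rewrite <- H0.
    apply (derive_nonpos_ge y0 (fun x => F (y0 x))); [easy | intros; apply Hd | ].
    intros t _. left. apply (ns_neg HN), Hr. }
  exists (c / 2). split; [lra | ]. intros x Hx.
  assert (H : y0 x * exp (c / 2 * x) <= y0 0 * exp (c / 2 * 0)).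
  { apply (derive_nonpos_ge (fun x => y0 x * exp (c / 2 * x))
      (fun x => (F (y0 x) + c / 2 * y0 x) * exp (c / 2 * x))); [easy | | ].
    - intros t _. assert (Hdt := Hd t). auto_derive; [now exists (F (y0 t)) | ].
      change (Derive (fun x => y0 x) t) with (Derive y0 t).
      rewrite (is_derive_unique _ _ _ Hdt). field.
    - intros t Ht. assert (He := exp_pos (c / 2 * t)).
      specialize (Hr t). specialize (Hdec t ltac:(lra)). specialize (HQ (y0 t)).
      rewrite (quotient01_correct F) by (apply HN || lra).
      assert (Hk : y0 t * (1 - y0 t) * quotient01 F (y0 t) <= - (c / 2 * y0 t)).
      { assert (H1 : 0 <= y0 t * (1 - y0 t - / 2)) by nra.
        assert (H2 : y0 t * (1 - y0 t) * quotient01 F (y0 t) <= y0 t * (1 - y0 t) * - c).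
        { apply Rmult_le_compat_l; [nra | easy]. }
        nra. }
      nra. }
  rewrite Rmult_0_r, exp_0, H0 in H.
  replace (- (c / 2) * x) with (- (c / 2 * x)) by ring. rewrite exp_Ropp.
  assert (He := exp_pos (c / 2 * x)).
  apply Rmult_le_reg_r with (exp (c / 2 * x)); [easy | ]. rewrite Rinv_l by lra. lra.
Qed.

(** The solution is the inverse function of a primitive of [1 / rho], which avoids any existence
    theorem for differential equations. *)
Lemma reparametrization_exists (rho : R -> R) :
  (forall t, continuous rho t) -> (forall t, / 2 <= rho t <= 3 / 2) ->
  exists tau : R -> R, tau 0 = 0 /\ forall x, is_derive tau x (rho (tau x)).
Proof.
  intros Hc Hr.
  destruct (ex_antiderivative (fun t => / rho t)) as [X0 HX0].
  { intros t. apply (continuous_comp rho Rinv); [apply Hc | ].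
    apply differentiable_continuous. auto_derive.
    specialize (Hr t). lra. }
  set (X := fun t => X0 t - X0 0).
  assert (HX : forall t, is_derive X t (/ rho t)).
  { intros t. replace (/ rho t) with (/ rho t - 0) by ring.
    apply (is_derive_minus (V := R_NormedModule)); [apply HX0 | ].
    apply (is_derive_const (K := R_AbsRing) (V := R_NormedModule)). }
  assert (Hinv : forall t, 2 / 3 <= / rho t <= 2).
  { intros t. specialize (Hr t). split.
    - replace (2 / 3) with (/ (3 / 2)) by field. apply Rinv_le_contravar; lra.
    - now apply inv_bounds. }
  assert (Hexp : forall a b, a <= b -> 2 / 3 * (b - a) <= X b - X a).
  { intros a b Hab.
    assert (H := derive_nonneg_le (fun t => X t - 2 / 3 * t) (fun t => / rho t - 2 / 3) a b Hab).
    cbv beta in H. enough (X a - 2 / 3 * a <= X b - 2 / 3 * b) by lra. apply H.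
    - intros t _. apply (is_derive_minus (V := R_NormedModule)); [apply HX | ].
      auto_derive; [easy | ring].
    - intros t _. specialize (Hinv t). lra. }
  assert (Hexp' : forall a b, Rabs (b - a) <= 3 / 2 * Rabs (X b - X a)).
  { intros a b. destruct (Rle_dec a b) as [Hab | Hab].
    - specialize (Hexp a b Hab). rewrite !Rabs_right by lra. lra.
    - specialize (Hexp b a ltac:(lra)). rewrite !Rabs_left1 by lra. lra. }
  assert (Hsur : forall x, exists t, X t = x).
  { intros x. assert (HX00 : X 0 = 0) by (unfold X; ring).
    destruct (IVT_gen X (- (2 * Rabs x)) (2 * Rabs x) x) as [t [_ Ht]]; [ | | now exists t].
    - intros t. apply continuity_pt_filterlim. now apply is_derive_continuous with (/ rho t).
    - assert (Hp := Rabs_pos x).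
      assert (H1 := Hexp 0 (2 * Rabs x) ltac:(lra)).
      assert (H2 := Hexp (- (2 * Rabs x)) 0 ltac:(lra)).
      rewrite Rmin_left, Rmax_right by lra.
      assert (H := Rle_abs x). assert (H' := Rle_abs (- x)). rewrite Rabs_Ropp in H'. lra. }
  set (tau := fun x => proj1_sig (constructive_indefinite_description _ (Hsur x))).
  assert (Htau : forall x, X (tau x) = x).
  { intros x. unfold tau. now destruct (constructive_indefinite_description _ (Hsur x)). }
  exists tau. split.
  - assert (H := Hexp' 0 (tau 0)). rewrite Htau in H. unfold X in H.
    rewrite Rminus_diag, !Rminus_0_r, Rabs_R0 in H.
    destruct (Req_dec (tau 0) 0) as [E | E]; [easy | ].
    assert (Hp := Rabs_pos_lt _ E). lra.
  - intros x. apply is_derive_Reals. intros e He.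
    assert (HXd := HX (tau x)). apply is_derive_Reals in HXd.
    destruct (HXd (e / 4) ltac:(lra)) as [d Hd].
    assert (Hdp := cond_pos d).
    exists (mkposreal (d / 2) ltac:(lra)). intros h Hh0 Hh. simpl in Hh.
    set (s := tau (x + h) - tau x).
    assert (Hs : Rabs s <= 3 / 2 * Rabs h).
    { assert (H := Hexp' (tau x) (tau (x + h))). rewrite !Htau in H.
      replace (x + h - x) with h in H by ring. exact H. }
    assert (Hs0 : s <> 0).
    { intros E. apply Hh0. unfold s in E.
      assert (E' : tau (x + h) = tau x) by lra.
      assert (E2 := Htau (x + h)). rewrite E', Htau in E2. lra. }
    specialize (Hd s Hs0 ltac:(lra)).
    replace (tau x + s) with (tau (x + h)) in Hd by (unfold s; ring). rewrite !Htau in Hd.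
    replace (x + h - x) with h in Hd by ring.
    assert (Hrx := Hr (tau x)). set (r := rho (tau x)) in *.
    replace (s / h - r) with ((h / s - / r) * - (r * (s / h))) by (field; lra).
    rewrite Rabs_mult, Rabs_Ropp, Rabs_mult.
    rewrite (Rabs_right r) by lra.
    assert (Hq : Rabs (s / h) <= 3 / 2).
    { unfold Rdiv at 1. rewrite Rabs_mult, Rabs_inv.
      assert (Hhp := Rabs_pos_lt h Hh0).
      apply Rmult_le_reg_r with (Rabs h); [easy | ].
      rewrite Rmult_assoc, Rinv_l by lra. lra. }
    assert (P1 := Rabs_pos (h / s - / r)). assert (P2 := Rabs_pos (s / h)).
    assert (r * Rabs (s / h) <= 9 / 4) by nra. nra.
Qed.

(** * Decay of a reparametrized profile *)

(** The logarithm of [exp(th x) p x] has derivative [w (p x) - w 0 = O(p x)], which is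
    integrable. *)
Lemma normalized_decay_bounded (w p : R -> R) (th L c : R) :
  0 < c -> w 0 = - th ->
  (forall v, 0 < v < 1 -> Rabs (w v - w 0) <= L * v) ->
  (forall x, is_derive p x (p x * w (p x))) ->
  (forall x, 0 < p x < 1) ->
  (forall x, 0 <= x -> p x <= exp (- c * x)) ->
  exists A, 0 < A /\ forall x, 0 <= x -> exp (th * x) * p x <= A.
Proof.
  intros Hc Hw0 HL Hp Hr Hdec.
  assert (HL0 : 0 <= L).
  { specialize (HL (/ 2) ltac:(lra)). assert (H := Rabs_pos (w (/ 2) - w 0)). lra. }
  set (l := fun x => ln (p x) + th * x).
  assert (Hl : forall x, is_derive l x (w (p x) - w 0)).
  { intros x. unfold l. specialize (Hr x). assert (Hpx := Hp x).
    auto_derive; [split; [now exists (p x * w (p x)) | lra] | ].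
    change (Derive (fun x => p x) x) with (Derive p x).
    rewrite (is_derive_unique _ _ _ Hpx), Hw0. field. lra. }
  assert (Hb := exp_decay_increment l (fun x => w (p x) - w 0) L c Hc (fun x _ => Hl x)).
  exists (exp (l 0 + L / c)). split; [apply exp_pos | ].
  intros x Hx.
  replace (exp (th * x) * p x) with (exp (l x)).
  - apply exp_le. apply Rle_trans with (l 0 + Rabs (l x - l 0)).
    + assert (H := Rle_abs (l x - l 0)). lra.
    + apply Rplus_le_compat_l. apply Hb; [ | easy].
      intros t Ht. eapply Rle_trans; [apply HL, Hr | ].
      apply Rmult_le_compat_l; [easy | now apply Hdec].
  - unfold l. rewrite exp_plus, exp_ln by apply Hr. ring.
Qed.

(** Since [tau' - 1 = O(eps)], the two times differ by [O(eps x)], which the exponential decay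
    of [p'] absorbs at the cost of an arbitrarily small part of the rate. With the exact rates
    nothing may be lost; but [th (zeta 0 x - tau x)] has derivative [O(eps p)], hence is
    [O(eps)] uniformly, and [exp(th x) p x] has an exponentially small derivative. *)
Lemma reparametrized_decay (w p : R -> R) (th L B A C al : R) :
  0 < th -> w 0 = - th -> 0 < A ->
  (forall v, 0 < v < 1 -> Rabs (w v - w 0) <= L * v) ->
  (forall v, 0 < v < 1 -> Rabs (w v) <= B) ->
  (forall x, is_derive p x (p x * w (p x))) ->
  (forall x, 0 < p x < 1) ->
  (forall x, 0 <= x -> exp (th * x) * p x <= A) ->
  0 <= C -> 0 < al < th ->
  exists eps1 D, 0 < eps1 /\ 0 <= D /\ forall eps zeta tau,
  0 <= eps <= eps1 ->
  (forall v, Rabs (zeta v - 1) <= C * eps) ->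
  (forall v, / 2 <= zeta v <= 3 / 2) ->
  (forall v, 0 < v < 1 -> Rabs (zeta v - zeta 0) <= C * eps * v) ->
  tau 0 = 0 ->
  (forall x, is_derive tau x (zeta (p (tau x)))) ->
  forall x, 0 <= x ->
    Rabs (p (tau x) - p x) <= D * eps * exp (- al * x) /\
    Rabs (exp (th * zeta 0 * x) * p (tau x) - exp (th * x) * p x) <= D * eps /\
    exp (th * zeta 0 * x) * p (tau x) <= D.
Proof.
  intros Hth Hw0 HA HL HB Hp Hr Hdec HC Hal.
  assert (HL0 : 0 <= L).
  { specialize (HL (/ 2) ltac:(lra)). assert (H := Rabs_pos (w (/ 2) - w 0)). lra. }
  assert (HB0 : 0 <= B) by (eapply Rle_trans; [apply Rabs_pos | apply (HB (/ 2)); lra]).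
  assert (Hdec' : forall x, 0 <= x -> p x <= A * exp (- th * x)).
  { intros x Hx. specialize (Hdec x Hx).
    replace (- th * x) with (- (th * x)) by ring. rewrite exp_Ropp.
    assert (He := exp_pos (th * x)).
    apply Rmult_le_reg_l with (exp (th * x)); [easy | ].
    replace (exp (th * x) * (A * / exp (th * x))) with A by (field; lra). easy. }
  (* half of the spare rate absorbs the time shift, the other half the factor [x] *)
  set (ka := (th - al) / 2).
  assert (Hka : 0 < ka) by (unfold ka; lra).
  (* the last two bounds give [C eps <= 1/2] and [th (1 - C eps) >= al + ka] *)
  set (eps1 := Rmin 1 (Rmin (/ (2 * (C + 1))) (ka / (th * (C + 1))))).
  assert (He1 : 0 < eps1).
  { unfold eps1. repeat apply Rmin_pos; [lra | apply Rinv_0_lt_compat; lra | ].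
    apply Rdiv_lt_0_compat; [easy | nra]. }
  set (E := exp (2 * C * A)).
  set (D1 := C * (B * A) * / ka).
  set (D2 := 2 * C * A * (1 + E) * A + C * (A * L * A) * / (th / 2)).
  set (D3 := E * A).
  assert (HE : 0 < E) by apply exp_pos.
  assert (Hika : 0 < / ka) by (now apply Rinv_0_lt_compat).
  assert (Hith : 0 < / (th / 2)) by (apply Rinv_0_lt_compat; lra).
  assert (HBA : 0 <= B * A) by nra.
  assert (HALA : 0 <= A * L * A) by (apply Rmult_le_pos; [apply Rmult_le_pos; lra | lra]).
  assert (HD1 : 0 <= D1).
  { unfold D1. apply Rmult_le_pos; [ | lra]. now apply Rmult_le_pos. }
  assert (HD2 : 0 <= D2).
  { unfold D2. apply Rplus_le_le_0_compat.
    - apply Rmult_le_pos; [ | lra]. apply Rmult_le_pos; [ | lra]. nra.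
    - apply Rmult_le_pos; [ | lra]. now apply Rmult_le_pos. }
  assert (HD3 : 0 <= D3) by (unfold D3; nra).
  exists eps1, (D1 + D2 + D3). split; [easy | ]. split; [lra | ].
  intros eps zeta tau [Heps Heps1] Hz1 Hz2 Hz0 Ht0 Htau.
  assert (Hee : eps <= 1 /\ C * eps <= / 2 /\ th * (C * eps) <= ka).
  { unfold eps1 in Heps1.
    assert (M1 := Rmin_l 1 (Rmin (/ (2 * (C + 1))) (ka / (th * (C + 1))))).
    assert (M2 := Rmin_r 1 (Rmin (/ (2 * (C + 1))) (ka / (th * (C + 1))))).
    assert (M3 := Rmin_l (/ (2 * (C + 1))) (ka / (th * (C + 1)))).
    assert (M4 := Rmin_r (/ (2 * (C + 1))) (ka / (th * (C + 1)))).
    split; [lra | ]. split.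
    - assert (H : eps <= / (2 * (C + 1))) by lra.
      apply Rmult_le_compat_l with (r := C + 1) in H; [ | lra].
      replace ((C + 1) * / (2 * (C + 1))) with (/ 2) in H by (field; lra). nra.
    - assert (H : eps <= ka / (th * (C + 1))) by lra.
      apply Rmult_le_compat_l with (r := th * (C + 1)) in H; [ | nra].
      replace (th * (C + 1) * (ka / (th * (C + 1)))) with ka in H by (field; lra). nra. }
  destruct Hee as [Hee1 [Hee2 Hee3]].
  assert (HCe : 0 <= C * eps) by nra.
  assert (Hhalf : forall x, 0 <= x -> / 2 * x <= tau x).
  { intros x Hx.
    assert (H := derive_nonneg_le (fun x => tau x - / 2 * x) (fun x => zeta (p (tau x)) - / 2) 0 x Hx).
    cbv beta in H. rewrite Ht0 in H. enough (0 - / 2 * 0 <= tau x - / 2 * x) by lra. apply H.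
    - intros t _. apply (is_derive_minus (V := R_NormedModule)); [apply Htau | ].
      auto_derive; [easy | ring].
    - intros t _. specialize (Hz2 (p (tau t))). lra. }
  assert (Hnear : forall x, 0 <= x -> Rabs (tau x - x) <= C * eps * x).
  { intros x Hx.
    assert (H := dominated_increment (fun x => tau x - x) (fun x => zeta (p (tau x)) - 1)
      (fun x => C * eps * x) (fun _ => C * eps) 0 x Hx).
    cbv beta in H. rewrite Ht0 in H.
    replace (tau x - x - (0 - 0)) with (tau x - x) in H by ring.
    rewrite Rmult_0_r, Rminus_0_r in H. apply H.
    - intros t _. apply (is_derive_minus (V := R_NormedModule)); [apply Htau | ].
      apply (is_derive_id (K := R_AbsRing)).
    - intros t _. auto_derive; [easy | ring].
    - intros t _. apply Hz1. }
  (* between [x] and [tau x] every point exceeds both [x / 2] and [(1 - C eps) x] *)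
  assert (Hbetween : forall x t, 0 <= x -> Rmin x (tau x) <= t <= Rmax x (tau x) ->
     0 <= t /\ / 2 * x <= t /\ (1 - C * eps) * x <= t).
  { intros x t Hx Ht. assert (H1 := Hhalf x Hx). assert (H2 := Hnear x Hx).
    apply Rabs_le_between in H2.
    assert (H3 : Rmin x (tau x) = x \/ Rmin x (tau x) = tau x)
      by (unfold Rmin; destruct Rle_dec; auto).
    assert (H4 : 0 <= C * eps * x) by now apply Rmult_le_pos.
    destruct H3 as [H3 | H3]; rewrite H3 in Ht; lra. }
  intros x Hx.
  set (d := fun x => th * (zeta 0 * x - tau x)).
  assert (Hd : Rabs (d x) <= 2 * C * A * eps).
  { assert (H := exp_decay_increment d (fun t => th * (zeta 0 - zeta (p (tau t))))
      (th * (C * eps) * A) (th / 2)).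
    assert (Hd0 : d 0 = 0) by (unfold d; rewrite Ht0; ring).
    rewrite Hd0 in H. specialize (H ltac:(lra)).
    replace (2 * C * A * eps) with (th * (C * eps) * A / (th / 2)) by (field; lra).
    rewrite <- (Rminus_0_r (d x)). apply H; [ | | easy].
    - intros t _. apply is_derive_scal.
      apply (is_derive_minus (V := R_NormedModule)); [ | apply Htau].
      auto_derive; [easy | ring].
    - intros t Ht. rewrite Rabs_mult, (Rabs_right th), Rabs_minus_sym by lra.
      specialize (Hhalf t Ht).
      rewrite !Rmult_assoc. apply Rmult_le_compat_l; [lra | ]. rewrite <- Rmult_assoc.
      eapply Rle_trans; [apply Hz0, Hr | ]. apply Rmult_le_compat_l; [easy | ].
      eapply Rle_trans; [apply Hdec'; lra | ]. apply Rmult_le_compat_l; [lra | ].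
      apply exp_le. nra. }
  assert (HdE : exp (d x) <= E).
  { unfold E. apply exp_le. assert (H := Rle_abs (d x)).
    assert (2 * C * A * eps <= 2 * C * A * 1) by (apply Rmult_le_compat_l; nra). lra. }
  assert (Hx1 := Hnear x Hx).
  split; [ | split].
  - apply Rle_trans with (B * (A * exp (- (al + ka) * x)) * Rabs (tau x - x)).
    + apply (derive_bounded_lipschitz p (fun t => p t * w (p t))).
      * intros t _. apply Hp.
      * intros t Ht. destruct (Hbetween x t Hx Ht) as [Ht1 [_ Ht2]].
        rewrite Rabs_mult, (Rabs_right (p t)) by (left; apply Hr). rewrite Rmult_comm.
        apply Rmult_le_compat; [apply Rabs_pos | left; apply Hr | apply HB, Hr | ].
        eapply Rle_trans; [now apply Hdec' | ]. apply Rmult_le_compat_l; [lra | ].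
        apply exp_le.
        assert (th * ((1 - C * eps) * x) <= th * t) by (apply Rmult_le_compat_l; lra).
        assert ((th * (C * eps)) * x <= ka * x) by (apply Rmult_le_compat_r; lra).
        unfold ka in *. lra.
    + replace (- (al + ka) * x) with (- al * x + - ka * x) by ring. rewrite exp_plus.
      assert (H1 := exp_pos (- al * x)). assert (H2 := exp_pos (- ka * x)).
      assert (H3 := linear_exp_le ka x Hka Hx).
      apply Rle_trans with (B * (A * (exp (- al * x) * exp (- ka * x))) * (C * eps * x)).
      { apply Rmult_le_compat_l; [ | easy]. apply Rmult_le_pos; [easy | ].
        apply Rmult_le_pos; [lra | ]. left. now apply Rmult_lt_0_compat. }
      replace (B * (A * (exp (- al * x) * exp (- ka * x))) * (C * eps * x))
        with ((C * (B * A) * eps * exp (- al * x)) * (x * exp (- ka * x))) by ring.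
      apply Rle_trans with ((C * (B * A) * eps * exp (- al * x)) * / ka).
      { apply Rmult_le_compat_l; [ | easy].
        apply Rmult_le_pos; [ | lra]. apply Rmult_le_pos; [ | lra]. now apply Rmult_le_pos. }
      replace (C * (B * A) * eps * exp (- al * x) * / ka) with (D1 * (eps * exp (- al * x)))
        by (unfold D1; ring).
      rewrite Rmult_assoc. apply Rmult_le_compat_r; [ | lra].
      apply Rmult_le_pos; lra.
  - set (P := fun x => exp (th * x) * p x).
    assert (HP : forall t, 0 <= t -> 0 <= P t <= A).
    { intros t Ht. unfold P. split; [ | now apply Hdec].
      left. apply Rmult_lt_0_compat; [apply exp_pos | apply Hr]. }
    assert (HPd : Rabs (P (tau x) - P x) <= C * (A * L * A) * / (th / 2) * eps).
    { apply Rle_trans with (A * (L * (A * exp (- (th / 2) * x))) * Rabs (tau x - x)).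
      - apply (derive_bounded_lipschitz P (fun t => P t * (w (p t) - w 0))).
        + intros t _. unfold P. assert (Hpt := Hp t). auto_derive; [now exists (p t * w (p t)) | ].
          change (Derive (fun x => p x) t) with (Derive p t).
          rewrite (is_derive_unique _ _ _ Hpt), Hw0. ring.
        + intros t Ht. destruct (Hbetween x t Hx Ht) as [Ht1 [Ht2 _]].
          specialize (HP t Ht1).
          rewrite Rabs_mult, (Rabs_right (P t)) by lra.
          apply Rmult_le_compat; [lra | apply Rabs_pos | lra | ].
          eapply Rle_trans; [apply HL, Hr | ]. apply Rmult_le_compat_l; [easy | ].
          eapply Rle_trans; [now apply Hdec' | ]. apply Rmult_le_compat_l; [lra | ].
          apply exp_le. nra.
      - assert (H2 := exp_pos (- (th / 2) * x)).
        assert (H3 := linear_exp_le (th / 2) x ltac:(lra) Hx).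
        apply Rle_trans with (A * (L * (A * exp (- (th / 2) * x))) * (C * eps * x)).
        { apply Rmult_le_compat_l; [ | easy]. apply Rmult_le_pos; [lra | ].
          apply Rmult_le_pos; [lra | ]. apply Rmult_le_pos; lra. }
        replace (A * (L * (A * exp (- (th / 2) * x))) * (C * eps * x))
          with ((C * eps * (A * L * A)) * (x * exp (- (th / 2) * x))) by ring.
        replace (C * (A * L * A) * / (th / 2) * eps)
          with ((C * eps * (A * L * A)) * / (th / 2)) by ring.
        apply Rmult_le_compat_l; [ | easy]. now apply Rmult_le_pos. }
    assert (Hfac : exp (th * zeta 0 * x) * p (tau x) = exp (d x) * P (tau x)).
    { unfold P, d. rewrite <- Rmult_assoc, <- exp_plus. f_equal. f_equal. ring. }
    rewrite Hfac. fold (P x).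
    replace (exp (d x) * P (tau x) - P x)
      with ((exp (d x) - exp 0) * P (tau x) + (P (tau x) - P x)) by (rewrite exp_0; ring).
    eapply Rle_trans; [apply Rabs_triang | ].
    assert (Hex := exp_diff_le 0 (d x)). rewrite exp_0, Rminus_0_r in Hex.
    assert (HPt := HP (tau x) ltac:(specialize (Hhalf x Hx); lra)).
    rewrite Rabs_mult, (Rabs_right (P (tau x))) by lra.
    assert (H1 : Rabs (exp (d x) - exp 0) * P (tau x) <= 2 * C * A * (1 + E) * A * eps).
    { rewrite exp_0. assert (0 < exp (d x)) by apply exp_pos.
      apply Rle_trans with ((1 + E) * (2 * C * A * eps) * A); [ | right; ring].
      apply Rmult_le_compat; [apply Rabs_pos | lra | | lra].
      eapply Rle_trans; [apply Hex | ]. apply Rmult_le_compat; [lra | apply Rabs_pos | lra | easy]. }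
    assert (0 <= D1 * eps) by now apply Rmult_le_pos.
    assert (0 <= D3 * eps) by now apply Rmult_le_pos.
    unfold D2. lra.
  - apply Rle_trans with D3; [ | lra]. unfold D3.
    replace (exp (th * zeta 0 * x) * p (tau x)) with (exp (d x) * (exp (th * tau x) * p (tau x))).
    + specialize (Hhalf x Hx).
      apply Rmult_le_compat; [left; apply exp_pos | | | apply Hdec; lra].
      * apply Rmult_le_pos; [left; apply exp_pos | left; apply Hr].
      * exact HdE.
    + unfold d. rewrite <- Rmult_assoc, <- exp_plus. f_equal. f_equal. ring.
Qed.

(** The case [p = y0] of the preceding estimates, with [w v = F v / v]. *)
Lemma half_line_estimates (F G y0 : R -> R) (C al : R) :
  normalized_shock F G -> inviscid_profile F y0 ->
  0 <= C -> 0 < al < - Derive F 0 ->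
  exists eps1 D, 0 < eps1 /\ 0 <= D /\
  (forall x, 0 <= x -> exp (- Derive F 0 * x) * y0 x <= D) /\
  forall eps z tau,
  0 <= eps <= eps1 ->
  (forall v, Rabs (z v - 1) <= C * eps) -> (forall v, / 2 <= z v <= 3 / 2) ->
  lipschitz (C * eps) z ->
  tau 0 = 0 -> (forall x, is_derive tau x (z (y0 (tau x)))) ->
  forall x, 0 <= x ->
    Rabs (y0 (tau x) - y0 x) <= D * eps * exp (- al * x) /\
    Rabs (exp (- Derive F 0 * z 0 * x) * y0 (tau x) - exp (- Derive F 0 * x) * y0 x) <= D * eps /\
    exp (- Derive F 0 * z 0 * x) * y0 (tau x) <= D.
Proof.
  intros HN HP HC Hal.
  assert (Hr := inviscid_profile_range F G y0 HN HP).
  destruct (inviscid_profile_decay F G y0 HN HP) as [c [Hc Hdec]].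
  destruct (quotient01_lipschitz F (ns_F HN)) as [K [HK0 HK]].
  destruct (quotient01_bounded F (ns_F HN)) as [B [HB0 HB]].
  assert (HQ0 : quotient01 F 0 = Derive F 0) by (apply quotient01_0; apply HN).
  set (w := fun v => (1 - v) * quotient01 F v).
  assert (Hw0 : w 0 = - - Derive F 0) by (unfold w; rewrite HQ0; ring).
  assert (HL : forall v, 0 < v < 1 -> Rabs (w v - w 0) <= (K + B) * v).
  { intros v Hv. unfold w.
    replace ((1 - v) * quotient01 F v - (1 - 0) * quotient01 F 0)
      with ((quotient01 F v - quotient01 F 0) - v * quotient01 F v) by ring.
    rewrite Rmult_plus_distr_r. apply Rabs_minus_le.
    - specialize (HK v 0). rewrite Rminus_0_r, (Rabs_right v) in HK by lra. exact HK.
    - rewrite Rabs_mult, (Rabs_right v), Rmult_comm by lra.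
      apply Rmult_le_compat_r; [lra | apply HB]. }
  assert (HwB : forall v, 0 < v < 1 -> Rabs (w v) <= B).
  { intros v Hv. unfold w. rewrite Rabs_mult, (Rabs_right (1 - v)) by lra.
    specialize (HB v). assert (H := Rabs_pos (quotient01 F v)). nra. }
  assert (Hp : forall x, is_derive y0 x (y0 x * w (y0 x))).
  { intros x. replace (y0 x * w (y0 x)) with (F (y0 x)); [apply HP | ].
    rewrite (quotient01_correct F (y0 x)); try apply HN.
    - unfold w. ring.
    - specialize (Hr x). lra. }
  destruct (normalized_decay_bounded w y0 (- Derive F 0) (K + B) c Hc Hw0 HL Hp Hr Hdec)
    as [A [HA HAb]].
  destruct (reparametrized_decay w y0 (- Derive F 0) (K + B) B A C al ltac:(lra) Hw0 HA HL HwB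
    Hp Hr HAb HC Hal) as [eps1 [D [He1 [HD Hmain]]]].
  exists eps1, (A + D). split; [easy | ]. split; [lra | ]. split.
  { intros x Hx. specialize (HAb x Hx). lra. }
  intros eps z tau Heps Hz1 Hz2 Hz3 Ht0 Htau x Hx.
  destruct (Hmain eps z tau Heps Hz1 Hz2) with (x := x) as [H1 [H2 H3]]; auto.
  { intros v Hv. specialize (Hz3 v 0). rewrite Rminus_0_r, (Rabs_right v) in Hz3 by lra.
    exact Hz3. }
  assert (He := exp_pos (- al * x)).
  repeat split.
  - eapply Rle_trans; [apply H1 | ]. apply Rmult_le_compat_r; [lra | ].
    apply Rmult_le_compat_r; lra.
  - eapply Rle_trans; [apply H2 | ]. apply Rmult_le_compat_r; lra.
  - lra.
Qed.

(** Exponential weight of rate [a] at plus infinity and [b] at minus infinity. *)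
Definition weight (a b x : R) : R := exp (a * Rmax x 0 + b * Rmax (- x) 0).

Lemma weight_pos (a b x : R) : 0 < weight a b x.
Proof. apply exp_pos. Qed.

Lemma weight_right (a b x : R) : 0 <= x -> weight a b x = exp (a * x).
Proof. intros H. unfold weight. rewrite Rmax_left, Rmax_right by lra. f_equal. ring. Qed.

Lemma weight_left (a b x : R) : x <= 0 -> weight a b x = exp (b * - x).
Proof. intros H. unfold weight. rewrite Rmax_right, Rmax_left by lra. f_equal. ring. Qed.

Lemma weight_opp (a b x : R) : weight a b x * weight (- a) (- b) x = 1.
Proof.
  unfold weight. rewrite <- exp_plus, <- exp_0. f_equal. ring.
Qed.

Lemma weight_le (a b a' b' x : R) : a <= a' -> b <= b' -> weight a b x <= weight a' b' x.
Proof.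
  intros Ha Hb. apply exp_le.
  assert (H1 := Rmax_r x 0). assert (H2 := Rmax_r (- x) 0). nra.
Qed.

(** [M] bounds both quantities, so that the relation is stable under products. *)
Definition comparable (M eps a b : R) : Prop :=
  Rabs a <= M /\ Rabs b <= M /\ Rabs (a - b) <= M * eps.

Lemma comparable_le (M M' eps a b : R) :
  0 <= eps -> M <= M' -> comparable M eps a b -> comparable M' eps a b.
Proof. intros He HM [H1 [H2 H3]]. repeat split; nra. Qed.

Lemma comparable_plus (M1 M2 eps a1 b1 a2 b2 : R) :
  comparable M1 eps a1 b1 -> comparable M2 eps a2 b2 ->
  comparable (M1 + M2) eps (a1 + a2) (b1 + b2).
Proof.
  intros [A1 [A2 A3]] [B1 [B2 B3]].
  apply Rabs_le_between in A1, A2, A3, B1, B2, B3.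
  repeat split; apply Rabs_le; lra.
Qed.

Lemma comparable_mult (M1 M2 eps a1 b1 a2 b2 : R) :
  comparable M1 eps a1 b1 -> comparable M2 eps a2 b2 ->
  comparable (2 * (M1 * M2)) eps (a1 * a2) (b1 * b2).
Proof.
  intros [A1 [A2 A3]] [B1 [B2 B3]].
  assert (P1 := Rabs_pos a1). assert (P2 := Rabs_pos a2).
  assert (P3 := Rabs_pos b1). assert (P4 := Rabs_pos b2).
  assert (HM : 0 <= M1 * M2) by nra.
  assert (Q1 : Rabs a1 * Rabs a2 <= M1 * M2) by (apply Rmult_le_compat; easy).
  assert (Q2 : Rabs b1 * Rabs b2 <= M1 * M2) by (apply Rmult_le_compat; easy).
  repeat split.
  - rewrite Rabs_mult. lra.
  - rewrite Rabs_mult. lra.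
  - replace (a1 * a2 - b1 * b2) with ((a1 - b1) * a2 + b1 * (a2 - b2)) by ring.
    eapply Rle_trans; [apply Rabs_triang | ]. rewrite !Rabs_mult.
    assert (Q3 : Rabs (a1 - b1) * Rabs a2 <= (M1 * eps) * M2)
      by (apply Rmult_le_compat; auto using Rabs_pos).
    assert (Q4 : Rabs b1 * Rabs (a2 - b2) <= M1 * (M2 * eps))
      by (apply Rmult_le_compat; auto using Rabs_pos).
    lra.
Qed.

(** If [y0' = F y0] and [tau' = z (y0 o tau)] then [y = y0 o tau] satisfies [y' = F y * z y]:
    the perturbed profile runs through the same heights as [y0] at another pace. *)
Record perturbed_profile (F G y0 : R -> R) (C eps sg : R) (z y : R -> R) : Prop := {
  pp_slope : slope_factor F G C eps sg z;
  pp_time : exists tau : R -> R, tau 0 = 0 /\ (forall x, is_derive tau x (z (y0 (tau x)))) /\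
      forall x, y x = y0 (tau x) }.

Arguments pp_slope {F G y0 C eps sg z y}.

(** By [sf_rate0] and [sf_rate1], the two exponential rates of the perturbed profile. *)
Definition rate_r (F z : R -> R) : R := - Derive F 0 * z 0.
Definition rate_l (F z : R -> R) : R := Derive F 1 * z 1.

(** The left end reduces to the right one through the symmetry [v -> 1 - v], [x -> - x] of the
    problem. *)
Lemma perturbed_profile_estimates (F G y0 : R -> R) (C al ar : R) :
  normalized_shock F G -> inviscid_profile F y0 ->
  0 <= C -> 0 < ar < - Derive F 0 -> 0 < al < Derive F 1 ->
  exists eps1 D, 0 < eps1 /\ 0 <= D /\
  forall eps sg z y, 0 <= eps <= eps1 -> perturbed_profile F G y0 C eps sg z y ->
  forall x,
    Rabs (y x - y0 x) <= D * eps * weight (- ar) (- al) x /\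
    comparable D eps (weight (rate_r F z) (rate_l F z) x * (y x * (1 - y x)))
      (weight (- Derive F 0) (Derive F 1) x * (y0 x * (1 - y0 x))) /\
    (0 <= x -> Rabs (exp (rate_r F z * x) * y x - exp (- Derive F 0 * x) * y0 x) <= D * eps) /\
    (x < 0 -> Rabs (exp (rate_l F z * - x) * (1 - y x) - exp (Derive F 1 * - x) * (1 - y0 x))
                <= D * eps).
Proof.
  intros HN HP HC Har Hal.
  assert (Hr := inviscid_profile_range F G y0 HN HP).
  assert (HN' := normalized_shock_reflect F G HN).
  assert (HP' := inviscid_profile_reflect F y0 HP).
  assert (HF' : Derive (fun v => F (1 - v)) 0 = - Derive F 1).
  { now rewrite Derive_reflect, Rminus_0_r by apply HN. }
  destruct (half_line_estimates F G y0 C ar HN HP HC Har)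
    as [e1 [D1 [He1 [HD1 [Hb1 Hm1]]]]].
  destruct (half_line_estimates _ _ _ C al HN' HP' HC) as [e2 [D2 [He2 [HD2 [Hb2 Hm2]]]]].
  { rewrite HF'. lra. }
  rewrite HF', Ropp_involutive in Hb2, Hm2.
  set (D := D1 + D2).
  exists (Rmin 1 (Rmin e1 e2)), (D + D * D). split; [now repeat apply Rmin_pos; try lra | ].
  assert (HD : 0 <= D) by (unfold D; lra).
  assert (HDD : 0 <= D * D) by nra.
  split; [lra | ].
  (* applied to the height on the right and to its distance to 1 on the left *)
  assert (Hprod : forall E E0 p p0 eps om, 0 <= eps -> 0 <= om <= 1 ->
    0 < E -> 0 < E0 -> 0 < p < 1 -> 0 < p0 < 1 ->
    Rabs (p - p0) <= D * eps * om -> Rabs (E * p - E0 * p0) <= D * eps ->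
    E * p <= D -> E0 * p0 <= D ->
    comparable (D + D * D) eps (E * (p * (1 - p))) (E0 * (p0 * (1 - p0)))).
  { intros E E0 p p0 eps om Heps Hom HE HE0 Hp Hp0 H1 H2 H3 H4.
    assert (Hpos1 : 0 <= E * p) by nra. assert (Hpos2 : 0 <= E0 * p0) by nra.
    repeat split.
    - rewrite Rabs_right by nra. nra.
    - rewrite Rabs_right by nra. nra.
    - replace (E * (p * (1 - p)) - E0 * (p0 * (1 - p0)))
        with ((E * p - E0 * p0) * (1 - p) - (E0 * p0) * (p - p0)) by ring.
      rewrite Rmult_plus_distr_r. apply Rabs_minus_le.
      + rewrite Rabs_mult, (Rabs_right (1 - p)) by lra.
        assert (H := Rabs_pos (E * p - E0 * p0)). nra.
      + rewrite Rabs_mult, (Rabs_right (E0 * p0)) by lra.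
        apply Rle_trans with (D * (D * eps)); [ | lra].
        apply Rmult_le_compat; auto using Rabs_pos.
        eapply Rle_trans; [apply H1 | ].
        assert (0 <= D * eps) by nra. nra. }
  intros eps sg z y [Heps1 Heps2] [Hsf [tau [Ht0 [Htau Hy]]]].
  assert (M1 := Rmin_l 1 (Rmin e1 e2)). assert (M2 := Rmin_r 1 (Rmin e1 e2)).
  assert (M3 := Rmin_l e1 e2). assert (M4 := Rmin_r e1 e2).
  intros x. rewrite Hy.
  assert (HDe : 0 <= D * eps) by nra.
  assert (Hom : forall a t, 0 < a -> 0 <= t -> 0 <= exp (- a * t) <= 1).
  { intros a t Ha Ht. split; [left; apply exp_pos | ]. rewrite <- exp_0. apply exp_le. nra. }
  destruct (Rle_dec 0 x) as [Hx | Hx].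
  - rewrite !weight_right by easy.
    destruct (Hm1 eps z tau ltac:(lra) (sf_close Hsf) (sf_range Hsf)
      (sf_lip Hsf) Ht0 Htau x Hx) as [H1 [H2 H3]].
    specialize (Hb1 x Hx). specialize (Hom ar x ltac:(lra) Hx).
    assert (H1' : Rabs (y0 (tau x) - y0 x) <= D * eps * exp (- ar * x)).
    { eapply Rle_trans; [apply H1 | ]. apply Rmult_le_compat_r; [lra | ].
      apply Rmult_le_compat_r; [lra | unfold D; lra]. }
    assert (H2' : Rabs (exp (rate_r F z * x) * y0 (tau x) - exp (- Derive F 0 * x) * y0 x)
              <= D * eps).
    { eapply Rle_trans; [apply H2 | ]. apply Rmult_le_compat_r; [lra | unfold D; lra]. }
    split; [ | split; [ | split; [intros _ | lra]]].
    + eapply Rle_trans; [apply H1' | ]. apply Rmult_le_compat_r; [lra | ]. nra.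
    + apply Hprod with (exp (- ar * x)); auto; try apply exp_pos; unfold D, rate_r; lra.
    + eapply Rle_trans; [apply H2' | ]. nra.
  - rewrite !weight_left by lra.
    destruct (Hm2 eps (fun v => z (1 - v)) (fun x => - tau (- x)) ltac:(lra)) with (x := - x)
      as [H1 [H2 H3]].
    + intros v. apply (sf_close Hsf).
    + intros v. apply (sf_range Hsf).
    + intros a b. eapply Rle_trans; [apply (sf_lip Hsf) | ].
      replace (1 - a - (1 - b)) with (- (a - b)) by ring. rewrite Rabs_Ropp. lra.
    + rewrite Ropp_0, Ht0. ring.
    + intros t. evar_last.
      * apply (is_derive_opp (V := R_NormedModule) (fun x => tau (- x))).
        apply (is_derive_comp tau Ropp); [apply Htau | ].
        auto_derive; [easy | reflexivity].
      * unfold opp, scal; simpl; unfold mult; simpl.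
        rewrite Ropp_involutive. replace (1 - (1 - y0 (tau (- t)))) with (y0 (tau (- t))) by ring.
        ring.
    + lra.
    + specialize (Hb2 (- x) ltac:(lra)). specialize (Hom al (- x) ltac:(lra) ltac:(lra)).
      rewrite !Ropp_involutive in H1, H2, H3. rewrite !Ropp_involutive in Hb2.
      rewrite Rminus_0_r in H2, H3.
      replace (1 - y0 (tau x) - (1 - y0 x)) with (- (y0 (tau x) - y0 x)) in H1 by ring.
      rewrite Rabs_Ropp in H1.
      assert (H1' : Rabs (y0 (tau x) - y0 x) <= D * eps * exp (- al * - x)).
      { eapply Rle_trans; [apply H1 | ]. apply Rmult_le_compat_r; [lra | ].
        apply Rmult_le_compat_r; [lra | unfold D; lra]. }
      assert (H2' : Rabs (exp (rate_l F z * - x) * (1 - y0 (tau x))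
                - exp (Derive F 1 * - x) * (1 - y0 x)) <= D * eps).
      { eapply Rle_trans; [apply H2 | ]. apply Rmult_le_compat_r; [lra | unfold D; lra]. }
      split; [ | split; [ | split; [lra | intros _]]].
      * eapply Rle_trans; [apply H1' | ]. apply Rmult_le_compat_r; [lra | ]. nra.
      * replace (y0 (tau x) * (1 - y0 (tau x)))
          with ((1 - y0 (tau x)) * (1 - (1 - y0 (tau x)))) by ring.
        replace (y0 x * (1 - y0 x)) with ((1 - y0 x) * (1 - (1 - y0 x))) by ring.
        assert (Hr1 := Hr (tau x)). assert (Hr2 := Hr x).
        apply Hprod with (exp (- al * - x)); auto; try apply exp_pos;
          try (unfold D, rate_l; lra).
        replace (1 - y0 (tau x) - (1 - y0 x)) with (- (y0 (tau x) - y0 x)) by ring.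
        now rewrite Rabs_Ropp.
      * eapply Rle_trans; [apply H2' | ]. nra.
Qed.

(** * Derivatives of a wave *)

Definition wave (F G : R -> R) (eps sg : R) (y : R -> R) : Prop :=
  forall x, ex_derive y x /\
    is_derive (Derive y) x ((Derive F (y x) - sg) * Derive y x - eps * G (y x)).

Lemma perturbed_profile_derive (F G y0 : R -> R) (C eps sg : R) (z y : R -> R) :
  normalized_shock F G -> inviscid_profile F y0 -> perturbed_profile F G y0 C eps sg z y ->
  (forall x, 0 < y x < 1) /\ y 0 = / 2 /\
  (forall x, is_derive y x (F (y x) * z (y x))) /\ wave F G eps sg y.
Proof.
  intros HN HP [Hsf [tau [Ht0 [Htau Hy]]]].
  assert (Hr := inviscid_profile_range F G y0 HN HP).
  assert (Hyr : forall x, 0 < y x < 1) by (intros x; rewrite Hy; apply Hr).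
  assert (Hd : forall x, is_derive y x (F (y x) * z (y x))).
  { intros x. apply (is_derive_ext (fun x => y0 (tau x))).
    - intros t. now rewrite Hy.
    - rewrite Hy. evar_last.
      + apply (is_derive_comp y0 tau); [apply HP | apply Htau].
      + unfold scal; simpl; unfold mult; simpl. ring. }
  assert (HD : forall x, Derive y x = F (y x) * z (y x)).
  { intros x. now apply is_derive_unique. }
  split; [exact Hyr | ]. split; [rewrite Hy, Ht0; apply HP | ]. split; [exact Hd | ].
  intros x. split; [exists (F (y x) * z (y x)); apply Hd | ].
  apply (is_derive_ext (fun t => (fun v => F v * z v) (y t))).
  - intros t. symmetry. apply HD.
  - evar_last.
    + apply (is_derive_comp (fun v => F v * z v) y).
      * apply (sf_ode Hsf). apply Hyr.
      * apply Hd.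
    + unfold scal; simpl; unfold mult; simpl. rewrite HD.
      destruct (quotient01_negative F G HN) as [c [Hc HQ]].
      specialize (HQ (y x)). specialize (Hyr x).
      assert (Hz := sf_range Hsf (y x)).
      assert (EG : G (y x) = y x * (1 - y x) * quotient01 G (y x))
        by (apply quotient01_correct; apply HN || lra).
      assert (EF : F (y x) = y x * (1 - y x) * quotient01 F (y x))
        by (apply quotient01_correct; apply HN || lra).
      rewrite EG, EF. field. lra.
Qed.

Lemma inviscid_profile_wave (F G y0 : R -> R) :
  smooth F -> inviscid_profile F y0 -> wave F G 0 0 y0.
Proof.
  intros HF [Hd _] x.
  assert (HD : forall x, Derive y0 x = F (y0 x)) by (intros t; now apply is_derive_unique).
  split; [exists (F (y0 x)); apply Hd | ].
  apply (is_derive_ext (fun t => F (y0 t))); [intros t; symmetry; apply HD | ].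
  evar_last.
  - apply (is_derive_comp F y0); [now apply smooth_is_derive | apply Hd].
  - unfold scal; simpl; unfold mult; simpl. rewrite HD. ring.
Qed.

(** Differential expressions in a wave. They form a class containing the slope and stable under
    differentiation along the wave, because the equation expresses the derivative of the slope;
    hence all derivatives of a wave belong to it. *)
Inductive expr : Type :=
  | Height (a : R -> R)
  | Strength
  | Speed
  | Slope
  | Source
  | Add (e1 e2 : expr)
  | Mul (e1 e2 : expr).

Fixpoint eval (G : R -> R) (e : expr) (eps sg : R) (y : R -> R) (x : R) : R :=
  match e with
  | Height a => a (y x)
  | Strength => eps
  | Speed => sg
  | Slope => Derive y x
  | Source => G (y x)
  | Add e1 e2 => eval G e1 eps sg y x + eval G e2 eps sg y x
  | Mul e1 e2 => eval G e1 eps sg y x * eval G e2 eps sg y x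
  end.

Fixpoint smooth_expr (e : expr) : Prop :=
  match e with
  | Height a => smooth a
  | Add e1 e2 | Mul e1 e2 => smooth_expr e1 /\ smooth_expr e2
  | _ => True
  end.

(** Expressions containing in each term a factor that decays at the exact rate at both ends. *)
Fixpoint decaying (e : expr) : Prop :=
  match e with
  | Height _ | Strength | Speed => False
  | Slope | Source => True
  | Add e1 e2 => decaying e1 /\ decaying e2
  | Mul e1 e2 => decaying e1 \/ decaying e2
  end.

Definition constant (c : R) : expr := Height (fun _ => c).

Fixpoint diff (F G : R -> R) (e : expr) : expr :=
  match e with
  | Height a => Mul (Height (Derive a)) Slope
  | Strength | Speed => constant 0
  | Slope =>
      Add (Mul (Add (Height (Derive F)) (Mul (constant (-1)) Speed)) Slope)
          (Mul (Mul (constant (-1)) Strength) Source)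
  | Source => Mul (Height (Derive G)) Slope
  | Add e1 e2 => Add (diff F G e1) (diff F G e2)
  | Mul e1 e2 => Add (Mul (diff F G e1) e2) (Mul e1 (diff F G e2))
  end.

Lemma smooth_constant (c : R) : smooth (fun _ => c).
Proof. intros n x. apply ex_derive_n_const. Qed.

Lemma smooth_expr_diff (F G : R -> R) (e : expr) :
  smooth F -> smooth G -> smooth_expr e -> smooth_expr (diff F G e).
Proof.
  intros HF HG.
  induction e as [ | | | | | e1 IH1 e2 IH2 | e1 IH1 e2 IH2]; simpl; intros H;
    repeat split; try tauto; auto using smooth_Derive, smooth_constant.
Qed.

Lemma decaying_diff (F G : R -> R) (e : expr) : decaying e -> decaying (diff F G e).
Proof. induction e; simpl; tauto. Qed.

Lemma eval_diff (F G : R -> R) (e : expr) (eps sg : R) (y : R -> R) (x : R) :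
  smooth G -> wave F G eps sg y -> smooth_expr e ->
  is_derive (eval G e eps sg y) x (eval G (diff F G e) eps sg y x).
Proof.
  intros HG Hw. destruct (Hw x) as [Hd1 Hd2].
  assert (Hcomp : forall a, smooth a ->
            is_derive (fun x => a (y x)) x (Derive a (y x) * Derive y x)).
  { intros a Ha. rewrite Rmult_comm.
    apply (is_derive_comp a y); [now apply smooth_is_derive | now apply Derive_correct]. }
  induction e as [a | | | | | e1 IH1 e2 IH2 | e1 IH1 e2 IH2]; simpl; intros H.
  - now apply Hcomp.
  - apply (is_derive_const (K := R_AbsRing) (V := R_NormedModule)).
  - apply (is_derive_const (K := R_AbsRing) (V := R_NormedModule)).
  - evar_last; [exact Hd2 | ]. simpl. ring.
  - now apply Hcomp.
  - apply (is_derive_plus (V := R_NormedModule)); tauto.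
  - apply (is_derive_mult (K := R_AbsRing)); try tauto. intros n m. apply Rmult_comm.
Qed.

Lemma eval_Derive_n (F G : R -> R) (eps sg : R) (y : R -> R) :
  smooth F -> smooth G -> wave F G eps sg y ->
  forall n x, is_derive (Derive_n y n) x
    (eval G (Nat.iter n (diff F G) Slope) eps sg y x).
Proof.
  intros HF HG Hw.
  assert (Hs : forall n, smooth_expr (Nat.iter n (diff F G) Slope)).
  { induction n as [ | n IH]; simpl; [easy | ]. now apply smooth_expr_diff. }
  induction n as [ | n IH]; intros x.
  - simpl. apply Derive_correct. apply Hw.
  - apply (is_derive_ext (eval G (Nat.iter n (diff F G) Slope) eps sg y)).
    + intros t. symmetry. simpl. apply is_derive_unique, IH.
    + simpl. now apply eval_diff.
Qed.

Lemma wave_smooth (F G : R -> R) (eps sg : R) (y : R -> R) :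
  smooth F -> smooth G -> wave F G eps sg y -> smooth y.
Proof.
  intros HF HG Hw [ | n] x; [easy | ]. simpl.
  exists (eval G (Nat.iter n (diff F G) Slope) eps sg y x).
  now apply eval_Derive_n.
Qed.

Lemma wave_Derive_n (F G : R -> R) (eps sg : R) (y : R -> R) (n : nat) (x : R) :
  smooth F -> smooth G -> wave F G eps sg y ->
  Derive_n y (S n) x = eval G (Nat.iter n (diff F G) Slope) eps sg y x.
Proof. intros HF HG Hw. simpl. apply is_derive_unique. now apply eval_Derive_n. Qed.

(** An induction that needs the estimates only for the height, the parameters, the slope and the
    source; [E] and [E0] stand for the values at [x] of the two weights, and multiply one
    decaying factor of each term. *)
Lemma eval_close (G y0 : R -> R) (M : R) (e : expr) :
  0 <= M -> smooth_expr e -> (forall x, 0 <= y0 x <= 1) ->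
  exists M', 0 <= M' /\
  forall eps sg y E E0 x, 0 <= eps <= 1 -> 0 <= y x <= 1 ->
  Rabs sg <= M * eps ->
  Rabs (y x - y0 x) <= M * eps ->
  comparable M eps (Derive y x) (Derive y0 x) ->
  comparable M eps (E * Derive y x) (E0 * Derive y0 x) ->
  comparable M eps (G (y x)) (G (y0 x)) ->
  comparable M eps (E * G (y x)) (E0 * G (y0 x)) ->
  comparable M' eps (eval G e eps sg y x) (eval G e 0 0 y0 x) /\
  (decaying e -> comparable M' eps (E * eval G e eps sg y x) (E0 * eval G e 0 0 y0 x)).
Proof.
  intros HM Hs Hr0.
  induction e as [a | | | | | e1 IH1 e2 IH2 | e1 IH1 e2 IH2]; simpl in Hs |- *.
  - destruct (continuous_bounded a 0 1) as [B HB]; [intros x; now apply smooth_continuous | ].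
    destruct (smooth_lipschitz_on a 0 1 Hs) as [K [HK0 HK]].
    assert (HB0 : 0 <= B) by (eapply Rle_trans; [apply Rabs_pos | apply (HB 0); lra]).
    assert (HKM : 0 <= K * M) by nra.
    exists (B + K * M). split; [lra | ].
    intros eps sg y E E0 x Heps Hy _ Hd _ _ _ _. split; [ | easy].
    assert (H1 := HB (y x) Hy). assert (H2 := HB (y0 x) (Hr0 x)).
    repeat split; try lra.
    eapply Rle_trans; [apply HK; auto | ].
    assert (K * Rabs (y x - y0 x) <= K * (M * eps)) by (apply Rmult_le_compat_l; easy).
    nra.
  - exists 1. split; [lra | ]. intros eps sg y E E0 x Heps _ _ _ _ _ _ _. split; [ | easy].
    repeat split; rewrite ?Rminus_0_r, ?Rabs_R0, ?(Rabs_right eps) by lra; lra.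
  - exists M. split; [lra | ]. intros eps sg y E E0 x Heps _ Hsg _ _ _ _ _. split; [ | easy].
    repeat split; rewrite ?Rminus_0_r, ?Rabs_R0; nra.
  - exists M. split; [lra | ]. now intros eps sg y E E0 x _ _ _ _ H1 H2 _ _.
  - exists M. split; [lra | ]. now intros eps sg y E E0 x _ _ _ _ _ _ H1 H2.
  - destruct IH1 as [M1 [HM1 H1]]; [easy | ]. destruct IH2 as [M2 [HM2 H2]]; [easy | ].
    exists (M1 + M2). split; [lra | ].
    intros eps sg y E E0 x Heps Hy Ha Hb Hc Hd He Hf.
    destruct (H1 eps sg y E E0 x) as [A1 A2]; auto.
    destruct (H2 eps sg y E E0 x) as [B1 B2]; auto.
    split; [now apply comparable_plus | ]. intros [Hd1 Hd2].
    rewrite !Rmult_plus_distr_l. apply comparable_plus; auto.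
  - destruct IH1 as [M1 [HM1 H1]]; [easy | ]. destruct IH2 as [M2 [HM2 H2]]; [easy | ].
    exists (2 * (M1 * M2)). split; [nra | ].
    intros eps sg y E E0 x Heps Hy Ha Hb Hc Hd He Hf.
    destruct (H1 eps sg y E E0 x) as [A1 A2]; auto.
    destruct (H2 eps sg y E E0 x) as [B1 B2]; auto.
    split; [now apply comparable_mult | ]. intros [Hd1 | Hd2].
    + replace (E * (eval G e1 eps sg y x * eval G e2 eps sg y x))
        with (E * eval G e1 eps sg y x * eval G e2 eps sg y x) by ring.
      replace (E0 * (eval G e1 0 0 y0 x * eval G e2 0 0 y0 x))
        with (E0 * eval G e1 0 0 y0 x * eval G e2 0 0 y0 x) by ring.
      apply comparable_mult; auto.
    + replace (E * (eval G e1 eps sg y x * eval G e2 eps sg y x))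
        with (eval G e1 eps sg y x * (E * eval G e2 eps sg y x)) by ring.
      replace (E0 * (eval G e1 0 0 y0 x * eval G e2 0 0 y0 x))
        with (eval G e1 0 0 y0 x * (E0 * eval G e2 0 0 y0 x)) by ring.
      apply comparable_mult; auto.
Qed.

(** * Existence in normalized variables *)

(** The rates satisfy [t = b + m / t], that is the quadratic equation [t ^ 2 - b t - m = 0],
    whose only positive root is this one. *)
Lemma positive_root (b m t : R) :
  0 <= m -> 0 < t -> t = b + m / t -> t = / 2 * b + / 2 * sqrt (b ^ 2 + 4 * m).
Proof.
  intros Hm Ht E.
  assert (E2 : t * t = b * t + m) by (rewrite E at 2; field; lra).
  assert (Hmt : 0 <= m / t) by (apply Rle_div_r; lra).
  replace (b ^ 2 + 4 * m) with ((2 * t - b) * (2 * t - b)) by (simpl; nra).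
  rewrite sqrt_square by lra. field.
Qed.

Lemma rate_r_formula (F G : R -> R) (C eps sg : R) (z : R -> R) :
  normalized_shock F G -> slope_factor F G C eps sg z -> 0 <= eps ->
  rate_r F z = / 2 * (sg - Derive F 0)
    + / 2 * sqrt ((sg - Derive F 0) ^ 2 + 4 * (eps * Rabs (Derive G 0))).
Proof.
  intros HN Hsf Heps.
  assert (H0 := ns_dF0 HN). assert (HG := ns_dG0 HN).
  assert (Hz := sf_range Hsf 0).
  assert (E := sf_rate0 Hsf).
  unfold rate_r. apply positive_root.
  - assert (H := Rabs_pos (Derive G 0)). nra.
  - nra.
  - rewrite Rabs_left by easy.
    replace (- Derive F 0 * z 0) with (- (Derive F 0 * z 0)) by ring.
    rewrite E at 1. field. lra.
Qed.

Lemma rate_l_formula (F G : R -> R) (C eps sg : R) (z : R -> R) :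
  normalized_shock F G -> slope_factor F G C eps sg z -> 0 <= eps ->
  rate_l F z = / 2 * (Derive F 1 - sg)
    + / 2 * sqrt ((Derive F 1 - sg) ^ 2 + 4 * (eps * Rabs (Derive G 1))).
Proof.
  intros HN Hsf Heps.
  assert (H0 := ns_dF1 HN). assert (HG := ns_dG1 HN).
  assert (Hz := sf_range Hsf 1).
  assert (E := sf_rate1 Hsf).
  unfold rate_l. apply positive_root.
  - assert (H := Rabs_pos (Derive G 1)). nra.
  - nra.
  - rewrite Rabs_left by easy. rewrite E at 1. field. lra.
Qed.

Record profile_estimates (F y0 : R -> R) (al ar : R) (k0 : nat)
    (D eps : R) (z y : R -> R) : Prop := {
  pe_height : forall x, Rabs (y x - y0 x) <= D * eps * weight (- ar) (- al) x;
  pe_slope : forall x, Rabs (Derive y x - Derive y0 x) <= D * eps * weight (- ar) (- al) x;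
  pe_right : forall x, 0 <= x ->
    Rabs (exp (rate_r F z * x) * y x - exp (- Derive F 0 * x) * y0 x) <= D * eps;
  pe_left : forall x, x < 0 ->
    Rabs (exp (rate_l F z * - x) * (1 - y x) - exp (Derive F 1 * - x) * (1 - y0 x)) <= D * eps;
  pe_derivatives : forall k x, (1 <= k <= k0)%nat ->
    Rabs (weight (rate_r F z) (rate_l F z) x * Derive_n y k x
          - weight (- Derive F 0) (Derive F 1) x * Derive_n y0 k x) <= D * eps }.

Arguments pe_height {F y0 al ar k0 D eps z y}.
Arguments pe_slope {F y0 al ar k0 D eps z y}.
Arguments pe_right {F y0 al ar k0 D eps z y}.
Arguments pe_left {F y0 al ar k0 D eps z y}.
Arguments pe_derivatives {F y0 al ar k0 D eps z y}.

(** The slope and the source are both [y (1 - y)] times a Lipschitz function of the height, so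
    that the estimate of the weighted [y (1 - y)] starts the induction of [eval_close]. *)
Lemma profile_derivative_estimates (F G y0 : R -> R) (C D1 : R) (k0 : nat) :
  normalized_shock F G -> inviscid_profile F y0 -> 0 <= C -> 0 <= D1 ->
  exists D, 0 <= D /\
  forall eps sg z y, 0 <= eps <= 1 -> perturbed_profile F G y0 C eps sg z y ->
  (forall x, Rabs (y x - y0 x) <= D1 * eps) ->
  (forall x, comparable D1 eps (weight (rate_r F z) (rate_l F z) x * (y x * (1 - y x)))
      (weight (- Derive F 0) (Derive F 1) x * (y0 x * (1 - y0 x)))) ->
  forall k x, (1 <= k <= k0)%nat ->
    Rabs (weight (rate_r F z) (rate_l F z) x * Derive_n y k x
          - weight (- Derive F 0) (Derive F 1) x * Derive_n y0 k x) <= D * eps.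
Proof.
  intros HN HP HC HD1.
  assert (HF := ns_F HN). assert (HG := ns_G HN).
  assert (Hr0 := inviscid_profile_range F G y0 HN HP).
  assert (Hw0 := inviscid_profile_wave F G y0 HF HP).
  destruct (quotient01_lipschitz F HF) as [KF [HKF LF]].
  destruct (quotient01_bounded F HF) as [BF [HBF0 HBF]].
  destruct (quotient01_lipschitz G HG) as [KG [HKG LG]].
  destruct (quotient01_bounded G HG) as [BG [HBG0 HBG]].
  assert (HKF1 : 0 <= KF * D1) by nra. assert (HKG1 : 0 <= KG * D1) by nra.
  set (MQ := BF + KF * D1). set (MP := BG + KG * D1). set (Mz := 2 + C).
  set (Mh := 1 + 2 * D1).
  assert (HMQ : 0 <= MQ) by (unfold MQ; lra). assert (HMP : 0 <= MP) by (unfold MP; lra).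
  assert (HMz : 0 <= Mz) by (unfold Mz; lra). assert (HMh : 0 <= Mh) by (unfold Mh; lra).
  set (S1 := 2 * (Mh * (2 * (MQ * Mz)))). set (S2 := 2 * (D1 * (2 * (MQ * Mz)))).
  set (S3 := 2 * (Mh * MP)). set (S4 := 2 * (D1 * MP)).
  assert (HMM : 0 <= MQ * Mz) by nra.
  assert (HS1 : 0 <= S1) by (unfold S1; nra). assert (HS2 : 0 <= S2) by (unfold S2; nra).
  assert (HS3 : 0 <= S3) by (unfold S3; nra). assert (HS4 : 0 <= S4) by (unfold S4; nra).
  set (M := C + D1 + S1 + S2 + S3 + S4).
  assert (HM : 0 <= M) by (unfold M; lra).
  assert (Hatoms : forall eps sg z y, 0 <= eps <= 1 -> perturbed_profile F G y0 C eps sg z y ->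
    (forall x, Rabs (y x - y0 x) <= D1 * eps) ->
    (forall x, comparable D1 eps (weight (rate_r F z) (rate_l F z) x * (y x * (1 - y x)))
      (weight (- Derive F 0) (Derive F 1) x * (y0 x * (1 - y0 x)))) ->
    wave F G eps sg y /\ forall x, 0 <= y x <= 1 /\ Rabs sg <= M * eps /\
      Rabs (y x - y0 x) <= M * eps /\
      comparable M eps (Derive y x) (Derive y0 x) /\
      comparable M eps (weight (rate_r F z) (rate_l F z) x * Derive y x)
        (weight (- Derive F 0) (Derive F 1) x * Derive y0 x) /\
      comparable M eps (G (y x)) (G (y0 x)) /\
      comparable M eps (weight (rate_r F z) (rate_l F z) x * G (y x))
        (weight (- Derive F 0) (Derive F 1) x * G (y0 x))).
  { intros eps sg z y Heps Hpp H1 H2.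
    destruct (perturbed_profile_derive F G y0 C eps sg z y HN HP Hpp) as [Hr [_ [Hd Hw]]].
    split; [easy | ]. intros x. specialize (H1 x). specialize (H2 x).
    specialize (Hr x). specialize (Hr0 x).
    set (E := weight (rate_r F z) (rate_l F z) x) in *.
    set (E0 := weight (- Derive F 0) (Derive F 1) x) in *.
    assert (Dy : Derive y x = (y x * (1 - y x)) * (quotient01 F (y x) * z (y x))).
    { rewrite (is_derive_unique _ _ _ (Hd x)), (quotient01_correct F (y x)) by (apply HN || lra).
      ring. }
    assert (Dy0 : Derive y0 x = (y0 x * (1 - y0 x)) * (quotient01 F (y0 x) * 1)).
    { rewrite (is_derive_unique _ _ _ (proj1 HP x)),
        (quotient01_correct F (y0 x)) by (apply HN || lra). ring. }
    assert (Gy : forall v, 0 < v < 1 -> G v = v * (1 - v) * quotient01 G v).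
    { intros v Hv. apply quotient01_correct; apply HN || lra. }
    assert (CQ : comparable MQ eps (quotient01 F (y x)) (quotient01 F (y0 x))).
    { repeat split; try (eapply Rle_trans; [apply HBF | unfold MQ; lra]).
      eapply Rle_trans; [apply LF | ].
      assert (KF * Rabs (y x - y0 x) <= KF * (D1 * eps)) by (apply Rmult_le_compat_l; easy).
      unfold MQ. nra. }
    assert (CP : comparable MP eps (quotient01 G (y x)) (quotient01 G (y0 x))).
    { repeat split; try (eapply Rle_trans; [apply HBG | unfold MP; lra]).
      eapply Rle_trans; [apply LG | ].
      assert (KG * Rabs (y x - y0 x) <= KG * (D1 * eps)) by (apply Rmult_le_compat_l; easy).
      unfold MP. nra. }
    assert (Cz : comparable Mz eps (z (y x)) 1).
    { assert (Hz := sf_range (pp_slope Hpp) (y x)).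
      assert (Hz' := sf_close (pp_slope Hpp) (y x)).
      repeat split.
      - rewrite Rabs_right by lra. unfold Mz. lra.
      - rewrite Rabs_R1. unfold Mz. lra.
      - unfold Mz. lra. }
    assert (Ch : comparable Mh eps (y x * (1 - y x)) (y0 x * (1 - y0 x))).
    { repeat split.
      - rewrite Rabs_right by nra. unfold Mh. nra.
      - rewrite Rabs_right by nra. unfold Mh. nra.
      - replace (y x * (1 - y x) - y0 x * (1 - y0 x))
          with ((y x - y0 x) * (1 - y x - y0 x)) by ring.
        rewrite Rabs_mult. assert (Rabs (1 - y x - y0 x) <= 1) by (apply Rabs_le; lra).
        assert (P1 := Rabs_pos (y x - y0 x)). unfold Mh. nra. }
    assert (CS := comparable_mult _ _ _ _ _ _ _ CQ Cz).
    split; [lra | ]. split; [ | split; [ | split; [ | split; [ | split]]]].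
    - eapply Rle_trans; [apply (sf_speed (pp_slope Hpp)) | ].
      apply Rmult_le_compat_r; [lra | unfold M; lra].
    - eapply Rle_trans; [apply H1 | ].
      apply Rmult_le_compat_r; [lra | unfold M; lra].
    - apply (comparable_le S1); [lra | unfold M; lra | ].
      rewrite Dy, Dy0. now apply comparable_mult.
    - apply (comparable_le S2); [lra | unfold M; lra | ].
      rewrite Dy, Dy0, <- (Rmult_assoc E), <- (Rmult_assoc E0). now apply comparable_mult.
    - apply (comparable_le S3); [lra | unfold M; lra | ].
      rewrite !Gy by easy. now apply comparable_mult.
    - apply (comparable_le S4); [lra | unfold M; lra | ].
      rewrite !Gy, <- (Rmult_assoc E), <- (Rmult_assoc E0) by easy. now apply comparable_mult. }
  induction k0 as [ | k0 IH].
  - exists 0. split; [lra | ]. intros. lia.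
  - destruct IH as [D [HD IH]].
    assert (Hse : smooth_expr (Nat.iter k0 (diff F G) Slope)).
    { clear IH. induction k0 as [ | n IHn]; simpl; [easy | ]. now apply smooth_expr_diff. }
    assert (Hde : decaying (Nat.iter k0 (diff F G) Slope)).
    { clear IH Hse. induction k0 as [ | n IHn]; simpl; [easy | ]. now apply decaying_diff. }
    destruct (eval_close G y0 M _ HM Hse) as [M' [HM' Hev]].
    { intros x. specialize (Hr0 x). lra. }
    exists (D + M'). split; [lra | ].
    intros eps sg z y Heps Hpp H1 H2 k x Hk.
    destruct (Nat.eq_dec k (S k0)) as [-> | Hne].
    + destruct (Hatoms eps sg z y Heps Hpp H1 H2) as [Hw Hx].
      destruct (Hx x) as [A1 [A2 [A3 [A4 [A5 [A6 A7]]]]]].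
      rewrite (wave_Derive_n F G eps sg y), (wave_Derive_n F G 0 0 y0) by easy.
      destruct (Hev eps sg y _ _ x Heps A1 A2 A3 A4 A5 A6 A7) as [_ Hc].
      destruct (Hc Hde) as [_ [_ Hfin]]. eapply Rle_trans; [apply Hfin | ].
      apply Rmult_le_compat_r; lra.
    + eapply Rle_trans; [apply (IH eps sg z y); auto; lia | ].
      apply Rmult_le_compat_r; lra.
Qed.

Lemma normalized_existence (F G y0 : R -> R) (al ar : R) (k0 : nat) :
  normalized_shock F G -> inviscid_profile F y0 ->
  0 < ar < - Derive F 0 -> 0 < al < Derive F 1 ->
  exists eps1 C D, 0 < eps1 /\ 0 <= C /\ 0 <= D /\
  forall eps, 0 <= eps <= eps1 ->
  exists sg z y, perturbed_profile F G y0 C eps sg z y /\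
    profile_estimates F y0 al ar k0 D eps z y.
Proof.
  intros HN HP Har Hal.
  assert (HF := ns_F HN).
  assert (Hr0 := inviscid_profile_range F G y0 HN HP).
  destruct (slope_factor_exists F G HN) as [e1 [C [He1 [HC Hex]]]].
  destruct (perturbed_profile_estimates F G y0 C al ar HN HP HC Har Hal)
    as [e2 [D1 [He2 [HD1 Hest]]]].
  destruct (profile_derivative_estimates F G y0 C D1 k0 HN HP HC HD1) as [D2 [HD2 Hder]].
  destruct (smooth_lipschitz_on F 0 1 HF) as [K [HK0 HK]].
  destruct (quotient01_bounded F HF) as [B [HB0 HB]].
  assert (HKD : 0 <= K * D1) by nra. assert (HBD : 0 <= B * D1) by nra.
  set (D3 := C * (B * D1) + (C + 1) * (K * D1)).
  assert (HD3 : 0 <= D3) by (unfold D3; nra).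
  exists (Rmin 1 (Rmin e1 e2)), C, (D1 + D2 + D3).
  split; [now repeat apply Rmin_pos; try lra | ]. split; [easy | ]. split; [lra | ].
  intros eps [Heps1 Heps2].
  assert (M1 := Rmin_l 1 (Rmin e1 e2)). assert (M2 := Rmin_r 1 (Rmin e1 e2)).
  assert (M3 := Rmin_l e1 e2). assert (M4 := Rmin_r e1 e2).
  destruct (Hex eps ltac:(lra)) as [sg [z Hsf]].
  destruct (reparametrization_exists (fun t => z (y0 t))) as [tau [Ht0 Htau]].
  { intros t. apply (continuous_comp y0 z).
    - apply is_derive_continuous with (F (y0 t)). apply HP.
    - apply lipschitz_continuous with (C * eps). apply (sf_lip Hsf). }
  { intros t. apply (sf_range Hsf). }
  set (y := fun x => y0 (tau x)).
  assert (Hpp : perturbed_profile F G y0 C eps sg z y).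
  { split; [easy | ]. exists tau. now split. }
  exists sg, z, y. split; [easy | ].
  destruct (perturbed_profile_derive F G y0 C eps sg z y HN HP Hpp) as [Hr [_ [Hd Hw]]].
  assert (He := Hest eps sg z y ltac:(lra) Hpp).
  assert (Hwle : forall x, weight (- ar) (- al) x <= 1).
  { intros x. replace 1 with (weight 0 0 x).
    - apply weight_le; lra.
    - unfold weight. rewrite !Rmult_0_l, Rplus_0_l. apply exp_0. }
  assert (HDe1 : 0 <= D1 * eps) by nra.
  assert (HDe : D1 * eps <= (D1 + D2 + D3) * eps) by (apply Rmult_le_compat_r; lra).
  split.
  - intros x. destruct (He x) as [H1 _]. eapply Rle_trans; [apply H1 | ].
    apply Rmult_le_compat_r; [left; apply weight_pos | easy].
  - intros x. destruct (He x) as [H1 [[_ [H2 _]] _]].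
    rewrite (is_derive_unique _ _ _ (Hd x)), (is_derive_unique _ _ _ (proj1 HP x)).
    specialize (Hr x). specialize (Hr0 x).
    assert (HFd : Rabs (F (y x) - F (y0 x)) <= K * D1 * eps * weight (- ar) (- al) x).
    { eapply Rle_trans; [apply HK; lra | ]. rewrite !Rmult_assoc in *.
      apply Rmult_le_compat_l; easy. }
    assert (Hw0 := weight_pos (- ar) (- al) x).
    set (om := weight (- ar) (- al) x) in *.
    assert (HF0 : Rabs (F (y0 x)) <= B * D1 * om).
    { rewrite (quotient01_correct F (y0 x)) by (apply HN || lra).
      rewrite Rabs_mult, Rmult_comm, Rmult_assoc.
      apply Rmult_le_compat; auto using Rabs_pos.
      set (E0 := weight (- Derive F 0) (Derive F 1) x) in *.
      assert (HE0 : 0 < E0) by apply weight_pos.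
      assert (Hinv := weight_opp (- Derive F 0) (Derive F 1) x). fold E0 in Hinv.
      assert (Hmon := weight_le (- - Derive F 0) (- Derive F 1) (- ar) (- al) x
        ltac:(lra) ltac:(lra)). fold om in Hmon.
      set (I0 := weight (- - Derive F 0) (- Derive F 1) x) in *.
      assert (HI0 : 0 < I0) by apply weight_pos.
      rewrite Rabs_mult, (Rabs_right E0) in H2 by lra.
      set (h := Rabs (y0 x * (1 - y0 x))) in *.
      replace h with (E0 * h * I0) by (transitivity (h * (E0 * I0)); [ring | rewrite Hinv; ring]).
      assert (0 <= h) by apply Rabs_pos.
      apply Rmult_le_compat; try lra. apply Rmult_le_pos; lra. }
    replace (F (y x) * z (y x) - F (y0 x))
      with ((F (y x) - F (y0 x)) + ((F (y x) - F (y0 x)) * (z (y x) - 1)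
              + F (y0 x) * (z (y x) - 1))) by ring.
    assert (Hz := sf_close Hsf (y x)).
    assert (HCe : 0 <= C * eps) by nra.
    assert (HCe' : C * eps <= C) by nra.
    eapply Rle_trans; [apply Rabs_triang | ].
    apply Rle_trans with (K * D1 * eps * om + (K * D1 * eps * om * C + B * D1 * om * (C * eps))).
    + apply Rplus_le_compat; [easy | ]. eapply Rle_trans; [apply Rabs_triang | ].
      rewrite !Rabs_mult.
      apply Rplus_le_compat; apply Rmult_le_compat; auto using Rabs_pos; lra.
    + replace (K * D1 * eps * om + (K * D1 * eps * om * C + B * D1 * om * (C * eps)))
        with (D3 * eps * om) by (unfold D3; ring).
      apply Rmult_le_compat_r; [lra | ]. apply Rmult_le_compat_r; lra.
  - intros x Hx. destruct (He x) as [_ [_ [H3 _]]]. specialize (H3 Hx). lra.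
  - intros x Hx. destruct (He x) as [_ [_ [_ H3]]]. specialize (H3 Hx). lra.
  - intros k x Hk.
    eapply Rle_trans; [apply (Hder eps sg z y); auto; [lra | | ] | apply Rmult_le_compat_r; lra].
    + intros t. destruct (He t) as [H1 _]. eapply Rle_trans; [apply H1 | ].
      specialize (Hwle t). assert (Hp := weight_pos (- ar) (- al) t). nra.
    + intros t. apply He.
Qed.

(** * Uniqueness in normalized variables *)

(** The sign condition under which the rest state 0 is a saddle for [eps > 0]. *)
Definition restoring (G : R -> R) (d : R) : Prop :=
  (forall u, 0 < u <= d -> G u < 0) /\ (forall u, - d <= u < 0 -> 0 < G u).

Lemma restoring_exists (G : R -> R) :
  smooth G -> G 0 = 0 -> Derive G 0 < 0 -> exists d, 0 < d /\ d <= / 4 /\ restoring G d.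
Proof.
  intros HG HG0 HdG.
  assert (H := smooth_is_derive G 0 HG). apply is_derive_Reals in H.
  destruct (H (- Derive G 0) ltac:(lra)) as [d Hd].
  assert (Hdp := cond_pos d).
  set (d' := Rmin (/ 4) (d / 2)).
  assert (M1 := Rmin_l (/ 4) (d / 2)). assert (M2 := Rmin_r (/ 4) (d / 2)). fold d' in M1, M2.
  assert (Hd' : 0 < d') by (unfold d'; apply Rmin_pos; lra).
  exists d'. split; [easy | ]. split; [easy | ].
  assert (Hq : forall u, u <> 0 -> - d' <= u <= d' -> G u / u < 0).
  { intros u Hu0 Hu. specialize (Hd u Hu0).
    rewrite Rplus_0_l, HG0, Rminus_0_r in Hd.
    assert (Hlt : Rabs u < d) by (apply Rabs_lt_between; lra).
    specialize (Hd Hlt). apply Rabs_lt_between in Hd. lra. }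
  split; intros u Hu.
  - specialize (Hq u ltac:(lra) ltac:(lra)).
    replace (G u) with (G u / u * u) by (field; lra). nra.
  - specialize (Hq u ltac:(lra) ltac:(lra)).
    replace (G u) with (G u / u * u) by (field; lra). nra.
Qed.

Lemma wave_continuous (F G : R -> R) (eps sg : R) (y : R -> R) (x : R) :
  wave F G eps sg y -> continuous y x.
Proof.
  intros Hw. apply differentiable_continuous. apply Hw.
Qed.

Lemma wave_damping_continuous (F G : R -> R) (eps sg : R) (y : R -> R) (x : R) :
  smooth F -> wave F G eps sg y -> continuous (fun x => Derive F (y x) - sg) x.
Proof.
  intros HF Hw. apply (continuous_minus (V := R_NormedModule)); [ | apply continuous_const].
  apply (continuous_comp y (Derive F)); [now apply (wave_continuous F G eps sg) | ].
  apply smooth_continuous. now apply smooth_Derive.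
Qed.

(** The equation multiplied by the exponential of minus a primitive of [F'(y) - sg]. *)
Lemma wave_integrating_factor (F G : R -> R) (eps sg : R) (y : R -> R) :
  smooth F -> wave F G eps sg y ->
  exists m : R -> R, (forall x, 0 < m x) /\
    forall x, is_derive (fun x => Derive y x * m x) x (- (eps * G (y x) * m x)).
Proof.
  intros HF Hw.
  destruct (ex_antiderivative (fun x => Derive F (y x) - sg)) as [c Hc].
  { intros x. now apply (wave_damping_continuous F G eps). }
  exists (fun x => exp (- c x)). split; [intros x; apply exp_pos | ].
  intros x. evar_last.
  - apply (is_derive_mult (K := R_AbsRing) (Derive y) (fun x => exp (- c x))).
    + apply Hw.
    + apply (is_derive_comp exp (fun x => - c x)); [apply is_derive_exp | ].
      apply (is_derive_opp (V := R_NormedModule)), Hc.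
    + intros n m. apply Rmult_comm.
  - unfold plus, mult, scal, opp; simpl; unfold mult; simpl. ring.
Qed.

(** The energy [y ^ 2 + y' ^ 2] satisfies a Gronwall inequality, so that a wave touching the
    rest state 0 with zero slope stays there. *)
Lemma wave_energy_zero (F G : R -> R) (eps sg K d a b x0 : R) (y : R -> R) :
  smooth F -> 0 <= eps -> 0 <= K -> wave F G eps sg y ->
  (forall u, Rabs u <= d -> Rabs (G u) <= K * Rabs u) ->
  (forall x, a <= x <= b -> Rabs (y x) <= d) ->
  a <= x0 <= b -> y x0 = 0 -> Derive y x0 = 0 ->
  forall x, a <= x <= b -> y x = 0.
Proof.
  intros HF Heps HK0 Hw HK Hd Hx0 Hy0 Hdy0 x Hx.
  destruct (continuous_bounded (fun x => Derive F (y x) - sg) a b) as [B HB].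
  { intros t. now apply (wave_damping_continuous F G eps). }
  assert (H : y x * y x + Derive y x * Derive y x = 0); [ | nra].
  apply (gronwall_zero (fun t => y t * y t + Derive y t * Derive y t)
    (fun t => 2 * (y t * Derive y t)
       + 2 * (Derive y t * ((Derive F (y t) - sg) * Derive y t - eps * G (y t))))
    (1 + 2 * B + eps * K) a b x0); auto.
  - intros t _. destruct (Hw t) as [H1 H2]. apply Derive_correct in H1.
    evar_last.
    + apply (is_derive_plus (V := R_NormedModule)).
      * apply (is_derive_mult (K := R_AbsRing) y y); [exact H1 | exact H1 | ].
        intros n m. apply Rmult_comm.
      * apply (is_derive_mult (K := R_AbsRing) (Derive y) (Derive y)); [exact H2 | exact H2 | ].
        intros n m. apply Rmult_comm.
    + unfold plus, mult; simpl. ring.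
  - intros t _. cbv beta. nra.
  - intros t Ht. specialize (HB t Ht). cbv beta in HB. specialize (HK (y t) (Hd t Ht)).
    set (u := y t) in *. set (p := Derive y t) in *. set (c := Derive F u - sg) in *.
    replace (2 * (u * p) + 2 * (p * (c * p - eps * G u)))
      with (2 * (u * p) + (2 * (c * (p * p)) - 2 * eps * (p * G u))) by ring.
    assert (Eu : u * u = Rabs u * Rabs u).
    { rewrite <- Rabs_mult. symmetry. apply Rabs_right. nra. }
    assert (Ep : p * p = Rabs p * Rabs p).
    { rewrite <- Rabs_mult. symmetry. apply Rabs_right. nra. }
    assert (Hu := Rabs_pos u). assert (Hp := Rabs_pos p).
    set (au := Rabs u) in *. set (ap := Rabs p) in *.
    assert (T1 : Rabs (2 * (u * p)) <= au * au + ap * ap).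
    { rewrite !Rabs_mult, (Rabs_right 2) by lra. fold au ap.
      assert (0 <= (au - ap) * (au - ap)) by apply Rle_0_sqr. lra. }
    assert (T2 : Rabs (2 * (c * (p * p))) <= 2 * B * (ap * ap)).
    { rewrite !Rabs_mult, (Rabs_right 2) by lra. fold ap.
      assert (0 <= ap * ap) by nra. nra. }
    assert (T3 : Rabs (2 * eps * (p * G u)) <= eps * K * (au * au + ap * ap)).
    { rewrite !Rabs_mult, (Rabs_right 2), (Rabs_right eps) by lra. fold ap.
      apply Rle_trans with (2 * eps * (ap * (K * au))).
      - apply Rmult_le_compat_l; [lra | ]. now apply Rmult_le_compat_l.
      - assert (0 <= eps * K) by now apply Rmult_le_pos.
        assert (0 <= (au - ap) * (au - ap)) by apply Rle_0_sqr. nra. }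
    assert (HB0 : 0 <= B) by (eapply Rle_trans; [apply Rabs_pos | apply HB]).
    eapply Rle_trans; [apply Rabs_triang | ].
    eapply Rle_trans; [apply Rplus_le_compat_l, (Rabs_minus_le _ _ _ _ T2 T3) | ].
    rewrite Eu, Ep. nra.
  - rewrite Hy0, Hdy0. ring.
Qed.

(** A maximum principle. Where [|y| <= d] the source pushes away from 0, so that a wave tending
    to 0 has no negative minimum; being nonnegative, it has a slope that could never become
    negative again after vanishing, which contradicts the decay to 0 unless the wave is 0 from
    there on, and [wave_energy_zero] excludes that. *)
Lemma wave_end_monotone (F G : R -> R) (eps sg d X : R) (y : R -> R) :
  smooth F -> smooth G -> G 0 = 0 -> restoring G d -> 0 < eps -> wave F G eps sg y ->
  (forall x, X <= x -> Rabs (y x) <= d) ->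
  (forall e, 0 < e -> exists M, forall x, M <= x -> Rabs (y x) <= e) ->
  0 < y X -> Derive y X < 0 ->
  forall x, X <= x -> 0 < y x /\ Derive y x < 0.
Proof.
  intros HF HG HG0 [Hneg Hpos] Heps Hw Hd Hlim HyX HdX.
  assert (Hdy : forall x, is_derive y x (Derive y x)) by (intros x; apply Derive_correct, Hw).
  assert (Hc : forall x, continuous y x) by (intros x; now apply (wave_continuous F G eps sg)).
  destruct (wave_integrating_factor F G eps sg y HF Hw) as [m [Hm Hq]].
  set (q := fun x => Derive y x * m x) in *.
  (* at a negative minimum the slope vanishes and, as [G > 0] there, becomes negative to the
     right *)
  assert (Hy0 : forall x, X <= x -> 0 <= y x).
  { intros x2 Hx2. apply Rnot_lt_le. intros Hlt.
    destruct (Hlim (- y x2 / 2) ltac:(lra)) as [M HM].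
    set (Y := Rmax M x2).
    assert (HY1 := Rmax_l M x2). assert (HY2 := Rmax_r M x2). fold Y in HY1, HY2.
    specialize (HM Y HY1). apply Rabs_le_between in HM.
    destruct (continuity_ab_min y X Y) as [p [Hpmin Hp]]; [lra | | ].
    { intros t _. apply continuity_pt_filterlim, Hc. }
    assert (Hpx2 := Hpmin x2 ltac:(lra)).
    assert (HpX : p <> X) by (intros ->; lra).
    assert (HpY : p <> Y) by (intros ->; lra).
    assert (Hdp : Derive y p = 0).
    { rewrite <- (Derive_Reals y p (ex_derive_Reals_0 y p (proj1 (Hw p)))).
      apply (deriv_minimum y X Y); try lra. intros t Ht1 Ht2. apply Hpmin. lra. }
    destruct (Hc p (fun u => u < y p / 2)) as [r Hr].
    { apply (open_lt (y p / 2)). lra. }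
    assert (Hrp := cond_pos r).
    set (h := Rmin (r / 2) (Y - p)).
    assert (Mh1 := Rmin_l (r / 2) (Y - p)). assert (Mh2 := Rmin_r (r / 2) (Y - p)).
    fold h in Mh1, Mh2.
    assert (Hh : 0 < h) by (unfold h; apply Rmin_pos; lra).
    assert (Hyneg : forall t, p <= t <= p + h -> - d <= y t < 0).
    { intros t Ht. assert (H1 := Hd t ltac:(lra)). apply Rabs_le_between in H1.
      assert (H2 : y t < y p / 2).
      { apply Hr. apply Rabs_lt_between. change (- r < t - p < r). lra. }
      lra. }
    assert (Hqneg : forall t, p < t <= p + h -> q t < 0).
    { intros t Ht. assert (Hlt2 : q t < q p).
      { apply (derive_neg_gt q (fun x => - (eps * G (y x) * m x))); [lra | intros; apply Hq | ].
        intros s Hs. specialize (Hpos (y s) (Hyneg s ltac:(lra))). specialize (Hm s).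
        assert (0 < eps * G (y s) * m s)
          by (apply Rmult_lt_0_compat; [now apply Rmult_lt_0_compat | easy]). lra. }
      unfold q at 2 in Hlt2. rewrite Hdp in Hlt2. lra. }
    assert (Hlow : y (p + h) < y (p + h / 2)).
    { apply (derive_neg_gt y (Derive y)); [lra | intros; apply Hdy | ].
      intros s Hs. specialize (Hqneg s ltac:(lra)). unfold q in Hqneg. specialize (Hm s). nra. }
    assert (Hlow2 : y (p + h / 2) <= y p).
    { apply (derive_nonpos_ge y (Derive y)); [lra | intros; apply Hdy | ].
      intros s Hs. destruct (Req_dec s p) as [-> | Hne]; [lra | ].
      specialize (Hqneg s ltac:(lra)). unfold q in Hqneg. specialize (Hm s). nra. }
    assert (Hfin := Hpmin (p + h) ltac:(lra)). lra. }
  assert (Hd0 : 0 <= d) by (eapply Rle_trans; [apply Rabs_pos | apply (Hd X); lra]).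
  assert (HGle : forall x, X <= x -> G (y x) <= 0).
  { intros x Hx. specialize (Hy0 x Hx). specialize (Hd x Hx). apply Rabs_le_between in Hd.
    destruct (Req_dec (y x) 0) as [-> | Hne]; [lra | ].
    left. apply Hneg. lra. }
  assert (Hdneg : forall x, X <= x -> Derive y x < 0).
  { intros x1 Hx1. apply Rnot_le_lt. intros Hge.
    assert (Hqpos : forall x, x1 <= x -> 0 <= Derive y x).
    { intros x Hx.
      assert (H : q x1 <= q x).
      { apply (derive_nonneg_le q (fun x => - (eps * G (y x) * m x))); [easy | intros; apply Hq | ].
        intros t Ht. specialize (HGle t ltac:(lra)). specialize (Hm t).
        assert (0 <= eps * - G (y t) * m t)
          by (apply Rmult_le_pos; [apply Rmult_le_pos; lra | lra]). lra. }
      unfold q in H. assert (H1 := Hm x1). assert (H2 := Hm x).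
      apply Rnot_lt_le. intros Hlt. nra. }
    assert (Hzero : forall x, x1 <= x -> y x = 0).
    { intros x Hx. specialize (Hy0 x ltac:(lra)).
      destruct (Req_dec (y x) 0) as [ | Hne]; [easy | ].
      destruct (Hlim (y x / 2) ltac:(lra)) as [M HM].
      assert (HY1 := Rmax_l M x). assert (HY2 := Rmax_r M x). set (Y := Rmax M x) in *.
      specialize (HM Y HY1). apply Rabs_le_between in HM.
      assert (y x <= y Y); [ | lra].
      apply (derive_nonneg_le y (Derive y)); [easy | intros; apply Hdy | ].
      intros t Ht. apply Hqpos. lra. }
    assert (Hdzero : Derive y (x1 + 1) = 0).
    { rewrite (Derive_ext_loc y (fun _ => 0)); [apply Derive_const | ].
      exists (mkposreal 1 Rlt_0_1). intros t Ht. apply Hzero.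
      change (Rabs (t - (x1 + 1)) < 1) in Ht. apply Rabs_lt_between in Ht. lra. }
    destruct (smooth_lipschitz_on G (- d) d HG) as [K [HK0 HK]].
    assert (H := wave_energy_zero F G eps sg K d X (x1 + 1) (x1 + 1) y HF ltac:(lra) HK0 Hw).
    enough (y X = 0) by lra.
    apply H; auto; try lra.
    - intros u Hu. apply Rabs_le_between in Hu.
      specialize (HK u 0 Hu ltac:(lra)). now rewrite HG0, !Rminus_0_r in HK.
    - intros t Ht. apply Hd. lra.
    - apply Hzero. lra. }
  intros x Hx. split; [ | now apply Hdneg].
  assert (H : y (x + 1) < y x).
  { apply (derive_neg_gt y (Derive y)); [lra | intros; apply Hdy | ].
    intros s Hs. apply Hdneg. lra. }
  specialize (Hy0 (x + 1) ltac:(lra)). lra.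
Qed.

Lemma wave_reflect (F G : R -> R) (eps sg : R) (y : R -> R) :
  smooth F -> wave F G eps sg y ->
  (forall x, Derive (fun x => 1 - y (- x)) x = Derive y (- x)) /\
  wave (fun v => F (1 - v)) (fun v => - G (1 - v)) eps (- sg) (fun x => 1 - y (- x)).
Proof.
  intros HF Hw.
  assert (Hd : forall x, is_derive (fun x => 1 - y (- x)) x (Derive y (- x))).
  { intros x. apply is_derive_reflect, Derive_correct, Hw. }
  assert (HD : forall x, Derive (fun x => 1 - y (- x)) x = Derive y (- x)).
  { intros x. apply is_derive_unique, Hd. }
  split; [exact HD | ]. intros x. split; [eexists; apply Hd | ].
  apply (is_derive_ext (fun x => Derive y (- x))); [intros t; symmetry; apply HD | ].
  evar_last.
  - apply (is_derive_comp (Derive y) Ropp); [apply Hw | ].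
    auto_derive; [easy | reflexivity].
  - unfold scal; simpl; unfold mult; simpl. rewrite HD, Derive_reflect by easy.
    replace (1 - (1 - y (- x))) with (y (- x)) by ring. ring.
Qed.

Lemma vanishes_plus (h1 h2 : R -> R) :
  vanishes_at_infinity h1 -> vanishes_at_infinity h2 ->
  vanishes_at_infinity (fun x => h1 x + h2 x).
Proof.
  intros H1 H2 e He.
  destruct (H1 (e / 2) ltac:(lra)) as [M1 HM1]. destruct (H2 (e / 2) ltac:(lra)) as [M2 HM2].
  exists (Rmax M1 M2). intros x Hx.
  assert (L1 := Rmax_l M1 M2). assert (L2 := Rmax_r M1 M2).
  specialize (HM1 x ltac:(lra)). specialize (HM2 x ltac:(lra)).
  eapply Rle_trans; [apply Rabs_triang | lra].
Qed.

Lemma vanishes_le (h1 h2 : R -> R) (K : R) :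
  0 <= K -> (forall x, Rabs (h1 x) <= K * Rabs (h2 x)) ->
  vanishes_at_infinity h2 -> vanishes_at_infinity h1.
Proof.
  intros HK Hle H2 e He.
  destruct (H2 (e / (K + 1))) as [M HM]; [apply Rdiv_lt_0_compat; lra | ].
  exists M. intros x Hx. eapply Rle_trans; [apply Hle | ].
  apply Rle_trans with (K * (e / (K + 1))).
  - apply Rmult_le_compat_l; auto.
  - apply Rmult_le_reg_r with (K + 1); [lra | ].
    replace (K * (e / (K + 1)) * (K + 1)) with (K * e) by (field; lra). nra.
Qed.

Lemma inviscid_profile_tail (F G y0 : R -> R) (e : R) :
  normalized_shock F G -> inviscid_profile F y0 -> 0 < e ->
  exists X, 0 < X /\ forall x, X <= x -> y0 x <= e.
Proof.
  intros HN HP He. destruct (inviscid_profile_decay F G y0 HN HP) as [c [Hc Hd]].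
  assert (HX : 0 < / (c * e)) by (apply Rinv_0_lt_compat; nra).
  exists (/ (c * e)). split; [easy | ]. intros x Hx.
  eapply Rle_trans; [apply Hd; lra | ].
  assert (H := linear_exp_le c x Hc ltac:(lra)).
  assert (Hp := exp_pos (- c * x)).
  apply Rmult_le_reg_l with (/ (c * e)); [easy | ].
  replace (/ (c * e) * e) with (/ c) by (field; lra).
  eapply Rle_trans; [ | apply H]. apply Rmult_le_compat_r; lra.
Qed.

Lemma inviscid_profile_tails (F G y0 : R -> R) (e : R) :
  normalized_shock F G -> inviscid_profile F y0 -> 0 < e ->
  exists X, 0 < X /\ (forall x, X <= x -> y0 x <= e) /\ (forall x, x <= - X -> 1 - y0 x <= e).
Proof.
  intros HN HP He.
  destruct (inviscid_profile_tail F G y0 e HN HP He) as [X1 [HX1 H1]].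
  destruct (inviscid_profile_tail _ _ _ e (normalized_shock_reflect F G HN)
    (inviscid_profile_reflect F y0 HP) He) as [X2 [HX2 H2]].
  exists (Rmax X1 X2). assert (L1 := Rmax_l X1 X2). assert (L2 := Rmax_r X1 X2).
  split; [lra | ]. split.
  - intros x Hx. apply H1. lra.
  - intros x Hx. specialize (H2 (- x) ltac:(lra)). now rewrite Ropp_involutive in H2.
Qed.

Lemma inviscid_slope_vanishes (F G y0 : R -> R) :
  normalized_shock F G -> inviscid_profile F y0 ->
  vanishes_at_infinity (fun x => F (y0 x)).
Proof.
  intros HN HP.
  assert (Hr := inviscid_profile_range F G y0 HN HP).
  destruct (quotient01_bounded F (ns_F HN)) as [B [HB0 HB]].
  apply (vanishes_le _ (fun x => y0 x * (1 - y0 x)) B HB0).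
  - intros x. specialize (Hr x).
    rewrite (quotient01_correct F (y0 x)) by (apply HN || lra).
    rewrite Rabs_mult, Rmult_comm. apply Rmult_le_compat_r; auto using Rabs_pos.
  - intros e He. destruct (inviscid_profile_tails F G y0 e HN HP He) as [X [HX [H1 H2]]].
    exists X. intros x Hx. specialize (Hr x). rewrite Rabs_right by nra.
    destruct (Rle_dec 0 x) as [H | H].
    + rewrite Rabs_right in Hx by lra. specialize (H1 x Hx). nra.
    + rewrite Rabs_left in Hx by lra. specialize (H2 x ltac:(lra)). nra.
Qed.

(** On a compact interval [y0] has a slope bounded away from 0, so that a function close to it
    in C^1 decreases there; beyond, the wave is close to an end state and the maximum principle
    applies. *)
Lemma near_wave_monotone (F G y0 : R -> R) :
  normalized_shock F G -> inviscid_profile F y0 ->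
  exists d X eta, 0 < d <= / 4 /\ restoring G d /\ restoring (fun v => - G (1 - v)) d /\
  0 < X /\ 0 < eta /\
  forall eps sg u, 0 < eps -> wave F G eps sg u ->
  (forall x, Rabs (u x - y0 x) <= eta) ->
  (forall x, Rabs (Derive u x - Derive y0 x) <= eta) ->
  vanishes_at_infinity (fun x => u x - y0 x) ->
  (forall x, 0 < u x < 1 /\ Derive u x < 0) /\
  (forall x, X <= x -> u x <= d) /\ (forall x, x <= - X -> 1 - u x <= d).
Proof.
  intros HN HP.
  assert (HN' := normalized_shock_reflect F G HN).
  assert (HP' := inviscid_profile_reflect F y0 HP).
  assert (Hr := inviscid_profile_range F G y0 HN HP).
  assert (HF := ns_F HN). assert (HG := ns_G HN).
  destruct (restoring_exists G HG (ns_G0 HN) (ns_dG0 HN)) as [d1 [Hd1 [Hd1' Hre1]]].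
  destruct (restoring_exists _ (ns_G HN') (ns_G0 HN') (ns_dG0 HN'))
    as [d2 [Hd2 [Hd2' Hre2]]].
  set (d := Rmin d1 d2). assert (L1 := Rmin_l d1 d2). assert (L2 := Rmin_r d1 d2).
  fold d in L1, L2. assert (Hd : 0 < d) by (unfold d; now apply Rmin_pos).
  assert (Hres : forall g d', d <= d' -> restoring g d' -> restoring g d).
  { intros g d' Hle [A B]. split; intros v Hv; [apply A | apply B]; lra. }
  specialize (Hres G d1 L1 Hre1) as HreG.
  specialize (Hres _ d2 L2 Hre2) as HreG'.
  destruct (inviscid_profile_tails F G y0 (d / 2) HN HP ltac:(lra)) as [X [HX [HX1 HX2]]].
  destruct (continuity_ab_maj (fun x => F (y0 x)) (- X) X) as [p [Hp _]]; [lra | | ].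
  { intros t _. apply continuity_pt_filterlim.
    apply (continuous_comp y0 F); [ | now apply smooth_continuous].
    apply is_derive_continuous with (F (y0 t)). apply HP. }
  assert (Hpneg := ns_neg HN _ (Hr p)). set (mm := - F (y0 p)) in *.
  assert (HrX := Hr X). assert (HrX' := Hr (- X)).
  set (eta := Rmin (Rmin (d / 2) (mm / 2)) (Rmin (y0 X / 2) ((1 - y0 (- X)) / 2))).
  assert (E1 := Rmin_l (Rmin (d / 2) (mm / 2)) (Rmin (y0 X / 2) ((1 - y0 (- X)) / 2))).
  assert (E2 := Rmin_r (Rmin (d / 2) (mm / 2)) (Rmin (y0 X / 2) ((1 - y0 (- X)) / 2))).
  assert (E3 := Rmin_l (d / 2) (mm / 2)). assert (E4 := Rmin_r (d / 2) (mm / 2)).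
  assert (E5 := Rmin_l (y0 X / 2) ((1 - y0 (- X)) / 2)).
  assert (E6 := Rmin_r (y0 X / 2) ((1 - y0 (- X)) / 2)).
  assert (Hmm : 0 < mm) by (unfold mm; lra).
  assert (Heta : 0 < eta) by (unfold eta; repeat apply Rmin_pos; lra).
  fold eta in E1, E2.
  exists d, X, eta. split; [lra | ]. split; [easy | ]. split; [easy | ].
  split; [easy | ]. split; [easy | ].
  intros eps sg u Heps Hw Hu Hdu Hv.
  assert (HDy0 : forall x, Derive y0 x = F (y0 x)).
  { intros x. apply is_derive_unique, HP. }
  assert (Hmid : forall x, - X <= x <= X -> Derive u x < 0).
  { intros x Hx. specialize (Hdu x). rewrite HDy0 in Hdu. apply Rabs_le_between in Hdu.
    specialize (Hp x Hx). unfold mm in *. lra. }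
  assert (Hright : forall x, X <= x -> Rabs (u x) <= d).
  { intros x Hx. specialize (Hu x). specialize (HX1 x Hx). specialize (Hr x).
    apply Rabs_le_between in Hu. apply Rabs_le. lra. }
  assert (Hleft : forall x, x <= - X -> Rabs (1 - u x) <= d).
  { intros x Hx. specialize (Hu x). specialize (HX2 x Hx). specialize (Hr x).
    apply Rabs_le_between in Hu. apply Rabs_le. lra. }
  assert (Hlim : forall e, 0 < e -> exists M, forall x, M <= x ->
            Rabs (u x) <= e /\ Rabs (1 - u (- x)) <= e).
  { intros e He. destruct (Hv (e / 2) ltac:(lra)) as [M HM].
    destruct (inviscid_profile_tails F G y0 (e / 2) HN HP ltac:(lra)) as [Y [HY [HY1 HY2]]].
    assert (K1 := Rmax_l M Y). assert (K2 := Rmax_r M Y).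
    exists (Rmax M Y). intros x Hx.
    assert (V1 := HM x ltac:(rewrite Rabs_right; lra)).
    assert (V2 := HM (- x) ltac:(rewrite Rabs_left; lra)).
    apply Rabs_le_between in V1. apply Rabs_le_between in V2.
    specialize (HY1 x ltac:(lra)). specialize (HY2 (- x) ltac:(lra)).
    assert (R1 := Hr x). assert (R2 := Hr (- x)).
    split; apply Rabs_le; lra. }
  assert (HuX : 0 < u X /\ u (- X) < 1).
  { assert (U1 := Hu X). assert (U2 := Hu (- X)).
    apply Rabs_le_between in U1. apply Rabs_le_between in U2. lra. }
  assert (HR := wave_end_monotone F G eps sg d X u HF HG (ns_G0 HN) HreG Heps Hw Hright).
  assert (HR' : forall x, X <= x -> 0 < u x /\ Derive u x < 0).
  { apply HR; [ | lra | apply Hmid; lra].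
    intros e He. destruct (Hlim e He) as [M HM]. exists M. intros x Hx. now apply HM. }
  destruct (wave_reflect F G eps sg u HF Hw) as [Hrd Hrw].
  assert (HL := wave_end_monotone _ _ eps (- sg) d X _ (ns_F HN') (ns_G HN')
    (ns_G0 HN') HreG' Heps Hrw).
  assert (HL' : forall x, X <= x -> 0 < 1 - u (- x) /\ Derive u (- x) < 0).
  { intros x Hx. rewrite <- Hrd. revert x Hx. apply HL.
    - intros x Hx. apply Hleft. lra.
    - intros e He. destruct (Hlim e He) as [M HM]. exists M. intros x Hx. now apply HM.
    - lra.
    - rewrite Hrd. apply Hmid. lra. }
  assert (Hdneg : forall x, Derive u x < 0).
  { intros x. destruct (Rle_dec X x) as [H1 | H1]; [now apply HR' | ].
    destruct (Rle_dec x (- X)) as [H2 | H2].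
    - rewrite <- (Ropp_involutive x). apply HL'. lra.
    - apply Hmid. lra. }
  assert (Hdec : forall a b, a < b -> u b < u a).
  { intros a b Hab. apply (derive_neg_gt u (Derive u)); [easy | | auto].
    intros t _. apply Derive_correct, Hw. }
  split; [ | split].
  - intros x. split; [ | apply Hdneg]. split.
    + destruct (Rle_dec X x) as [H1 | H1]; [now apply HR' | ].
      assert (H2 := Hdec x X ltac:(lra)). lra.
    + destruct (Rle_dec x (- X)) as [H1 | H1].
      * assert (H2 := HL' (- x) ltac:(lra)). rewrite Ropp_involutive in H2. lra.
      * assert (H2 := Hdec (- X) x ltac:(lra)). lra.
  - intros x Hx. specialize (Hright x Hx). apply Rabs_le_between in Hright. lra.
  - intros x Hx. specialize (Hleft x Hx). apply Rabs_le_between in Hleft. lra.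
Qed.

(** The defect [u' - F u * z u] satisfies [defect' = (sg - sg') u' + eps k(u) * defect], where
    [k = G / (F z)] is positive near the height 0 and negative near the height 1. With the
    integrating factor the defect therefore still tends to 0 at both ends, while it is monotone
    because [u'] has a constant sign: it vanishes, which forces [sg = sg'], and [u] and [y]
    solve the same first order equation. *)
Lemma normalized_uniqueness (F G y0 : R -> R) :
  normalized_shock F G -> inviscid_profile F y0 ->
  exists eta, 0 < eta /\
  forall C eps sg z y sg' u, 0 <= C -> 0 < eps ->
  perturbed_profile F G y0 C eps sg z y -> wave F G eps sg' u -> u 0 = / 2 ->
  (forall x, Rabs (u x - y0 x) <= eta) ->
  (forall x, Rabs (Derive u x - Derive y0 x) <= eta) ->
  vanishes_at_infinity (fun x => u x - y0 x) ->
  vanishes_at_infinity (fun x => Derive u x - Derive y0 x) ->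
  sg' = sg /\ forall x, u x = y x.
Proof.
  intros HN HP.
  assert (HF := ns_F HN). assert (HG := ns_G HN).
  destruct (near_wave_monotone F G y0 HN HP)
    as [d [X [eta [Hd [[HreN _] [[HreP _] [HX [Heta Hmon]]]]]]]].
  destruct (quotient01_negative F G HN) as [c [Hc HQ]].
  destruct (quotient01_lipschitz F HF) as [KQ [HKQ LQ]].
  destruct (quotient01_lipschitz G HG) as [KP [HKP LP]].
  destruct (smooth_lipschitz_on F 0 1 HF) as [K [HK0 HK]].
  exists eta. split; [easy | ].
  intros C eps sg z y sg' u HC Heps Hpp Hw Hu0 Hclose Hdclose Hv Hdv.
  destruct (Hmon eps sg' u Heps Hw Hclose Hdclose Hv) as [Hu [Hend1 Hend2]].
  destruct (perturbed_profile_derive F G y0 C eps sg z y HN HP Hpp) as [Hyr [Hy0 [Hyd _]]].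
  assert (Hsf := pp_slope Hpp).
  assert (Hz := sf_range Hsf). assert (Lz := sf_lip Hsf).
  assert (HCe : 0 <= C * eps) by nra.
  assert (Hr := inviscid_profile_range F G y0 HN HP).
  assert (Hdu : forall x, is_derive u x (Derive u x)) by (intros x; apply Derive_correct, Hw).
  set (W := fun v => F v * z v).
  set (k := fun v => quotient01 G v / quotient01 F v / z v).
  assert (EF : forall v, 0 < v < 1 -> F v = v * (1 - v) * quotient01 F v).
  { intros v Hv'. apply quotient01_correct; apply HN || lra. }
  assert (EG : forall v, 0 < v < 1 -> G v = v * (1 - v) * quotient01 G v).
  { intros v Hv'. apply quotient01_correct; apply HN || lra. }
  assert (EkW : forall v, 0 < v < 1 -> k v * W v = G v).
  { intros v Hv'. unfold k, W. rewrite (EF v), (EG v) by easy.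
    specialize (HQ v). specialize (Hz v). field. lra. }
  assert (Hksign1 : forall v, 0 < v <= d -> 0 <= k v).
  { intros v Hv'. assert (H := HreN v Hv'). rewrite (EG v) in H by lra.
    specialize (HQ v). specialize (Hz v).
    assert (HP' : quotient01 G v < 0) by (assert (0 < v * (1 - v)) by nra; nra).
    unfold k. replace (quotient01 G v / quotient01 F v / z v)
      with (- quotient01 G v * / (- quotient01 F v) * / z v) by (field; lra).
    assert (0 < / z v) by (apply Rinv_0_lt_compat; lra).
    assert (0 < / - quotient01 F v) by (apply Rinv_0_lt_compat; lra).
    apply Rmult_le_pos; [apply Rmult_le_pos | ]; lra. }
  assert (Hksign2 : forall v, 0 < 1 - v <= d -> k v <= 0).
  { intros v Hv'. assert (H := HreP (1 - v) Hv').
    replace (1 - (1 - v)) with v in H by ring. rewrite (EG v) in H by lra.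
    specialize (HQ v). specialize (Hz v).
    assert (HP' : 0 < quotient01 G v) by (assert (0 < v * (1 - v)) by nra; nra).
    unfold k. replace (quotient01 G v / quotient01 F v / z v)
      with (- (quotient01 G v * / (- quotient01 F v) * / z v)) by (field; lra).
    assert (0 < / z v) by (apply Rinv_0_lt_compat; lra).
    assert (0 < / - quotient01 F v) by (apply Rinv_0_lt_compat; lra).
    assert (0 <= quotient01 G v * / (- quotient01 F v) * / z v)
      by (apply Rmult_le_pos; [apply Rmult_le_pos | ]; lra). lra. }
  assert (Hkc : forall v, continuous k v).
  { intros v. unfold k, Rdiv.
    assert (Hz0 : z v <> 0) by (specialize (Hz v); lra).
    assert (HQ0 : quotient01 F v <> 0) by (specialize (HQ v); lra).
    apply (continuous_mult (K := R_AbsRing)); [apply (continuous_mult (K := R_AbsRing)) | ].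
    - now apply lipschitz_continuous with KP.
    - apply (continuous_comp (quotient01 F) Rinv); [now apply lipschitz_continuous with KQ | ].
      apply differentiable_continuous. auto_derive. easy.
    - apply (continuous_comp z Rinv); [now apply lipschitz_continuous with (C * eps) | ].
      apply differentiable_continuous. auto_derive. easy. }
  destruct (ex_antiderivative (fun x => eps * k (u x))) as [B HB].
  { intros x. apply (continuous_mult (K := R_AbsRing)); [apply continuous_const | ].
    apply (continuous_comp u k); [now apply (wave_continuous F G eps sg') | apply Hkc]. }
  set (defect := fun x => Derive u x - W (u x)).
  set (phi := fun x => defect x * exp (- B x)).
  assert (Hphi : forall x, is_derive phi x ((sg - sg') * Derive u x * exp (- B x))).
  { intros x. specialize (Hu x). evar_last.
    - apply (is_derive_mult (K := R_AbsRing) defect (fun x => exp (- B x))).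
      + apply (is_derive_minus (V := R_NormedModule)); [apply Hw | ].
        apply (is_derive_comp W u); [ | apply Hdu].
        apply (sf_ode Hsf). easy.
      + apply (is_derive_comp exp (fun x => - B x)); [apply is_derive_exp | ].
        apply (is_derive_opp (V := R_NormedModule)), HB.
      + intros n m. apply Rmult_comm.
    - unfold plus, minus, mult, scal, opp, plus; simpl; unfold mult; simpl.
      fold (k (u x)). rewrite <- (EkW (u x)) by easy. unfold defect. ring. }
  assert (Hbound : exists E, 0 <= E /\ forall x, X <= Rabs x -> exp (- B x) <= E).
  { exists (exp (- B X) + exp (- B (- X))).
    assert (P1 := exp_pos (- B X)). assert (P2 := exp_pos (- B (- X))).
    split; [lra | ]. intros x Hx. destruct (Rle_dec 0 x) as [H | H].
    - rewrite Rabs_right in Hx by lra.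
      assert (HBX : B X <= B x).
      { apply (derive_nonneg_le B (fun x => eps * k (u x))); [easy | intros; apply HB | ].
        intros t Ht. apply Rmult_le_pos; [lra | ]. apply Hksign1.
        specialize (Hend1 t ltac:(lra)). specialize (Hu t). lra. }
      assert (exp (- B x) <= exp (- B X)) by (apply exp_le; lra). lra.
    - rewrite Rabs_left in Hx by lra.
      assert (HBX : B (- X) <= B x).
      { apply (derive_nonpos_ge B (fun x => eps * k (u x))); [lra | intros; apply HB | ].
        intros t Ht. specialize (Hend2 t ltac:(lra)). specialize (Hu t).
        specialize (Hksign2 (u t) ltac:(lra)). nra. }
      assert (exp (- B x) <= exp (- B (- X))) by (apply exp_le; lra). lra. }
  assert (HFv := inviscid_slope_vanishes F G y0 HN HP).
  assert (Hdef : vanishes_at_infinity defect).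
  { assert (HFu : vanishes_at_infinity (fun x => W (u x))).
    { apply (vanishes_le _ (fun x => F (u x)) (3 / 2)); [lra | | ].
      - intros x. unfold W. rewrite Rabs_mult, (Rabs_right (z (u x))) by (specialize (Hz (u x)); lra).
        assert (H := Rabs_pos (F (u x))). specialize (Hz (u x)). nra.
      - intros e He.
        assert (H := vanishes_plus (fun x => F (u x) - F (y0 x)) (fun x => F (y0 x))).
        destruct (H) with (e := e) as [M HM]; [ | easy | easy | ].
        + apply (vanishes_le _ (fun x => u x - y0 x) K HK0); [ | easy].
          intros x. specialize (Hu x). specialize (Hr x). apply HK; lra.
        + exists M. intros x Hx. specialize (HM x Hx).
          now replace (F (u x) - F (y0 x) + F (y0 x)) with (F (u x)) in HM by ring. }
    assert (HDu : vanishes_at_infinity (Derive u)).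
    { intros e He.
      destruct (vanishes_plus _ _ Hdv HFv e He) as [M HM].
      exists M. intros x Hx. specialize (HM x Hx). cbv beta in HM.
      rewrite (is_derive_unique _ _ _ (proj1 HP x)) in HM.
      now replace (Derive u x - F (y0 x) + F (y0 x)) with (Derive u x) in HM by ring. }
    apply vanishes_plus; [easy | ].
    apply (vanishes_le _ (fun x => W (u x)) 1); [lra | | easy].
    intros x. rewrite Rabs_Ropp. lra. }
  assert (Hphiv : vanishes_at_infinity phi).
  { destruct Hbound as [E [HE0 HE]]. intros e He.
    destruct (Hdef (e / (E + 1))) as [M HM]; [apply Rdiv_lt_0_compat; lra | ].
    exists (Rmax M X). intros x Hx.
    assert (K1 := Rmax_l M X). assert (K2 := Rmax_r M X).
    specialize (HM x ltac:(lra)). specialize (HE x ltac:(lra)).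
    assert (Hp := exp_pos (- B x)). unfold phi.
    rewrite Rabs_mult, (Rabs_right (exp (- B x))) by lra.
    apply Rle_trans with (e / (E + 1) * (E + 1)); [ | right; field; lra].
    apply Rmult_le_compat; auto using Rabs_pos; lra. }
  assert (Hphi0 : forall x, phi x = 0).
  { destruct (Rle_dec sg sg') as [Hs | Hs].
    - apply (increasing_vanishing_zero phi _ Hphi); [ | easy].
      intros x. assert (Hp := exp_pos (- B x)). specialize (Hu x).
      apply Rmult_le_pos; [nra | lra].
    - intros x. enough (H : - phi x = 0) by lra.
      apply (increasing_vanishing_zero (fun x => - phi x)
        (fun x => - ((sg - sg') * Derive u x * exp (- B x)))).
      + intros t. apply (is_derive_opp (V := R_NormedModule)), Hphi.
      + intros t. assert (Hp := exp_pos (- B t)). specialize (Hu t).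
        assert (0 <= (sg - sg') * - Derive u t * exp (- B t))
          by (apply Rmult_le_pos; [nra | lra]). lra.
      + apply (vanishes_le _ phi 1); [lra | | easy]. intros t. rewrite Rabs_Ropp. lra. }
  split.
  - assert (H : (sg - sg') * Derive u 0 * exp (- B 0) = 0).
    { rewrite <- (is_derive_unique _ _ _ (Hphi 0)).
      rewrite (Derive_ext phi (fun _ => 0)) by exact Hphi0. apply Derive_const. }
    assert (Hp := exp_pos (- B 0)). specialize (Hu 0).
    apply Rmult_integral in H. destruct H as [H | H]; [ | lra].
    apply Rmult_integral in H. lra.
  - assert (Hdu' : forall x, is_derive u x (W (u x))).
    { intros x. replace (W (u x)) with (Derive u x); [apply Hdu | ].
      specialize (Hphi0 x). unfold phi, defect in Hphi0.
      assert (Hp := exp_pos (- B x)). apply Rmult_integral in Hphi0. lra. }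
    destruct (continuous_bounded F 0 1) as [BF HBF]; [intros; now apply smooth_continuous | ].
    intros x.
    assert (M1 := Rmin_l 0 x). assert (M2 := Rmax_l 0 x).
    assert (M3 := Rmin_r 0 x). assert (M4 := Rmax_r 0 x).
    apply (ode_unique_on W u y (K * (3 / 2) + BF * (C * eps)) 0 1 (Rmin 0 x) (Rmax 0 x) 0);
      auto; try lra.
    + intros a b Ha Hb. unfold W.
      replace (F a * z a - F b * z b) with ((F a - F b) * z a + F b * (z a - z b)) by ring.
      eapply Rle_trans; [apply Rabs_triang | ]. rewrite !Rabs_mult.
      specialize (HK a b Ha Hb). specialize (HBF b Hb). specialize (Lz a b).
      assert (Hza := Hz a). rewrite (Rabs_right (z a)) by lra.
      rewrite Rmult_plus_distr_r. apply Rplus_le_compat.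
      * replace (K * (3 / 2) * Rabs (a - b)) with (K * Rabs (a - b) * (3 / 2)) by ring.
        apply Rmult_le_compat; auto using Rabs_pos; lra.
      * rewrite Rmult_assoc. apply Rmult_le_compat; auto using Rabs_pos.
    + intros t _. specialize (Hu t). lra.
    + intros t _. specialize (Hyr t). lra.
Qed.

(** * Return to the original variables *)

Lemma Rbar_plus_nonneg_le (a b : Rbar) (M : R) :
  Rbar_le 0 a -> Rbar_le 0 b -> Rbar_le (Rbar_plus a b) M -> Rbar_le a M /\ Rbar_le b M.
Proof. destruct a, b; simpl; try tauto; intros; lra. Qed.

Lemma Rbar_plus_nonneg (a b : Rbar) :
  Rbar_le 0 a -> Rbar_le 0 b -> Rbar_le 0 (Rbar_plus a b).
Proof. destruct a, b; simpl; try tauto; intros; lra. Qed.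

(** [D] is the half-line on the side of the sign [e], and [om] the weight of rate [a]. *)
Record half_line_weight (D : R -> Prop) (om : R -> R) (a e : R) : Prop := {
  hw_sign : Rabs e = 1;
  hw_inside : forall x, 0 < e * x -> locally x D;
  hw_outside : forall x, D x -> x <> 0 -> 0 < e * x;
  hw_weight : forall x, 0 < e * x -> locally x (fun t => om t = exp (a * (e * t))) }.

Arguments hw_sign {D om a e}.
Arguments hw_inside {D om a e}.
Arguments hw_outside {D om a e}.
Arguments hw_weight {D om a e}.

Lemma half_line_weight_right (a : R) :
  half_line_weight Rplus_half (fun x => exp (a * x)) a 1.
Proof.
  split.
  - apply Rabs_R1.
  - intros x Hx. exists (mkposreal x ltac:(lra)). intros t Ht.
    change (Rabs (t - x) < x) in Ht. apply Rabs_lt_between in Ht. unfold Rplus_half. lra.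
  - unfold Rplus_half. intros x Hx Hne. lra.
  - intros x _. apply filter_forall. intros t. f_equal. ring.
Qed.

Lemma half_line_weight_left (a : R) :
  half_line_weight Rminus_half (fun x => exp (a * Rabs x)) a (-1).
Proof.
  assert (Hloc : forall x, 0 < -1 * x -> locally x (fun t => t < 0)).
  { intros x Hx. exists (mkposreal (- x) ltac:(lra)). intros t Ht.
    change (Rabs (t - x) < - x) in Ht. apply Rabs_lt_between in Ht. lra. }
  split.
  - rewrite Rabs_left; lra.
  - intros x Hx. apply (filter_imp (fun t => t < 0)); [ | now apply Hloc].
    unfold Rminus_half. intros t Ht. lra.
  - unfold Rminus_half. intros x Hx Hne. lra.
  - intros x Hx. apply (filter_imp (fun t => t < 0)); [ | now apply Hloc].
    intros t Ht. rewrite Rabs_left by easy. f_equal. ring.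
Qed.

Lemma weighted_derive (D : R -> Prop) (om : R -> R) (a e : R) (h : R -> R) (x : R) :
  half_line_weight D om a e -> (forall x, ex_derive h x) -> 0 < e * x ->
  Derive (fun x => om x * h x) x = exp (a * (e * x)) * (a * e * h x + Derive h x).
Proof.
  intros Hw Hh Hx.
  rewrite (Derive_ext_loc _ (fun t => exp (a * (e * t)) * h t)).
  - apply is_derive_unique. auto_derive; [apply Hh | ].
    change (Derive (fun x => h x) x) with (Derive h x). ring.
  - apply (filter_imp (fun t => om t = exp (a * (e * t)))); [ | now apply (hw_weight Hw)].
    intros t ->. reflexivity.
Qed.

Lemma W1inf_norm_weighted_le (D : R -> Prop) (om : R -> R) (a e : R) (h : R -> R) (M1 M2 : R) :
  half_line_weight D om a e -> (forall x, ex_derive h x) -> 0 <= a -> 0 <= M1 ->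
  (forall x, 0 < e * x -> Rabs (h x) <= M1 * exp (- a * (e * x))) ->
  (forall x, 0 < e * x -> Rabs (Derive h x) <= M2 * exp (- a * (e * x))) ->
  Rbar_le (W1inf_norm D (fun x => om x * h x)) (M1 + (a * M1 + M2)).
Proof.
  intros Hw Hh Ha HM1 H1 H2. unfold W1inf_norm.
  assert (He := hw_sign Hw).
  assert (Hexp : forall x, exp (a * (e * x)) * exp (- a * (e * x)) = 1).
  { intros x. rewrite <- exp_plus, <- exp_0. f_equal. ring. }
  change (Finite (M1 + (a * M1 + M2))) with (Rbar_plus M1 (a * M1 + M2)).
  apply Rbar_plus_le_compat; apply (Linf_norm_le _ _ 0); intros x HD Hx0;
    assert (Hx := hw_outside Hw x HD Hx0);
    assert (Hp := exp_pos (a * (e * x))); specialize (Hexp x);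
    specialize (H1 x Hx); specialize (H2 x Hx).
  - rewrite (locally_singleton _ _ (hw_weight Hw x Hx)).
    rewrite Rabs_mult, (Rabs_right (exp (a * (e * x)))) by lra.
    replace M1 with (exp (a * (e * x)) * (M1 * exp (- a * (e * x)))).
    + apply Rmult_le_compat_l; lra.
    + transitivity (M1 * (exp (a * (e * x)) * exp (- a * (e * x)))); [ring | rewrite Hexp; ring].
  - rewrite (weighted_derive D om a e h x Hw Hh Hx).
    rewrite Rabs_mult, (Rabs_right (exp (a * (e * x)))) by lra.
    replace (a * M1 + M2)
      with (exp (a * (e * x)) * (a * (M1 * exp (- a * (e * x))) + M2 * exp (- a * (e * x)))).
    + apply Rmult_le_compat_l; [lra | ]. eapply Rle_trans; [apply Rabs_triang | ].
      rewrite !Rabs_mult, He, (Rabs_right a), Rmult_1_r by lra.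
      apply Rplus_le_compat; [ | easy]. now apply Rmult_le_compat_l.
    + transitivity ((a * M1 + M2) * (exp (a * (e * x)) * exp (- a * (e * x))));
        [ring | rewrite Hexp; ring].
Qed.

(** Pointwise bounds come back from the essential suprema by continuity; the derivative of [h]
    is recovered from that of the weighted function, at the cost of the factor [1 + a]. *)
Lemma W1inf_norm_weighted_bound (D : R -> Prop) (om : R -> R) (a e : R) (h : R -> R) (M : R) :
  half_line_weight D om a e -> (forall x, ex_derive h x) ->
  (forall x, continuous (Derive h) x) -> 0 <= a ->
  Rbar_le (W1inf_norm D (fun x => om x * h x)) M ->
  forall x, 0 < e * x ->
    Rabs (h x) <= M * exp (- a * (e * x)) /\
    Rabs (Derive h x) <= (1 + a) * M * exp (- a * (e * x)).
Proof.
  intros Hw Hh Hc Ha HM x Hx.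
  assert (He := hw_sign Hw).
  assert (HinD := hw_inside Hw x Hx).
  assert (Hhc : continuous h x) by (apply differentiable_continuous, Hh).
  assert (Hec : continuous (fun t => exp (a * (e * t))) x).
  { apply differentiable_continuous. auto_derive. easy. }
  assert (Hpos : locally x (fun t => 0 < e * t)).
  { assert (Hcont : continuous (fun t => e * t) x).
    { apply differentiable_continuous. auto_derive. easy. }
    apply (Hcont (fun u => 0 < u)). now apply (open_gt _). }
  unfold W1inf_norm in HM.
  destruct (Rbar_plus_nonneg_le _ _ M (Linf_norm_nonneg D _ x HinD)
    (Linf_norm_nonneg D _ x HinD) HM) as [HM1 HM2].
  assert (Hexp : exp (a * (e * x)) * exp (- a * (e * x)) = 1).
  { rewrite <- exp_plus, <- exp_0. f_equal. ring. }
  assert (Hp := exp_pos (a * (e * x))). assert (Hn := exp_pos (- a * (e * x))).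
  assert (B1 : Rabs (exp (a * (e * x)) * h x) <= M).
  { assert (H : Rbar_le (Rabs ((fun t => om t * h t) x)) M).
    { apply Rbar_le_trans with (2 := HM1), (le_Linf_norm D (fun t => om t * h t) x HinD).
      apply (continuous_ext_loc _ (fun t => exp (a * (e * t)) * h t)).
      - apply (filter_imp (fun t => om t = exp (a * (e * t)))); [ | now apply (hw_weight Hw)].
        intros t ->. reflexivity.
      - now apply (continuous_mult (K := R_AbsRing)). }
    simpl in H. now rewrite (locally_singleton _ _ (hw_weight Hw x Hx)) in H. }
  assert (B2 : Rabs (exp (a * (e * x)) * (a * e * h x + Derive h x)) <= M).
  { assert (H : Rbar_le (Rabs (Derive (fun t => om t * h t) x)) M).
    { apply Rbar_le_trans with (2 := HM2),
        (le_Linf_norm D (Derive (fun t => om t * h t)) x HinD).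
      apply (continuous_ext_loc _ (fun t => exp (a * (e * t)) * (a * e * h t + Derive h t))).
      - apply (filter_imp (fun t => 0 < e * t)); [ | easy].
        intros t Ht. symmetry. now apply (weighted_derive D).
      - apply (continuous_mult (K := R_AbsRing)); [easy | ].
        apply (continuous_plus (V := R_NormedModule)); [ | apply Hc].
        apply (continuous_mult (K := R_AbsRing)); [apply continuous_const | easy]. }
    simpl in H. now rewrite (weighted_derive D om a e h x Hw Hh Hx) in H. }
  rewrite Rabs_mult, (Rabs_right (exp (a * (e * x)))) in B1, B2 by lra.
  assert (C1 : Rabs (h x) <= M * exp (- a * (e * x))).
  { replace (Rabs (h x)) with (exp (a * (e * x)) * Rabs (h x) * exp (- a * (e * x))).
    - apply Rmult_le_compat_r; lra.
    - transitivity (Rabs (h x) * (exp (a * (e * x)) * exp (- a * (e * x))));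
        [ring | rewrite Hexp; ring]. }
  split; [easy | ].
  assert (C2 : Rabs (a * e * h x + Derive h x) <= M * exp (- a * (e * x))).
  { set (r := Rabs (a * e * h x + Derive h x)) in *.
    replace r with (exp (a * (e * x)) * r * exp (- a * (e * x))).
    - apply Rmult_le_compat_r; lra.
    - transitivity (r * (exp (a * (e * x)) * exp (- a * (e * x))));
        [ring | rewrite Hexp; ring]. }
  replace (Derive h x) with ((a * e * h x + Derive h x) - a * e * h x) by ring.
  replace ((1 + a) * M * exp (- a * (e * x)))
    with (M * exp (- a * (e * x)) + a * (M * exp (- a * (e * x)))) by ring.
  apply Rabs_minus_le; [easy | ].
  rewrite !Rabs_mult, He, (Rabs_right a), Rmult_1_r by lra. now apply Rmult_le_compat_l.
Qed.

Lemma W1inf_norm_nonneg (D : R -> Prop) (h : R -> R) (x : R) :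
  locally x D -> Rbar_le 0 (W1inf_norm D h).
Proof. intros H. apply Rbar_plus_nonneg; now apply Linf_norm_nonneg with x. Qed.

Lemma continuous_bound_at (h : R -> R) (x0 M : R) :
  continuous h x0 -> (forall x, x <> x0 -> Rabs (h x) <= M) -> Rabs (h x0) <= M.
Proof.
  intros Hc HM. apply Rnot_lt_le. intros Hlt.
  assert (HcA : continuous (fun y => Rabs (h y)) x0).
  { apply (continuous_comp h Rabs); [easy | ]. apply continuous_Rabs. }
  destruct (HcA (fun t => M < t)) as [r Hr]; [now apply (open_gt _) | ].
  assert (Hrp := cond_pos r).
  assert (Hin : M < Rabs (h (x0 + r / 2))).
  { apply Hr. apply Rabs_lt_between. change (- r < x0 + r / 2 - x0 < r). lra. }
  specialize (HM (x0 + r / 2) ltac:(lra)). lra.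
Qed.

Lemma vanishes_exp (h : R -> R) (M a : R) :
  0 <= M -> 0 < a -> (forall x, x <> 0 -> Rabs (h x) <= M * exp (- a * Rabs x)) ->
  vanishes_at_infinity h.
Proof.
  intros HM Ha Hh e He.
  assert (Hq : 0 < M / (a * e) + 1).
  { assert (0 <= M / (a * e)) by (apply Rmult_le_pos; [easy | left; apply Rinv_0_lt_compat; nra]).
    lra. }
  exists (M / (a * e) + 1). intros x Hx.
  assert (Hx0 : x <> 0) by (intros ->; rewrite Rabs_R0 in Hx; lra).
  specialize (Hh x Hx0). assert (Hl := linear_exp_le a (Rabs x) Ha (Rabs_pos x)).
  assert (Hp := exp_pos (- a * Rabs x)).
  eapply Rle_trans; [apply Hh | ].
  apply Rmult_le_reg_l with (Rabs x); [lra | ].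
  apply Rle_trans with (M * / a).
  - replace (Rabs x * (M * exp (- a * Rabs x))) with (M * (Rabs x * exp (- a * Rabs x))) by ring.
    now apply Rmult_le_compat_l.
  - apply Rle_trans with ((M / (a * e)) * e).
    + right. field. lra.
    + apply Rmult_le_compat_r; lra.
Qed.

Lemma smooth_affine (f : R -> R) (p d : R) : smooth f -> smooth (fun v => f (p + d * v)).
Proof.
  intros Hf n x.
  apply (ex_derive_n_comp_scal (fun u => f (p + u)) d n x).
  apply filter_forall. intros t k _.
  apply (ex_derive_n_ext (fun u => f (u + p))).
  - intros u. f_equal. ring.
  - apply ex_derive_n_comp_trans, Hf.
Qed.

Lemma smooth_scal (c : R) (a : R -> R) : smooth a -> smooth (fun v => c * a v).
Proof. intros Ha n x. apply ex_derive_n_scal_l, Ha. Qed.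

Lemma smooth_minus (a b : R -> R) : smooth a -> smooth b -> smooth (fun v => a v - b v).
Proof.
  intros Ha Hb n x. apply ex_derive_n_minus; apply filter_forall; intros t k _; [apply Ha | apply Hb].
Qed.

Lemma smooth_plus (a b : R -> R) : smooth a -> smooth b -> smooth (fun v => a v + b v).
Proof.
  intros Ha Hb n x. apply ex_derive_n_plus; apply filter_forall; intros t k _; [apply Ha | apply Hb].
Qed.

Definition normalized_flux (f : R -> R) (s0 up d : R) (v : R) : R :=
  / d * (f (up + d * v) - f up) - s0 * v.

Definition normalized_source (g : R -> R) (up d : R) (v : R) : R := / d * g (up + d * v).

Lemma Derive_normalized_flux (f : R -> R) (s0 up d v : R) :
  smooth f -> d <> 0 ->
  Derive (normalized_flux f s0 up d) v = Derive f (up + d * v) - s0.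
Proof.
  intros Hf Hd. apply is_derive_unique. unfold normalized_flux.
  assert (H := smooth_is_derive f (up + d * v) Hf).
  auto_derive; [now exists (Derive f (up + d * v)) | ].
  change (Derive (fun x => f x)) with (Derive f). field. exact Hd.
Qed.

Lemma Derive_normalized_source (g : R -> R) (up d v : R) :
  smooth g -> d <> 0 ->
  Derive (normalized_source g up d) v = Derive g (up + d * v).
Proof.
  intros Hf Hd. apply is_derive_unique. unfold normalized_source.
  assert (H := smooth_is_derive g (up + d * v) Hf).
  auto_derive; [now exists (Derive g (up + d * v)) | ].
  change (Derive (fun x => g x)) with (Derive g). field. exact Hd.
Qed.

Lemma class_Cinf_smooth (f : R -> R) : class_Cinf f -> smooth f.
Proof. intros Hf n x. now apply (proj1 (Hf n)). Qed.

(** With [F] the normalized flux, the two slopes in the entropy condition at height [v] are [s0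
    - F v / (1 - v)] and [s0 + F v / v]. *)
Lemma normalized_shock_of_shock (f g : R -> R) (s0 um up : R) :
  class_Cinf f -> class_Cinf g -> strictly_entropic_shock f g s0 um up ->
  Derive g up < 0 -> Derive g um < 0 ->
  normalized_shock (normalized_flux f s0 up (um - up)) (normalized_source g up (um - up)).
Proof.
  intros Hf Hg [Hne [Hgp [Hgm [HRH [Hlm [Hlp Hent]]]]]] Hdp Hdm.
  apply class_Cinf_smooth in Hf. apply class_Cinf_smooth in Hg.
  set (d := um - up). assert (Hd : d <> 0) by (unfold d; lra).
  assert (E0 : up + d * 0 = up) by ring. assert (E1 : up + d * 1 = um) by (unfold d; ring).
  assert (Hid : smooth (fun v => s0 * v)).
  { apply smooth_scal. intros [ | n] x; [easy | ].
    simpl. destruct n as [ | n]; [apply ex_derive_id | ].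
    apply (ex_derive_ext (Derive_n (fun _ => 1) n)).
    - intros t. rewrite <- (Nat.add_1_r n), <- Derive_n_comp. apply Derive_n_ext.
      intros u. symmetry. apply Derive_id.
    - apply (smooth_constant 1 (S n) x). }
  split.
  - apply smooth_minus; [ | exact Hid]. apply smooth_scal. apply smooth_minus.
    + now apply smooth_affine.
    + apply smooth_constant.
  - apply smooth_scal. now apply smooth_affine.
  - unfold normalized_flux. rewrite E0. ring.
  - unfold normalized_flux. rewrite E1.
    replace (f um - f up) with (s0 * d) by (unfold d; lra). field. exact Hd.
  - unfold normalized_source. rewrite E0, Hgp. ring.
  - unfold normalized_source. rewrite E1, Hgm. ring.
  - intros v Hv. specialize (Hent v Hv). cbv zeta in Hent.
    replace (v * um + (1 - v) * up) with (up + d * v) in Hent by (unfold d; ring).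
    set (Fv := normalized_flux f s0 up d v).
    replace ((f (up + d * v) - f um) / (up + d * v - um)) with (s0 - Fv / (1 - v)) in Hent.
    + replace ((f (up + d * v) - f up) / (up + d * v - up)) with (s0 + Fv / v) in Hent.
      * assert (Hsum : Fv / v + Fv / (1 - v) = Fv * / (v * (1 - v))) by (field; lra).
        assert (Hinv : 0 < / (v * (1 - v))) by (apply Rinv_0_lt_compat; nra).
        nra.
      * unfold Fv, normalized_flux. replace (up + d * v - up) with (d * v) by ring.
        field. split; [lra | exact Hd].
    + unfold Fv, normalized_flux.
      replace (f um) with (f up + s0 * d) by (unfold d; lra).
      replace (up + d * v - um) with (d * (v - 1)) by (unfold d; ring).
      field. repeat split; [lra | exact Hd | lra].
  - rewrite Derive_normalized_flux, E0 by easy. lra.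
  - rewrite Derive_normalized_flux, E1 by easy. lra.
  - now rewrite Derive_normalized_source, E0 by easy.
  - now rewrite Derive_normalized_source, E1 by easy.
Qed.

Lemma Derive_n_affine_image (p d : R) (y : R -> R) (n : nat) (x : R) :
  smooth y -> Derive_n (fun x => p + d * y x) (S n) x = d * Derive_n y (S n) x.
Proof.
  intros Hy.
  rewrite (Derive_n_plus (fun _ => p) (fun x => d * y x)).
  - rewrite Derive_n_const, Derive_n_scal_l. apply Rplus_0_l.
  - apply filter_forall. intros t k _. apply smooth_constant.
  - apply filter_forall. intros t k _. now apply smooth_scal.
Qed.

Lemma smooth_class_C (h : R -> R) (n : nat) : smooth h -> class_C n h.
Proof.
  intros Hh. split.
  - intros k x _. apply Hh.
  - intros x. apply differentiable_continuous. apply (Hh (S n) x).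
Qed.

Lemma theta_l_at_0 (f g : R -> R) (um s0 : R) :
  s0 < Derive f um -> theta_l f g um 0 s0 = Derive f um - s0.
Proof.
  intros H. unfold theta_l. rewrite Rmult_0_r, Rmult_0_l, Rplus_0_r.
  rewrite sqrt_pow2 by lra. field.
Qed.

Lemma theta_r_at_0 (f g : R -> R) (up s0 : R) :
  Derive f up < s0 -> theta_r f g up 0 s0 = s0 - Derive f up.
Proof.
  intros H. unfold theta_r. rewrite Rmult_0_r, Rmult_0_l, Rplus_0_r.
  replace ((Derive f up - s0) ^ 2) with ((s0 - Derive f up) ^ 2) by ring.
  rewrite sqrt_pow2, Rabs_left by lra. field.
Qed.

Lemma inviscid_profile_of_profile0 (f : R -> R) (s0 um up : R) (U0 : R -> R) :
  um <> up -> is_profile0 f s0 um up U0 ->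
  inviscid_profile (normalized_flux f s0 up (um - up)) (fun x => / (um - up) * (U0 x - up)).
Proof.
  intros Hne [Hd H0]. set (d := um - up). assert (Hd0 : d <> 0) by (unfold d; lra).
  split.
  - intros x. specialize (Hd x). unfold normalized_flux.
    replace (up + d * (/ d * (U0 x - up))) with (U0 x) by (field; exact Hd0).
    replace (/ d * (f (U0 x) - f up) - s0 * (/ d * (U0 x - up)))
      with (/ d * (f (U0 x) - f up - s0 * (U0 x - up) - 0)) by ring.
    apply is_derive_scal. apply (is_derive_minus (V := R_NormedModule)); [exact Hd | ].
    apply (is_derive_const (K := R_AbsRing) (V := R_NormedModule)).
  - rewrite H0. unfold d. field. lra.
Qed.

Lemma wave_of_travelling (f g : R -> R) (s0 up d eps s : R) (V : R -> R) :
  smooth f -> d <> 0 -> class_C 2 V ->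
  (forall x, Derive (fun y => f (V y) - s * V y) x = Derive_n V 2 x + eps * g (V x)) ->
  wave (normalized_flux f s0 up d) (normalized_source g up d) eps (s - s0)
    (fun x => / d * (V x - up)) /\
  forall x, Derive (fun x => / d * (V x - up)) x = / d * Derive V x.
Proof.
  intros Hf Hd [HC _] Heq.
  assert (H1 : forall x, ex_derive V x) by (intros x; apply (HC 1%nat x); lia).
  assert (H2 : forall x, ex_derive (Derive V) x) by (intros x; apply (HC 2%nat x); lia).
  assert (Hdu : forall x, is_derive (fun x => / d * (V x - up)) x (/ d * Derive V x)).
  { intros x. auto_derive; [apply H1 | ].
    change (Derive (fun x => V x)) with (Derive V). ring. }
  assert (HDu : forall x, Derive (fun x => / d * (V x - up)) x = / d * Derive V x)
    by (intros x; apply is_derive_unique, Hdu).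
  split; [ | exact HDu]. intros x. split; [eexists; apply Hdu | ].
  apply (is_derive_ext (fun t => / d * Derive V t)); [intros t; symmetry; apply HDu | ].
  assert (E : Derive (Derive V) x = (Derive f (V x) - s) * Derive V x - eps * g (V x)).
  { specialize (Heq x). change (Derive_n V 2 x) with (Derive (Derive V) x) in Heq.
    replace (Derive (Derive V) x) with (Derive (fun y => f (V y) - s * V y) x - eps * g (V x))
      by lra.
    f_equal. apply is_derive_unique.
    assert (Hfv := smooth_is_derive f (V x) Hf).
    auto_derive; [repeat split; [now exists (Derive f (V x)) | apply H1 | apply H1] | ].
    change (Derive (fun x => V x)) with (Derive V).
    change (Derive (fun x => f x)) with (Derive f). ring. }
  evar_last; [apply is_derive_scal, Derive_correct, H2 | ].
  rewrite E, HDu, Derive_normalized_flux by easy. unfold normalized_source.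
  replace (up + d * (/ d * (V x - up))) with (V x) by (field; exact Hd). ring.
Qed.

Lemma travelling_of_wave (f g : R -> R) (s0 up d eps sg : R) (y : R -> R) :
  smooth f -> d <> 0 ->
  wave (normalized_flux f s0 up d) (normalized_source g up d) eps sg y -> smooth y ->
  forall x, Derive (fun t => f (up + d * y t) - (s0 + sg) * (up + d * y t)) x
    = Derive_n (fun t => up + d * y t) 2 x + eps * g (up + d * y x).
Proof.
  intros Hf Hd Hw Hy x. rewrite Derive_n_affine_image by easy.
  change (Derive_n y 2 x) with (Derive (Derive y) x).
  destruct (Hw x) as [H1 H2].
  rewrite (is_derive_unique _ _ _ H2), Derive_normalized_flux by easy.
  unfold normalized_source.
  apply is_derive_unique.
  assert (Hfv := smooth_is_derive f (up + d * y x) Hf).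
  auto_derive; [repeat split; [now exists (Derive f (up + d * y x)) | easy | easy] | ].
  change (Derive (fun x => y x)) with (Derive y).
  change (Derive (fun x => f x)) with (Derive f). field. exact Hd.
Qed.

Lemma close_profile_bounds (f g : R -> R) (s0 um up : R) (U0 : R -> R)
    (al ar C0 eps s : R) (V : R -> R) :
  class_C 1 U0 -> U0 0 = (um + up) / 2 -> 0 < al -> 0 < ar ->
  is_close_profile f g s0 um up U0 al ar C0 eps s V ->
  let M := (1 + al + ar) * (C0 * eps) in
  0 <= C0 * eps /\
  (forall x, Rabs (V x - U0 x) <= M /\ Rabs (Derive V x - Derive U0 x) <= M) /\
  (forall x, x <> 0 -> Rabs (V x - U0 x) <= M * exp (- Rmin al ar * Rabs x) /\
     Rabs (Derive V x - Derive U0 x) <= M * exp (- Rmin al ar * Rabs x)).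
Proof.
  intros [CU CU'] HU00 Hal Har [[CV CV'] [HV0 [_ Hnorm]]] M.
  assert (Hl : Rbar_le 0 (W1inf_norm Rminus_half (fun x => exp (al * Rabs x) * (V x - U0 x)))).
  { apply W1inf_norm_nonneg with (-1).
    apply (hw_inside (half_line_weight_left al)). lra. }
  assert (Hr : Rbar_le 0 (W1inf_norm Rplus_half (fun x => exp (ar * x) * (V x - U0 x)))).
  { apply W1inf_norm_nonneg with 1.
    apply (hw_inside (half_line_weight_right ar)). lra. }
  assert (Hs : Rbar_le 0 (Rabs (s - s0))) by (simpl; apply Rabs_pos).
  destruct (Rbar_plus_nonneg_le _ _ _ (Rbar_plus_nonneg _ _ Hs Hl) Hr Hnorm) as [Hn1 Hnr].
  destruct (Rbar_plus_nonneg_le _ _ _ Hs Hl Hn1) as [Hns Hnl].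
  assert (HCe : 0 <= C0 * eps).
  { simpl in Hns. eapply Rle_trans; [apply Rabs_pos | exact Hns]. }
  assert (HV1 : forall x, ex_derive V x) by (intros x; apply (CV 1%nat x); lia).
  assert (HU1 : forall x, ex_derive U0 x) by (intros x; apply (CU 1%nat x); lia).
  set (h := fun x => V x - U0 x) in *.
  assert (Hh : forall x, ex_derive h x).
  { intros x. apply (ex_derive_minus (V := R_NormedModule)); auto. }
  assert (HDh : forall x, Derive h x = Derive V x - Derive U0 x).
  { intros x. apply Derive_minus; auto. }
  assert (Hhc : forall x, continuous (Derive h) x).
  { intros x. apply (continuous_ext (fun t => Derive V t - Derive U0 t)).
    - intros t. symmetry. apply HDh.
    - apply (continuous_minus (V := R_NormedModule)); [ | apply CU'].
      apply differentiable_continuous. apply (CV 2%nat x). lia. }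
  assert (BR := W1inf_norm_weighted_bound _ _ ar 1 h _ (half_line_weight_right ar) Hh Hhc
    ltac:(lra) Hnr).
  assert (BL := W1inf_norm_weighted_bound _ _ al (-1) h _ (half_line_weight_left al) Hh Hhc
    ltac:(lra) Hnl).
  set (b := Rmin al ar).
  assert (M1 := Rmin_l al ar). assert (M2 := Rmin_r al ar). fold b in M1, M2.
  assert (Hb : 0 < b) by (unfold b; now apply Rmin_pos).
  assert (HM1 : C0 * eps <= M) by (unfold M; nra).
  assert (HM2 : (1 + al) * (C0 * eps) <= M) by (unfold M; nra).
  assert (HM3 : (1 + ar) * (C0 * eps) <= M) by (unfold M; nra).
  assert (HM : 0 <= M) by lra.
  assert (Hmain : forall x, x <> 0 -> Rabs (h x) <= M * exp (- b * Rabs x) /\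
     Rabs (Derive h x) <= M * exp (- b * Rabs x)).
  { assert (Hstep : forall a t A r, b <= a -> 0 <= t -> 0 <= A -> A <= M ->
              r <= A * exp (- a * t) -> r <= M * exp (- b * t)).
    { intros a t A r Ha Ht HA HAM Hrr. eapply Rle_trans; [apply Hrr | ].
      apply Rmult_le_compat; [easy | left; apply exp_pos | easy | ].
      apply exp_le. nra. }
    intros x Hx. destruct (Rdichotomy x 0 Hx) as [H | H]; cycle 1.
    - destruct (BR x ltac:(lra)) as [B1 B2]. rewrite Rmult_1_l in B1, B2.
      rewrite (Rabs_right x) by lra. split.
      + apply (Hstep ar x (C0 * eps)); lra.
      + apply (Hstep ar x ((1 + ar) * (C0 * eps))); try lra.
        apply Rmult_le_pos; lra.
    - destruct (BL x ltac:(lra)) as [B1 B2].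
      replace (-1 * x) with (Rabs x) in B1, B2 by (rewrite Rabs_left by lra; ring).
      assert (P := Rabs_pos x). split.
      + apply (Hstep al (Rabs x) (C0 * eps)); lra.
      + apply (Hstep al (Rabs x) ((1 + al) * (C0 * eps))); try lra.
        apply Rmult_le_pos; lra. }
  assert (Hle1 : forall x, M * exp (- b * Rabs x) <= M).
  { intros x. rewrite <- (Rmult_1_r M) at 2. apply Rmult_le_compat_l; [easy | ].
    rewrite <- exp_0. apply exp_le. assert (P := Rabs_pos x). nra. }
  split; [easy | ]. split.
  - intros x. rewrite <- HDh. fold (h x). destruct (Req_dec x 0) as [-> | Hx].
    + split.
      * unfold h. rewrite HV0, HU00, Rminus_diag, Rabs_R0. easy.
      * apply continuous_bound_at; [apply Hhc | ]. intros t Ht.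
        destruct (Hmain t Ht) as [_ B]. specialize (Hle1 t). lra.
    + destruct (Hmain x Hx) as [A B]. specialize (Hle1 x). lra.
  - intros x Hx. rewrite <- HDh. now apply Hmain.
Qed.

Lemma profile_is_close (f g : R -> R) (s0 um up : R) (U0 y0 : R -> R)
    (al ar C D C0 eps sg : R) (y : R -> R) :
  smooth f -> um <> up -> 0 < al -> 0 < ar -> 0 <= D -> 0 <= eps ->
  (forall x, U0 x = up + (um - up) * y0 x) -> smooth y0 ->
  wave (normalized_flux f s0 up (um - up)) (normalized_source g up (um - up)) eps sg y ->
  smooth y -> y 0 = / 2 -> Rabs sg <= C * eps ->
  (forall x, Rabs (y x - y0 x) <= D * eps * weight (- ar) (- al) x) ->
  (forall x, Rabs (Derive y x - Derive y0 x) <= D * eps * weight (- ar) (- al) x) ->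
  C + Rabs (um - up) * D * (2 + al) + Rabs (um - up) * D * (2 + ar) <= C0 ->
  is_close_profile f g s0 um up U0 al ar C0 eps (s0 + sg) (fun x => up + (um - up) * y x).
Proof.
  intros Hf Hne Hal Har HD Heps HU0 Hs0 Hw Hs Hy0 Hsg H1 H2 HC0.
  set (d := um - up) in *. assert (Hd : d <> 0) by (unfold d; lra).
  assert (Hsm : smooth (fun x => up + d * y x)).
  { apply smooth_plus; [apply smooth_constant | now apply smooth_scal]. }
  split; [now apply smooth_class_C | ]. split; [rewrite Hy0; unfold d; field | ].
  split; [now apply travelling_of_wave | ].
  set (h := fun x => up + d * y x - U0 x).
  assert (Eh : forall x, h x = d * (y x - y0 x)) by (intros x; unfold h; rewrite HU0; ring).
  assert (Hh : forall x, is_derive h x (d * (Derive y x - Derive y0 x))).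
  { intros x. apply (is_derive_ext (fun x => d * (y x - y0 x))).
    - intros t. symmetry. apply Eh.
    - apply is_derive_scal. apply (is_derive_minus (V := R_NormedModule));
        now apply smooth_is_derive. }
  assert (Hhe : forall x, ex_derive h x) by (intros x; eexists; apply Hh).
  assert (P := Rabs_pos d).
  assert (HDe : 0 <= D * eps) by nra.
  set (N := Rabs d * (D * eps)). assert (HN : 0 <= N) by (unfold N; nra).
  assert (B1 : forall x, Rabs (h x) <= N * weight (- ar) (- al) x).
  { intros x. rewrite Eh, Rabs_mult. unfold N. rewrite Rmult_assoc.
    apply Rmult_le_compat_l; auto. }
  assert (B2 : forall x, Rabs (Derive h x) <= N * weight (- ar) (- al) x).
  { intros x. rewrite (is_derive_unique _ _ _ (Hh x)), Rabs_mult. unfold N. rewrite Rmult_assoc.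
    apply Rmult_le_compat_l; auto. }
  assert (WL := W1inf_norm_weighted_le _ _ al (-1) h N N (half_line_weight_left al) Hhe
    ltac:(lra) HN).
  assert (WR := W1inf_norm_weighted_le _ _ ar 1 h N N (half_line_weight_right ar) Hhe
    ltac:(lra) HN).
  eapply Rbar_le_trans.
  - apply Rbar_plus_le_compat; [apply Rbar_plus_le_compat | ].
    + apply Rbar_le_refl.
    + apply WL.
      * intros x Hx. specialize (B1 x). rewrite weight_left in B1 by lra.
        now replace (-1 * x) with (- x) by ring.
      * intros x Hx. specialize (B2 x). rewrite weight_left in B2 by lra.
        now replace (-1 * x) with (- x) by ring.
    + apply WR.
      * intros x Hx. specialize (B1 x). rewrite weight_right in B1 by lra.
        now rewrite Rmult_1_l.
      * intros x Hx. specialize (B2 x). rewrite weight_right in B2 by lra.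
        now rewrite Rmult_1_l.
  - simpl. replace (s0 + sg - s0) with sg by ring.
    apply Rle_trans with ((C + Rabs d * D * (2 + al) + Rabs d * D * (2 + ar)) * eps).
    + unfold N. lra.
    + now apply Rmult_le_compat_r.
Qed.

Theorem proposition1 (f g : R -> R) (s0 um up : R) (U0 : R -> R)
  (hf : class_Cinf f) (hg : class_Cinf g)
  (hshock : strictly_entropic_shock f g s0 um up)
  (hgp : Derive g up < 0) (hgm : Derive g um < 0)
  (hU0 : is_profile0 f s0 um up U0)
  (al ar : R) (k0 : nat)
  (hal : 0 < al < theta_l f g um 0 s0)
  (har : 0 < ar < theta_r f g up 0 s0)
  (hk0 : (1 <= k0)%nat) :
  exists eps0 C0 : R, 0 < eps0 /\ 0 < C0 /\
  forall eps : R, 0 < eps <= eps0 ->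
  exists (s : R) (U : R -> R),
    is_close_profile f g s0 um up U0 al ar C0 eps s U /\
    (forall (s' : R) (U' : R -> R),
       is_close_profile f g s0 um up U0 al ar C0 eps s' U' ->
       s' = s /\ forall x, U' x = U x) /\
    Rbar_le
      (Linf_norm Rminus_half (fun x =>
         exp (theta_l f g um eps s * Rabs x) * (U x - um)
         - exp (theta_l f g um 0 s0 * Rabs x) * (U0 x - um)))
      (Finite (C0 * eps)) /\
    Rbar_le
      (Linf_norm Rplus_half (fun x =>
         exp (theta_r f g up eps s * x) * (U x - up)
         - exp (theta_r f g up 0 s0 * x) * (U0 x - up)))
      (Finite (C0 * eps)) /\
    forall k : nat, (1 <= k <= k0)%nat ->
      (forall x, ex_derive_n U k x) /\
      Rbar_le
        (Linf_norm Rminus_half (fun x =>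
           exp (theta_l f g um eps s * Rabs x) * Derive_n U k x
           - exp (theta_l f g um 0 s0 * Rabs x) * Derive_n U0 k x))
        (Finite (C0 * eps)) /\
      Rbar_le
        (Linf_norm Rplus_half (fun x =>
           exp (theta_r f g up eps s * x) * Derive_n U k x
           - exp (theta_r f g up 0 s0 * x) * Derive_n U0 k x))
        (Finite (C0 * eps)).
Proof.
  assert (HN := normalized_shock_of_shock f g s0 um up hf hg hshock hgp hgm).
  assert (Hf := class_Cinf_smooth f hf). assert (Hg := class_Cinf_smooth g hg).
  destruct hshock as [Hne [_ [_ [_ [Hlm [Hlp _]]]]]].
  assert (HP := inviscid_profile_of_profile0 f s0 um up U0 Hne hU0).
  set (d := um - up) in *. assert (Hd : d <> 0) by (unfold d; lra).
  assert (Hdp := Rabs_pos_lt d Hd).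
  set (F := normalized_flux f s0 up d) in *. set (G := normalized_source g up d) in *.
  set (y0 := fun x => / d * (U0 x - up)) in *.
  assert (EF0 : Derive F 0 = Derive f up - s0).
  { unfold F. rewrite Derive_normalized_flux by easy. do 2 f_equal. ring. }
  assert (EF1 : Derive F 1 = Derive f um - s0).
  { unfold F. rewrite Derive_normalized_flux by easy. do 2 f_equal. unfold d. ring. }
  assert (EG0 : Derive G 0 = Derive g up).
  { unfold G. rewrite Derive_normalized_source by easy. f_equal. ring. }
  assert (EG1 : Derive G 1 = Derive g um).
  { unfold G. rewrite Derive_normalized_source by easy. f_equal. unfold d. ring. }
  assert (TL0 : theta_l f g um 0 s0 = Derive F 1) by (rewrite theta_l_at_0; lra).
  assert (TR0 : theta_r f g up 0 s0 = - Derive F 0) by (rewrite theta_r_at_0; lra).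
  rewrite TL0 in hal |- *. rewrite TR0 in har |- *.
  assert (HsF := ns_F HN). assert (HsG := ns_G HN).
  destruct (normalized_existence F G y0 al ar k0 HN HP har hal)
    as [eps1 [C [D [Heps1 [HC [HD Hex]]]]]].
  destruct (normalized_uniqueness F G y0 HN HP) as [eta [Heta Huniq]].
  assert (Hs0 : smooth y0) by (apply (wave_smooth F G 0 0); auto using inviscid_profile_wave).
  assert (HU0 : forall x, U0 x = up + d * y0 x) by (intros x; unfold y0; field; exact Hd).
  assert (HU0s : smooth U0).
  { intros n x. apply (ex_derive_n_ext (fun x => up + d * y0 x)); [intros; symmetry; apply HU0 | ].
    apply smooth_plus; [apply smooth_constant | now apply smooth_scal]. }
  assert (HU0n : forall n x, Derive_n U0 (S n) x = d * Derive_n y0 (S n) x).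
  { intros n x. rewrite (Derive_n_ext _ _ _ _ HU0). now apply Derive_n_affine_image. }
  set (dD := Rabs d * D). assert (HdD : 0 <= dD) by (unfold dD; nra).
  set (C0 := C + dD * (2 + al) + dD * (2 + ar) + 1).
  assert (HdDl : 0 <= dD * (1 + al)) by nra. assert (HdDr : 0 <= dD * (1 + ar)) by nra.
  assert (HC0 : 0 < C0) by (unfold C0; lra).
  assert (HdC0 : dD <= C0) by (unfold C0; lra).
  (* [e2] keeps [f'(up) - s] nonpositive, which removes the absolute value in [theta_r]; [e3] puts
     every candidate of the uniqueness part in the neighbourhood of [normalized_uniqueness] *)
  set (e2 := - Derive F 0 / (C + 1)).
  set (e3 := eta * Rabs d / ((1 + al + ar) * C0)).
  assert (HF0 := ns_dF0 HN). assert (HF1 := ns_dF1 HN).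
  assert (He2 : 0 < e2) by (unfold e2; apply Rdiv_lt_0_compat; lra).
  assert (He3 : 0 < e3) by (unfold e3; apply Rdiv_lt_0_compat; nra).
  exists (Rmin eps1 (Rmin e2 e3)), C0.
  assert (L1 := Rmin_l eps1 (Rmin e2 e3)). assert (L2 := Rmin_r eps1 (Rmin e2 e3)).
  assert (L3 := Rmin_l e2 e3). assert (L4 := Rmin_r e2 e3).
  split; [now repeat apply Rmin_pos | ]. split; [easy | ].
  intros eps [Heps Hepsle].
  destruct (Hex eps ltac:(lra)) as [sg [z [y [Hpp Hpe]]]].
  destruct (perturbed_profile_derive F G y0 C eps sg z y HN HP Hpp) as [Hyr [Hy0 [Hyd Hw]]].
  assert (Hsf := pp_slope Hpp).
  assert (Hsg := sf_speed Hsf).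
  assert (Hys : smooth y) by now apply (wave_smooth F G eps sg).
  assert (HCe : C * eps <= - Derive F 0).
  { apply Rle_trans with ((C + 1) * e2); [nra | ]. unfold e2. right. field. lra. }
  assert (TL : theta_l f g um eps (s0 + sg) = rate_l F z).
  { rewrite (rate_l_formula F G C eps sg z HN Hsf) by lra.
    unfold theta_l. rewrite EF1, EG1. repeat (f_equal; try ring). }
  assert (TR : theta_r f g up eps (s0 + sg) = rate_r F z).
  { rewrite (rate_r_formula F G C eps sg z HN Hsf) by lra.
    unfold theta_r. rewrite EF0, EG0 in *. apply Rabs_le_between in Hsg.
    rewrite Rabs_left1 by lra.
    repeat (f_equal; try ring). }
  exists (s0 + sg), (fun x => up + d * y x). rewrite TL, TR.
  assert (HUn : forall n x, Derive_n (fun x => up + d * y x) (S n) x = d * Derive_n y (S n) x).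
  { intros n x. now apply Derive_n_affine_image. }
  assert (Hscale : forall r, Rabs r <= D * eps -> Rabs (d * r) <= C0 * eps).
  { intros r Hr. rewrite Rabs_mult. apply Rle_trans with (Rabs d * (D * eps)).
    - apply Rmult_le_compat_l; lra.
    - rewrite <- Rmult_assoc. fold dD. apply Rmult_le_compat_r; lra. }
  split; [ | split; [ | split; [ | split]]].
  - apply (profile_is_close f g s0 um up U0 y0 al ar C D); auto; try lra.
    + apply (pe_height Hpe).
    + apply (pe_slope Hpe).
    + fold d. fold dD. unfold C0. lra.
  - intros s' V HV.
    destruct (close_profile_bounds f g s0 um up U0 al ar C0 eps s' V) as [HCe0 [Hb1 Hb2]];
      try lra; try easy.
    { now apply smooth_class_C. }
    { apply hU0. }
    destruct HV as [HVC [HV0 [HVeq _]]].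
    destruct (wave_of_travelling f g s0 up d eps s' V Hf Hd HVC HVeq) as [HVw HVd].
    set (u := fun x => / d * (V x - up)) in *.
    set (M := (1 + al + ar) * (C0 * eps)) in *.
    assert (HMeta : M * / Rabs d <= eta).
    { apply Rmult_le_reg_r with (Rabs d); [easy | ].
      rewrite Rmult_assoc, Rinv_l, Rmult_1_r by lra.
      unfold M. apply Rle_trans with ((1 + al + ar) * C0 * e3).
      - rewrite <- Rmult_assoc. apply Rmult_le_compat_l; [nra | lra].
      - unfold e3. right. field. split; lra. }
    assert (Eu : forall x, u x - y0 x = / d * (V x - U0 x)) by (intros x; unfold u, y0; ring).
    assert (EDu : forall x, Derive u x - Derive y0 x = / d * (Derive V x - Derive U0 x)).
    { intros x. rewrite HVd.
      assert (H : Derive U0 x = d * Derive y0 x) by exact (HU0n 0%nat x).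
      rewrite H. field. exact Hd. }
    assert (Hinv : forall r m, Rabs r <= m -> Rabs (/ d * r) <= m * / Rabs d).
    { intros r m Hr. rewrite Rabs_mult, Rabs_inv, Rmult_comm.
      apply Rmult_le_compat_r; [left; now apply Rinv_0_lt_compat | easy]. }
    assert (HM0 : 0 <= M) by (unfold M; apply Rmult_le_pos; lra).
    assert (Hb : 0 < Rmin al ar) by (apply Rmin_pos; lra).
    assert (HMd : 0 <= M * / Rabs d)
      by (apply Rmult_le_pos; [easy | left; now apply Rinv_0_lt_compat]).
    destruct (Huniq C eps sg z y (s' - s0) u HC Heps Hpp HVw) as [Hsig Hu].
    + unfold u. rewrite HV0. unfold d. field. lra.
    + intros x. rewrite Eu. eapply Rle_trans; [apply Hinv, Hb1 | easy].
    + intros x. rewrite EDu. eapply Rle_trans; [apply Hinv, Hb1 | easy].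
    + apply (vanishes_exp _ (M * / Rabs d) (Rmin al ar)); [easy | easy | ].
      intros x Hx. rewrite Eu. eapply Rle_trans; [apply Hinv, Hb2, Hx | ]. right. ring.
    + apply (vanishes_exp _ (M * / Rabs d) (Rmin al ar)); [easy | easy | ].
      intros x Hx. rewrite EDu. eapply Rle_trans; [apply Hinv, Hb2, Hx | ]. right. ring.
    + split; [lra | ]. intros x. rewrite <- Hu. unfold u. field. exact Hd.
  - apply (Linf_norm_le _ _ 0). intros x Hx Hx0. destruct Hx as [Hx | Hx]; [ | contradiction].
    rewrite (Rabs_left x), HU0 by lra.
    assert (H := pe_left Hpe x ltac:(lra)).
    rewrite <- Rabs_Ropp in H. apply Hscale in H.
    eapply Rle_trans; [ | exact H]. right. f_equal. unfold d. ring.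
  - apply (Linf_norm_le _ _ 0). intros x Hx Hx0. unfold Rplus_half in Hx.
    rewrite HU0.
    assert (H := pe_right Hpe x Hx). apply Hscale in H.
    eapply Rle_trans; [ | exact H]. right. f_equal. ring.
  - intros k Hk. destruct k as [ | k]; [lia | ].
    split; [ | split].
    + intros x. apply smooth_plus; [apply smooth_constant | now apply smooth_scal].
    + apply (Linf_norm_le _ _ 0). intros x Hx Hx0. destruct Hx as [Hx | Hx]; [ | contradiction].
      assert (H := pe_derivatives Hpe (S k) x Hk).
      rewrite !weight_left in H by lra. apply Hscale in H.
      rewrite (Rabs_left x), HUn, HU0n by lra.
      eapply Rle_trans; [ | exact H]. right. f_equal. ring.
    + apply (Linf_norm_le _ _ 0). intros x Hx Hx0. unfold Rplus_half in Hx.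
      assert (H := pe_derivatives Hpe (S k) x Hk).
      rewrite !weight_right in H by lra. apply Hscale in H.
      rewrite HUn, HU0n.
      eapply Rle_trans; [ | exact H]. right. f_equal. ring.
Qed.
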